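(* Let $\omega=(w_1,w_2)\in\mathbb{R}^2$ and let $\alpha,\beta:(\mathbb{R},0)\to(SE(2),(0,E))$ be $C^\infty$ curve-germs which have singular points at $0$, written as $$\alpha(u)=\big((u^2a_1(u),u^2a_2(u)),\,u^2p(u)\big),\qquad \beta(v)=\big((v^2b_1(v),v^2b_2(v)),\,v^2q(v)\big),$$ where $a_1,a_2,p,b_1,b_2,q$ are smooth function-germs at $0$ and $SO(2)$ is identified with $S^1=\mathbb{R}/2\pi\mathbb{Z}$ by the rotation angle. Let $\nu(u,v)=\beta(v)\alpha(u)$ be the composite motion of $\alpha$ and $\beta$. Then $0$ is a corank $2$ singular point of $f=ev_\omega\circ\nu$. Furthermore, $ev_\omega\circ\nu$ at $0$ is a sharksfin if and only if $$\det\begin{pmatrix} 1 & w_2 & -w_1 \\ p(0) & a_1(0) & a_2(0) \\ q(0) & b_1(0) & b_2(0) \end{pmatrix}\neq0,$$ $$\det\begin{pmatrix} 1 & w_2 & -w_1 \\ p(0) & a_1(0) & a_2(0) \\ p'(0) & a_1'(0) & a_2'(0) \end{pmatrix}\neq0,\qquad \det\begin{pmatrix} 1 & w_2 & -w_1 \\ q(0) & b_1(0) & b_2(0) \\ q'(0) & b_1'(0) & b_2'(0) \end{pmatrix}\neq0.$$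
   Context: All maps and germs are $C^\infty$. $SE(2)=\mathbb{R}^2\rtimes SO(2)$ is the Lie group of pairs $(a,A)$ with $a\in\mathbb{R}^2$ and $A=\begin{pmatrix}\cos\theta&-\sin\theta\\ \sin\theta&\cos\theta\end{pmatrix}$, $\theta\in S^1=\mathbb{R}/2\pi\mathbb{Z}$, acting on $\mathbb{R}^2$ by $x\mapsto Ax+a$, with product $(b,B)(a,A)=(b+Ba,BA)$; $E$ is the identity matrix. A curve-germ $\alpha$ has a singular point at $0$ if its derivative vanishes at $0$. For $\omega\in\mathbb{R}^2$, $ev_\omega:SE(2)\to\mathbb{R}^2$ is $ev_\omega(a,A)=A\omega+a$. The composite motion $\nu:(\mathbb{R},0)\times(\mathbb{R},0)\to SE(2)$ is $\nu(u,v)=\beta(v)\alpha(u)$ (product in $SE(2)$). A point $0$ is a corank $2$ singular point of a map-germ $f$ from the plane into the plane if $\operatorname{rank} df_0=0$. A map-germ $f$ from $(\mathbb{R}^2,0)$ into $\mathbb{R}^2$ is a sharksfin at $0$ if, after translating $f(0)$ to the origin of the target, it is $\mathcal{A}$-equivalent to the germ at the origin of $(u,v)\mapsto(uv,u^2+v^2+u^3)$, where $f_1,f_2:(\mathbb{R}^2,0)\to(\mathbb{R}^2,0)$ are $\mathcal{A}$-equivalent if there exist diffeomorphism-germs $\phi$ of the source and $\Phi$ of the target with $\Phi\circ f_1=f_2\circ\phi$. *)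

(* Defs.v *)
From HB Require Import structures.
From mathcomp Require Import all_boot all_order all_algebra.
From mathcomp Require Import all_classical all_reals all_analysis.
Set Implicit Arguments.
Unset Strict Implicit.
Unset Printing Implicit Defensive.
Import Order.TTheory GRing.Theory Num.Theory.
Import numFieldNormedType.Exports.
Local Open Scope classical_set_scope.
Local Open Scope ring_scope.

Definition mx_of_seqs (R : nzRingType) m n (s : seq (seq R)) : 'M[R]_(m, n) :=
  \matrix_(i, j) nth 0 (nth [::] s i) j.

Definition row2 (R : nzRingType) (x y : R) : 'rV[R]_2 :=
  mx_of_seqs 1 2 [:: [:: x; y]].

Section smooth_germs.
Context {R : realType}.

(* C^k on an open set U. The recursion is correct when V is finite-dimensional,
   since continuity of 'd f (with values in linear maps) is then equivalent to
   continuity of 'D_v f for every v. Only used with V = R and V = R^2. *)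
Fixpoint Ck_on {V W : normedModType R} (k : nat) (U : set V) (f : V -> W)
    : Prop :=
  match k with
  | 0 => forall x, U x -> {for x, continuous f}
  | k'.+1 => (forall x, U x -> differentiable f x) /\
             (forall v, Ck_on k' U (fun x => 'D_v f x))
  end.

(* f represents a C^oo germ at x: all orders of smoothness hold on the same
   neighborhood. *)
Definition smooth_at {V W : normedModType R} (f : V -> W) (x : V) : Prop :=
  exists U : set V, [/\ open U, U x & forall k, Ck_on k U f].

Definition diffeo_germ (phi : 'rV[R]_2 -> 'rV[R]_2) : Prop :=
  [/\ phi 0 = 0, smooth_at phi 0 &
    exists psi : 'rV[R]_2 -> 'rV[R]_2,
      [/\ psi 0 = 0, smooth_at psi 0,
          \forall x \near (0 : 'rV[R]_2), psi (phi x) = x &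
          \forall y \near (0 : 'rV[R]_2), phi (psi y) = y]].

Definition A_equivalent (f1 f2 : 'rV[R]_2 -> 'rV[R]_2) : Prop :=
  exists phi Phi : 'rV[R]_2 -> 'rV[R]_2,
    [/\ diffeo_germ phi, diffeo_germ Phi &
      \forall x \near (0 : 'rV[R]_2), Phi (f1 x) = f2 (phi x)].

Definition sharksfin_model (x : 'rV[R]_2) : 'rV[R]_2 :=
  let u := x 0 0 in let v := x 0 1 in
  row2 (u * v) (u ^+ 2 + v ^+ 2 + u ^+ 3).

Definition sharksfin_at0 (f : 'rV[R]_2 -> 'rV[R]_2) : Prop :=
  smooth_at f 0 /\ A_equivalent (fun x => f x - f 0) sharksfin_model.

(* Smoothness makes the Jacobian meaningful: 'd f 0 is a default value when f
   is not differentiable at 0. *)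
Definition corank2_singular_at0 (f : 'rV[R]_2 -> 'rV[R]_2) : Prop :=
  smooth_at f 0 /\ \rank (jacobian f 0) = 0%N.

End smooth_germs.

Section SE2.
Context {R : realType}.

Definition rotmx (t : R) : 'M[R]_2 :=
  mx_of_seqs 2 2 [:: [:: cos t; - sin t]; [:: sin t; cos t]].

(* Points of the plane are row vectors, so A x + a is written x *m A^T + a. *)
Record se2 := SE2 {
  se2_trans : 'rV[R]_2 ;
  se2_rot : 'M[R]_2 ;
  se2_rotP : exists t, se2_rot = rotmx t }.

Lemma rotmx0 : rotmx 0 = 1%:M.
Proof.
apply/matrixP => i j; rewrite !mxE cos0 sin0 oppr0.
by case: i => [[|[|[]]]] //= ?; case: j => [[|[|[]]]].
Qed.

Lemma rotmxD (s t : R) : rotmx s *m rotmx t = rotmx (s + t).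
Proof.
apply/matrixP => i j; rewrite !mxE big_ord_recl big_ord1 !mxE cosD sinD.
case: i => [[|[|[]]]] //= ?; case: j => [[|[|[]]]] //= ?.
- by rewrite mulNr.
- by rewrite mulrN mulNr opprD addrC.
- by rewrite mulrN addrC.
Qed.

Lemma se2_one_subproof : exists t, 1%:M = rotmx t.
Proof. by exists 0; rewrite rotmx0. Qed.

Definition se2_one : se2 := SE2 0 se2_one_subproof.

Lemma se2_mul_subproof (g h : se2) :
  exists t, se2_rot g *m se2_rot h = rotmx t.
Proof.
by have [[s ->] [t ->]] := (se2_rotP g, se2_rotP h); exists (s + t); rewrite rotmxD.
Qed.

Definition se2_mul (g h : se2) : se2 :=
  SE2 (se2_trans g + se2_trans h *m (se2_rot g)^T) (se2_mul_subproof g h).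

Definition se2_act (g : se2) (x : 'rV[R]_2) : 'rV[R]_2 :=
  x *m (se2_rot g)^T + se2_trans g.

Definition ev (w : 'rV[R]_2) (g : se2) : 'rV[R]_2 := se2_act g w.

Definition se2_of_angle (a : 'rV[R]_2) (t : R) : se2 :=
  SE2 a (ex_intro _ t erefl).

(* SE(2) carries the smooth structure of a closed submanifold of R^2 x M_2(R),
   so curves are differentiated componentwise. *)
Definition se2_curve_germ (alpha : R -> se2) : Prop :=
  [/\ alpha 0 = se2_one,
      smooth_at (fun u : R => se2_trans (alpha u)) 0 &
      smooth_at (fun u : R => se2_rot (alpha u)) 0].

Definition se2_singular_at0 (alpha : R -> se2) : Prop :=
  derive1 (fun u : R => se2_trans (alpha u)) 0 = 0 /\
  derive1 (fun u : R => se2_rot (alpha u)) 0 = 0.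

Definition composite_motion (alpha beta : R -> se2) (x : 'rV[R]_2) : se2 :=
  se2_mul (beta (x 0 1)) (alpha (x 0 0)).

End SE2.
Arguments se2 : clear implicits.

(* Main.v *)
Require Import Defs.
From HB Require Import structures.
From mathcomp Require Import all_boot all_order all_algebra.
From mathcomp Require Import all_classical all_reals all_analysis.
From mathcomp Require Import ring lra.
Set Implicit Arguments.
Unset Strict Implicit.
Unset Printing Implicit Defensive.
Import Order.TTheory GRing.Theory Num.Theory.
Import numFieldNormedType.Exports.
Local Open Scope classical_set_scope.
Local Open Scope ring_scope.

(* Write [u^2 p(u)] and [v^2 q(v)] for the angles. Expanding [cos] and [sin],
   [f(u,v) - f(0) = u^2 A(u) + v^2 B(v) + u^2 v^2 C(u,v)], and the three 3x3
   determinants are [det(A(0),B(0))], [det(A(0),A'(0))] and [det(B(0),B'(0))]. For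
   such a germ the axes are the singular set, crossed transversally by the kernel.

   Sufficiency: if the determinants do not vanish, the images of the axes are two
   cusps with transverse tangents. Target diffeomorphisms and reparametrizations
   carry them to [(x^2,x^3)] and [(y^3,y^2)] (this uses Whitney's theorem that a
   smooth germ is [e(x^2) + x o(x^2)], hence Borel's theorem). By Hadamard division
   the germ then differs from [N(x,y) = (x^2+y^3, y^2+x^3)] by a multiple of
   [x^2 y^2], which the implicit function theorem absorbs into the source, so that
   it is equivalent to [N]. The sharksfin, in a chart straightening the two
   branches of its singular set, is such a germ as well.

   Necessity: if a determinant vanishes, a linear functional of [f - f(0)] vanishes
   to order 3 at 0, or to order 4 along an axis. The corresponding function of the
   target of the model has a nonzero linear part, which is impossible by the
   expansion of the model at 0 and along its singular set [2 v^2 = 2 u^2 + 3 u^3]. *)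

(** Two maps that satisfy the kernel condition of [prenormal] and agree on the axes have the same
    transverse derivatives there, so their difference has a double zero on each axis: this is the
    origin of the factor [x^2 y^2]. It reduces the classification of germs to that of the two curves
    drawn by the axes, with independent parameters. Adding [x y^2 k] to [x] and [x^2 y m] to [y]
    changes [x^2] and [y^2] by [2 x^2 y^2 k] and [2 x^2 y^2 m] to leading order, which is why such a
    difference can be solved away. The obstacle lies in the pair of cusps. A target change that
    fixes the first cusp [X^3 = Y^2] pointwise alters the coordinates by multiples of [X^3 - Y^2],
    and a function of [X, Y] restricted to the second cusp is a function of [y^2] and [y^3 S],
    without a term of degree 1 in [y]. One coefficient, that of [y^5], is out of reach of these
    changes and has to be removed beforehand. The vectors [A(0)] and [B(0)] are the velocities at
    the point [w] of the infinitesimal motions [(a, p)] and [(b, q)]; the row [(1, w2, -w1)] of the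
    determinants performs this evaluation at [w]. *)

Section Ck_calculus.
Context {R : realType}.

Section gen.
Context {V W : normedModType R}.
Implicit Types (U : set V) (k : nat).

Lemma Ck_on_sub k U U' (f : V -> W) : U' `<=` U -> Ck_on k U f -> Ck_on k U' f.
Proof.
move=> sub; elim: k f => [f /= cf x /sub /cf //|k IH f /= [df Df]].
by split=> [x /sub /df //|v]; exact: IH.
Qed.

Lemma near_open U (x : V) : open U -> U x -> \forall y \near x, U y.
Proof. by move=> oU Ux; apply: open_nbhs_nbhs. Qed.

(** Differentials are found by hand below, for implicit solutions, integrals with a parameter and
    series; in each case an explicit estimate of the remainder is what is at hand. *)
Lemma differentiable_criterion (f : V -> W) (x : V) (L : {linear V -> W}) :
  continuous L ->
  (forall e : R, 0 < e ->
    \forall y \near x, `|f y - f x - L (y - x)| <= e * `|y - x|) ->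
  differentiable f x /\ 'd f x = L :> (V -> W).
Proof.
move=> cL H.
have E : f \o shift x = cst (f x) + L +o_ 0 id.
  apply/eqaddoP => e e0; have := H e e0.
  rewrite (near_shift 0 x) subr0.
  apply: filter_app; near=> y => /=.
  by rewrite addrK !fctE /= opprD addrA.
have dE := diff_unique cL E; split=> //.
apply/diff_locallyP; rewrite dE; split => //.
Unshelve. all: by end_near. Qed.

Lemma differentiable_approx (f : V -> W) (x : V) :
  differentiable f x ->
  forall e : R, 0 < e ->
    \forall y \near x, `|f y - f x - 'd f x (y - x)| <= e * `|y - x|.
Proof.
move=> /diff_locallyP [_ /eqaddoP H] e e0.
have {H} : \forall h \near (0 : V), `|f (h + x) - f x - 'd f x h| <= e * `|h|.
  have := H e e0; apply: filter_app; near=> h.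
  by rewrite /= !fctE /= opprD addrA.
rewrite (near_shift x 0) sub0r; apply: filter_app; near=> y.
by rewrite /= subrK.
Unshelve. all: by end_near. Qed.

Lemma differentiable_near_eq (f g : V -> W) (x : V) :
  (\forall y \near x, f y = g y) -> differentiable f x -> differentiable g x.
Proof.
move=> fg df; have fgx := nbhs_singleton fg.
apply: (differentiable_criterion (L := 'd f x) _ _).1.
  exact: diff_continuous.
move=> e e0; have := differentiable_approx df e0; apply: filter_app.
by near=> y; rewrite -fgx; have -> : f y = g y by near: y.
Unshelve. all: by end_near. Qed.

End gen.
End Ck_calculus.

(** * Closure properties of C^k maps *)

Section Ck_closure.
Context {R : realType}.

Section gen.
Context {V W : normedModType R}.
Implicit Types (U : set V) (k : nat).

Lemma Ck_on_eq k U (f g : V -> W) : open U -> (forall x, U x -> f x = g x) ->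
  Ck_on k U f -> Ck_on k U g.
Proof.
move=> oU; elim: k f g => [f g fg /= cf x Ux|k IH f g fg /= [df Df]].
  have nfg : \forall y \near x, f y = g y.
    by have := near_open oU Ux; apply: filterS => y /fg.
  rewrite /prop_for /continuous_at -(fg _ Ux).
  by apply: cvg_trans (cf x Ux); apply: near_eq_cvg.
split=> [x Ux|v].
  apply: differentiable_near_eq (df _ Ux).
  by have := near_open oU Ux; apply: filterS => y /fg.
apply: IH (Df v) => x Ux; apply: near_eq_derive.
by have := near_open oU Ux; apply: filterS => y /fg.
Qed.

Lemma Ck_on_pred k U (f : V -> W) : Ck_on k.+1 U f -> Ck_on k U f.
Proof.
elim: k f => [f [df _] x /df|k IH f [df Df]]; first exact: differentiable_continuous.
by split=> // v; exact: IH (Df v).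
Qed.

Lemma Ck_on_cst k U (c : W) : open U -> Ck_on k U (fun=> c).
Proof.
move=> oU; elim: k c => [c x _|k IH c]; first exact: cst_continuous.
split=> [x _|v]; first exact: differentiable_cst.
by apply: (@Ck_on_eq _ _ (fun=> 0)) => // x _; rewrite derive_cst.
Qed.

Lemma Ck_onD k U (f g : V -> W) : open U -> Ck_on k U f -> Ck_on k U g ->
  Ck_on k U (fun x => f x + g x).
Proof.
move=> oU; elim: k f g => [f g /= cf cg x Ux|k IH f g [df Df] [dg Dg]].
  by apply: cvgD; [exact: cf|exact: cg].
split=> [x Ux|v]; first by apply: differentiableD; [exact: df|exact: dg].
apply: (Ck_on_eq oU _ (IH _ _ (Df v) (Dg v))) => x Ux.
by rewrite deriveD //; apply: diff_derivable; [exact: df|exact: dg].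
Qed.

Lemma Ck_onZ k U (c : R) (f : V -> W) : open U -> Ck_on k U f ->
  Ck_on k U (fun x => c *: f x).
Proof.
move=> oU; elim: k f => [f /= cf x Ux|k IH f [df Df]].
  by apply: cvgZ; [exact: cvg_cst|exact: cf].
split=> [x Ux|v]; first by apply: differentiableZ; exact: df.
apply: (Ck_on_eq oU _ (IH _ (Df v))) => x Ux.
by rewrite deriveZ //; apply: diff_derivable; exact: df.
Qed.

End gen.

Lemma Ck_on_lin {V W : normedModType R} k (U : set V) (L : {linear V -> W}) :
  open U -> continuous L -> Ck_on k U L.
Proof.
move=> oU cL; case: k => [x _|k]; first exact: cL.
split=> [x _|v]; first exact: linear_differentiable.
apply: (Ck_on_eq oU _ (Ck_on_cst k (L v) oU)) => x Ux.
by rewrite deriveE ?diff_lin//; exact: linear_differentiable.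
Qed.

Section scalar.
Context {V : normedModType R}.
Implicit Types (U : set V) (k : nat) (f g : V -> R).

Lemma Ck_onM k U f g : open U -> Ck_on k U f -> Ck_on k U g ->
  Ck_on k U (fun x => f x * g x).
Proof.
move=> oU; elim: k f g => [f g /= cf cg x Ux|k IH f g Hf Hg].
  by apply: cvgM; [exact: cf|exact: cg].
have [[df Df] [dg Dg]] := (Hf, Hg).
split=> [x Ux|v]; first by apply: differentiableM; [exact: df|exact: dg].
apply: (Ck_on_eq oU _ (Ck_onD oU (IH _ _ (Ck_on_pred Hf) (Dg v))
   (IH _ _ (Ck_on_pred Hg) (Df v)))) => x Ux.
by rewrite deriveM //; apply: diff_derivable; [exact: df|exact: dg].
Qed.

Lemma Ck_onV k U f : open U -> (forall x, U x -> f x != 0) -> Ck_on k U f ->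
  Ck_on k U (fun x => (f x)^-1).
Proof.
move=> oU f0; elim: k => [/= cf x Ux|k IH Hf].
  by apply: cvgV; [exact: f0|exact: cf].
have [df Df] := Hf.
split=> [x Ux|v]; first by apply: differentiableV; [exact: df|exact: f0].
have HV := IH (Ck_on_pred Hf).
apply: (Ck_on_eq oU _ (Ck_onZ (-1) oU (Ck_onM oU (Ck_onM oU HV HV) (Df v)))) => x Ux.
rewrite deriveV //; [|exact: f0|by apply: diff_derivable; exact: df].
by rewrite -exprVn expr2 scaleN1r -mulNr.
Qed.

Lemma Ck_on_comp1 k U (V' : set R) (g : R -> R) f : open U -> open V' ->
  (forall x, U x -> V' (f x)) ->
  Ck_on k V' g -> Ck_on k U f -> Ck_on k U (fun x => g (f x)).
Proof.
move=> oU oV' UV'; elim: k g => [g /= cg cf x Ux|k IH g Hg Hf].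
  by apply: continuous_comp; [exact: cf|apply: cg; exact: UV'].
have [[df Df] [dg Dg]] := (Hf, Hg).
split=> [x Ux|v].
  by apply: differentiable_comp; [exact: df|apply: dg; exact: UV'].
apply: (Ck_on_eq oU _ (Ck_onM oU (Df v) (IH _ (Dg 1) (Ck_on_pred Hf)))) => x Ux.
have dgx : differentiable g (f x) by apply: dg; exact: UV'.
have dfx := df _ Ux.
rewrite [RHS]deriveE; last exact: differentiable_comp.
have E1 : 'D_1 g (f x) = 'd g (f x) 1 by rewrite deriveE.
rewrite (@diff_comp _ _ _ _ f g) //= (deriveE v dfx) E1.
by rewrite -[in RHS](mulr1 ('d f x v)) -[X in _ = 'd g _ X]/(_ *: 1) linearZ.
Qed.

Lemma rV_sum_delta n (v : 'rV[R]_n) : v = \sum_i v 0 i *: delta_mx 0 i.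
Proof.
rewrite {1}[v]matrix_sum_delta big_ord1.
by [].
Qed.

Lemma derive_rV_sum n (W : normedModType R) (g : 'rV[R]_n -> W) y v : differentiable g y ->
  'D_v g y = \sum_i v 0 i *: 'D_(delta_mx 0 i) g y.
Proof.
move=> dg; rewrite deriveE // {1}[v]rV_sum_delta linear_sum.
by apply: eq_bigr => i _; rewrite linearZ /= deriveE.
Qed.

End scalar.

Section matrix_valued.
Context {V : normedModType R} {m n : nat}.

Lemma differentiable_mxP (F : V -> 'M[R]_(m, n)) x :
  differentiable F x <-> forall i j, differentiable (fun x => F x i j) x.
Proof.
split=> [dF i j|dF].
  by apply: (@differentiable_comp _ _ _ _ F (fun M => M i j)) => //;
     exact: differentiable_coord.
have -> : F = \sum_(i < m) \sum_(j < n) (fun x => F x i j *: delta_mx i j).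
  apply/funext => y; rewrite [F y]matrix_sum_delta fct_sumE.
  by apply: eq_bigr => i _; rewrite fct_sumE.
apply: differentiable_sum => i; apply: differentiable_sum => j.
exact: differentiableZl.
Qed.

Lemma derive_mx_entry (F : V -> 'M[R]_(m, n)) x v i j : differentiable F x ->
  ('D_v F x) i j = 'D_v (fun y => F y i j) x.
Proof.
by move=> dF; rewrite derive_mx ?mxE //; exact: diff_derivable.
Qed.

Lemma cvg_mxP (T : Type) (G : set_system T) (FG : Filter G) (F : T -> 'M[R]_(m, n))
    (M : 'M[R]_(m, n)) :
  F @ G --> M <-> forall i j, (fun x => F x i j) @ G --> M i j.
Proof.
split=> [cF i j|cF].
  exact: (@cvg_comp _ _ _ F (fun A : 'M[R]_(m, n) => A i j) _ _ _ cF
    (@coord_continuous _ _ _ i j M)).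
apply/cvgrPdist_le => e e0.
suff : \forall x \near G, forall ij : 'I_m * 'I_n, `|(M - F x) ij.1 ij.2| <= e.
  apply: filterS => x H; rewrite [leLHS]/Num.Def.normr/= mx_normrE.
  by apply: bigmax_le => [|ij _]; [exact: ltW|exact: H].
apply: filter_forall => -[i j] /=.
have /cvgrPdist_le/(_ e e0) := cF i j.
by apply: filterS => x; rewrite !mxE.
Qed.

Lemma Ck_on_mxP k (U : set V) (F : V -> 'M[R]_(m, n)) : open U ->
  Ck_on k U F <-> forall i j, Ck_on k U (fun x => F x i j).
Proof.
move=> oU; elim: k F => [F|k IH F].
  split=> [cF i j x Ux|cF x Ux]; first by have /cvg_mxP := cF _ Ux; exact.
  by apply/cvg_mxP => i j; exact: cF.
split=> [[dF DF] i j|HF].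
  split=> [x Ux|v]; first by have /differentiable_mxP := dF _ Ux; exact.
  apply: (Ck_on_eq oU _ ((IH _).1 (DF v) i j)) => x Ux.
  by rewrite derive_mx_entry //; exact: dF.
have dF x : U x -> differentiable F x.
  by move=> Ux; apply/differentiable_mxP => i j; have [+ _] := HF i j; exact.
split=> // v; apply/IH => i j.
have [_ /(_ v)] := HF i j; apply: Ck_on_eq => // x Ux.
by rewrite derive_mx_entry //; exact: dF.
Qed.

End matrix_valued.

Section composition.
Context {V : normedModType R} {n : nat}.

Lemma Ck_on_sum k (U : set V) (I : Type) (r : seq I) (f : I -> V -> R) :
  open U -> (forall i, Ck_on k U (f i)) -> Ck_on k U (fun x => \sum_(i <- r) f i x).
Proof.
move=> oU Hf; elim: r => [|i r IH].
  apply: (@Ck_on_eq V R _ _ (fun=> 0)) => // [x _|]; first by rewrite big_nil.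
  exact: Ck_on_cst.
apply: (@Ck_on_eq V R _ _ (fun x => f i x + \sum_(j <- r) f j x)) => //.
  by move=> x _; rewrite big_cons.
exact: Ck_onD.
Qed.

Lemma Ck_on_comp k (U : set V) (V' : set 'rV[R]_n) (g : 'rV[R]_n -> R)
    (f : V -> 'rV[R]_n) : open U -> open V' ->
  (forall x, U x -> V' (f x)) ->
  Ck_on k V' g -> Ck_on k U f -> Ck_on k U (fun x => g (f x)).
Proof.
move=> oU oV' UV'; elim: k g => [g /= cg cf x Ux|k IH g Hg Hf].
  by apply: continuous_comp; [exact: cf|apply: cg; exact: UV'].
have [[df Df] [dg Dg]] := (Hf, Hg).
split=> [x Ux|v].
  by apply: differentiable_comp; [exact: df|apply: dg; exact: UV'].
have H i : Ck_on k U (fun x => 'D_v f x 0 i * 'D_(delta_mx 0 i) g (f x)).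
  apply: Ck_onM => //; last exact: IH (Dg _) (Ck_on_pred Hf).
  exact: ((Ck_on_mxP k _ oU).1 (Df v)).
apply: (Ck_on_eq oU _ (Ck_on_sum (index_enum 'I_n) oU H)) => x Ux.
have dgx : differentiable g (f x) by apply: dg; exact: UV'.
have dfx := df _ Ux.
rewrite [RHS]deriveE; last exact: differentiable_comp.
rewrite (@diff_comp _ _ _ _ f g) //= -(deriveE v dfx) -deriveE //.
by rewrite (derive_rV_sum _ dgx).
Qed.

End composition.
End Ck_closure.

(** * Calculus of smooth germs *)

Section smooth_germ_calculus.
Context {R : realType}.

Section gen.
Context {V W : normedModType R}.
Implicit Types (f g : V -> W) (x : V).

Lemma smooth_at_eq f g x : (\forall y \near x, f y = g y) ->
  smooth_at f x -> smooth_at g x.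
Proof.
rewrite -nbhs_nearE nbhsE => -[B [oB Bx] fgB] [U [oU Ux Uf]].
exists (U `&` B); split; [exact: openI|by []|move=> k].
apply: (@Ck_on_eq _ _ _ _ _ f); first exact: openI.
  by move=> y [_ /fgB].
by apply: Ck_on_sub (Uf k) => y [].
Qed.

Lemma smooth_at_near f x : smooth_at f x -> \forall y \near x, smooth_at f y.
Proof.
move=> [U [oU Ux Uf]]; apply: filterS (near_open oU Ux) => y Uy.
by exists U.
Qed.

Lemma smooth_at_differentiable f x : smooth_at f x -> differentiable f x.
Proof. by move=> [U [oU Ux /(_ 1%N) [df _]]]; exact: df. Qed.

Lemma smooth_at_continuous f x : smooth_at f x -> {for x, continuous f}.
Proof. by move=> /smooth_at_differentiable /differentiable_continuous. Qed.

Lemma smooth_at_derive f x v : smooth_at f x -> smooth_at ('D_v f) x.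
Proof. by move=> [U [oU Ux Uf]]; exists U; split=> // k; have [_ DU] := Uf k.+1; exact: DU. Qed.

Lemma smooth_at_cst (c : W) x : smooth_at (fun=> c) x.
Proof.
by exists setT; split=> [|//|k]; [exact: openT|apply: Ck_on_cst; exact: openT].
Qed.

Lemma smooth_atD f g x : smooth_at f x -> smooth_at g x ->
  smooth_at (fun y => f y + g y) x.
Proof.
move=> [U [oU Ux Uf]] [U' [oU' Ux' Ug]].
exists (U `&` U'); split; [exact: openI|by []|move=> k].
apply: Ck_onD; first exact: openI.
  by apply: Ck_on_sub (Uf k) => y [].
by apply: Ck_on_sub (Ug k) => y [].
Qed.

Lemma smooth_atZ (c : R) f x : smooth_at f x -> smooth_at (fun y => c *: f y) x.
Proof.
by move=> [U [oU Ux Uf]]; exists U; split=> // k; exact: Ck_onZ.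
Qed.

Lemma smooth_atN f x : smooth_at f x -> smooth_at (fun y => - f y) x.
Proof.
move=> /(smooth_atZ (-1)); apply: smooth_at_eq; near=> y.
by rewrite scaleN1r.
Unshelve. all: by end_near. Qed.

Lemma smooth_atB f g x : smooth_at f x -> smooth_at g x ->
  smooth_at (fun y => f y - g y) x.
Proof. by move=> sf sg; apply: smooth_atD => //; exact: smooth_atN. Qed.

Lemma smooth_at_lin (L : {linear V -> W}) x : continuous L -> smooth_at L x.
Proof.
move=> cL; exists setT; split=> [|//|k]; first exact: openT.
by apply: Ck_on_lin => //; exact: openT.
Qed.

End gen.

Lemma smooth_at_id (V : normedModType R) (x : V) : smooth_at (fun y : V => y) x.
Proof. by apply: (@smooth_at_lin V V idfun) => y; exact: cvg_id. Qed.

Lemma smooth_at_mxP {V : normedModType R} m n (F : V -> 'M[R]_(m, n)) (x : V) :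
  smooth_at F x <-> forall i j, smooth_at (fun y => F y i j) x.
Proof.
split=> [[U [oU Ux UF]] i j|H].
  by exists U; split=> // k; exact: ((Ck_on_mxP k _ oU).1 (UF k)).
have {}H ij : smooth_at (fun y => F y ij.1 ij.2) x by exact: H.
have /choice [U HU] := H.
exists [set y | forall ij, U ij y].
have oU : open [set y | forall ij, U ij y].
  rewrite openE => y /= Uy; apply: filter_forall => ij.
  by have [oU _ _] := HU ij; apply: near_open.
split=> // [ij|k]; first by have [] := HU ij.
apply/Ck_on_mxP => // i j; have [_ _ /(_ k)] := HU (i, j).
by apply: Ck_on_sub => y /(_ (i, j)).
Qed.

Lemma smooth_at_coord m n (i : 'I_m) (j : 'I_n) (x : 'M[R]_(m, n)) :
  smooth_at (fun y : 'M[R]_(m, n) => y i j) x.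
Proof. by have /smooth_at_mxP := smooth_at_id x; exact. Qed.

Section scalar.
Context {V : normedModType R}.
Implicit Types (f g : V -> R) (x : V).

Lemma smooth_atM f g x : smooth_at f x -> smooth_at g x ->
  smooth_at (fun y => f y * g y) x.
Proof.
move=> [U [oU Ux Uf]] [U' [oU' Ux' Ug]].
exists (U `&` U'); split; [exact: openI|by []|move=> k].
apply: Ck_onM; first exact: openI.
  by apply: Ck_on_sub (Uf k) => y [].
by apply: Ck_on_sub (Ug k) => y [].
Qed.

Lemma smooth_atX n f x : smooth_at f x -> smooth_at (fun y => f y ^+ n) x.
Proof.
move=> sf; elim: n => [|n IH]; first exact: smooth_at_cst.
have := smooth_atM sf IH; apply: smooth_at_eq; near=> y.
by rewrite exprS.
Unshelve. all: by end_near. Qed.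

Lemma smooth_atV f x : f x != 0 -> smooth_at f x ->
  smooth_at (fun y => (f y)^-1) x.
Proof.
move=> fx0 sf; have [U [oU Ux Uf]] := sf.
have : \forall y \near x, f y != 0.
  exact: cvgr_neq0 (smooth_at_continuous sf) fx0.
rewrite -nbhs_nearE nbhsE => -[B [oB Bx] fgB].
exists (U `&` B); split; [exact: openI|by []|move=> k].
apply: Ck_onV; first exact: openI.
  by move=> y [_ /fgB].
by apply: Ck_on_sub (Uf k) => y [].
Qed.

Lemma open_preimage_at (W : normedModType R) (f : V -> W) x (U : set V) (B : set W) :
  open U -> open B -> (forall k, Ck_on k U f) -> open (U `&` f @^-1` B).
Proof.
move=> oU oB Uf; rewrite openE => y [Uy By]; apply: filterI.
  exact: near_open.
exact: (Uf 0%N y Uy) (near_open oB By).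
Qed.

Lemma smooth_at_comp1 (g : R -> R) f x : smooth_at g (f x) -> smooth_at f x ->
  smooth_at (fun y => g (f y)) x.
Proof.
move=> [B [oB Bx Bg]] [U [oU Ux Uf]].
have oUB := open_preimage_at x oU oB Uf.
exists (U `&` f @^-1` B); split=> // k.
apply: (Ck_on_comp1 oUB oB _ (Bg k)); first by move=> y [].
by apply: Ck_on_sub (Uf k) => y [].
Qed.

Lemma smooth_at_comp n (g : 'rV[R]_n -> R) (f : V -> 'rV[R]_n) x :
  smooth_at g (f x) -> smooth_at f x -> smooth_at (fun y => g (f y)) x.
Proof.
move=> [B [oB Bx Bg]] [U [oU Ux Uf]].
have oUB := open_preimage_at x oU oB Uf.
exists (U `&` f @^-1` B); split=> // k.
apply: (Ck_on_comp oUB oB _ (Bg k)); first by move=> y [].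
by apply: Ck_on_sub (Uf k) => y [].
Qed.

Lemma smooth_at_comp_rV n m (g : 'rV[R]_n -> 'rV[R]_m) (f : V -> 'rV[R]_n) x :
  smooth_at g (f x) -> smooth_at f x -> smooth_at (fun y => g (f y)) x.
Proof.
move=> /smooth_at_mxP sg sf; apply/smooth_at_mxP => i j.
exact: (@smooth_at_comp _ (fun y => g y i j)).
Qed.

Lemma smooth_at_row2 f g x : smooth_at f x -> smooth_at g x ->
  smooth_at (fun y => row2 (f y) (g y)) x.
Proof.
move=> sf sg; apply/smooth_at_mxP => i [[|[|//]] lj].
  by apply: smooth_at_eq sf; near=> y; rewrite mxE ord1.
by apply: smooth_at_eq sg; near=> y; rewrite mxE ord1.
Unshelve. all: by end_near. Qed.

End scalar.

(** The derivative in direction [v] is [v] times the derivative in direction 1, so a single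
    derivative function suffices on the line. *)
Lemma Ck_on_S1 k (U : set R) (f f' : R -> R) : open U ->
  (forall x, U x -> is_derive x 1 f (f' x)) -> Ck_on k U f' -> Ck_on k.+1 U f.
Proof.
move=> oU df Hf'; split=> [x Ux|v].
  by apply/derivable1_diffP; have := df _ Ux => -[].
apply: (Ck_on_eq oU _ (Ck_onZ v oU Hf')) => x Ux.
have [dfx <-] := df _ Ux.
have dx : differentiable f x by apply/derivable1_diffP.
have E1 : 'D_1 f x = 'd f x 1 by rewrite deriveE.
by rewrite [RHS]deriveE // E1 -[in RHS](mulr1 v) -[X in _ = 'd f _ X]/(v *: 1) linearZ.
Qed.

(** The derivative [(2 * Num.sqrt y)^-1] is again built from the square root, so regularity
    bootstraps. *)
Lemma smooth_at_sqrt (x : R) : 0 < x -> smooth_at Num.sqrt x.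
Proof.
move=> x0; have oU : open [set y : R | 0 < y] by exact: open_gt.
exists [set y : R | 0 < y]; split=> //.
elim=> [y /= _|k IH]; first exact: sqrt_continuous.
have Hs : Ck_on k [set y : R | 0 < y] (fun y => (2 * Num.sqrt y)^-1).
  apply: Ck_onV => //; first by move=> y /= y0; rewrite mulf_neq0 // gt_eqF // sqrtr_gt0.
  by apply: Ck_onM => //; exact: Ck_on_cst.
by apply: (Ck_on_S1 oU _ Hs) => y; exact: is_derive1_sqrt.
Qed.

Lemma Ck_on_sin_cos k : Ck_on k [set: R] sin /\ Ck_on k [set: R] cos.
Proof.
have oT := @openT R.
elim: k => [|k [IHs IHc]].
  by split=> x _; [exact: continuous_sin|exact: continuous_cos].
have Hs : Ck_on k [set: R] (fun x => -1 * sin x).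
  by apply: Ck_onM => //; exact: Ck_on_cst.
split; first by apply: (Ck_on_S1 oT _ IHc).
by apply: (Ck_on_S1 oT _ Hs) => x _; rewrite mulN1r; exact: is_derive_cos.
Qed.

Lemma smooth_at_sin (x : R) : smooth_at sin x.
Proof. by exists setT; split=> [|//|k]; [exact: openT|have [] := Ck_on_sin_cos k]. Qed.

Lemma smooth_at_cos (x : R) : smooth_at cos x.
Proof. by exists setT; split=> [|//|k]; [exact: openT|have [] := Ck_on_sin_cos k]. Qed.

End smooth_germ_calculus.

(** * Slices along lines and coordinates, mean value estimates *)

Section lines.
Context {R : realType}.

Lemma is_derive_line (V : normedModType R) (F : V -> R) (a e : V) (z : R) :
  differentiable F (a + z *: e) ->
  is_derive z 1 (fun t : R => F (a + t *: e)) ('D_e F (a + z *: e)).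
Proof.
move=> /(@diff_derivable _ _ _ F _ e) dF.
have E : (fun h : R => h^-1 *: (F (a + (h *: 1 + z) *: e) - F (a + z *: e))) =
         (fun h : R => h^-1 *: (F (h *: e + (a + z *: e)) - F (a + z *: e))).
  apply/funext => h; congr (_ *: (F _ - _)).
  by rewrite [h *: 1]mulr1 scalerDl addrCA.
split; first by rewrite /derivable E.
by rewrite /derive E.
Qed.

Lemma between_dist (a b z c r : R) : `|a - c| < r -> `|b - c| < r ->
  Num.min a b <= z <= Num.max a b -> `|z - c| < r.
Proof.
rewrite !ltr_distl => /andP[a1 a2] /andP[b1 b2] /andP[].
rewrite ge_min le_max => /orP zl /orP zr.
by apply/andP; split; case: zl => ?; case: zr => ?; lra.
Qed.

Lemma derivable_bound (f f' : R -> R) (a b M : R) :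
  (forall x, Num.min a b <= x <= Num.max a b -> is_derive x 1 f (f' x)) ->
  (forall x, Num.min a b <= x <= Num.max a b -> `|f' x| <= M) ->
  `|f b - f a| <= M * `|b - a|.
Proof.
wlog ab : a b / a <= b.
  move=> H df Mf; case: (leP a b) => [/H|/ltW]; first exact.
  move=> ba; rewrite distrC (distrC b); apply: H => //.
    by rewrite minC maxC.
  by rewrite minC maxC.
rewrite (min_idPl ab) (max_idPr ab) => df Mf.
have df' x : x \in `]a, b[ -> is_derive x 1 f (f' x).
  by rewrite in_itv /= => /andP[ax xb]; apply: df; rewrite !ltW.
have cf : {within `[a, b], continuous f}.
  apply: derivable_within_continuous => x; rewrite in_itv /= => xab.
  by have := df x xab => -[].
have [c] := MVT_segment ab df' cf; rewrite in_itv /= => cab ->.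
by rewrite normrM ler_wpM2r // Mf.
Qed.

Lemma differentiable_lipschitz (V W : normedModType R) (f : V -> W) (x : V) :
  differentiable f x ->
  exists2 M : R, 0 < M & \forall y \near x, `|f y - f x| <= M * `|y - x|.
Proof.
move=> df; have [k k0 Hk] := linear_lipschitz (diff_continuous df).
exists (k + 1); first by rewrite addr_gt0.
have := differentiable_approx df ltr01; apply: filterS => y H.
rewrite -(subrK ('d f x (y - x)) (f y - f x)) (le_trans (ler_normD _ _)) //.
by rewrite mulrDl addrC lerD // mul1r -[leRHS]mul1r.
Qed.

Lemma lipschitz_at_continuous (V W : normedModType R) (f : V -> W) (x : V) (M : R) :
  0 < M -> (\forall y \near x, `|f y - f x| <= M * `|y - x|) ->
  {for x, continuous f}.
Proof.
move=> M0 HM; apply/cvgrPdist_le => d d0.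
have nd : \forall y \near x, `|x - y| < d / M.
  have dM : 0 < d / M by rewrite divr_gt0.
  by have := nbhsx_ballx x (d / M) dM; rewrite -ball_normE.
apply: filterS2 HM nd => y H1 H2; rewrite distrC (le_trans H1) //.
by rewrite mulrC -ler_pdivlMr // distrC ltW.
Qed.

End lines.

Lemma entry_continuous {R : realType} m n i j (A : 'M[R]_(m, n)) :
  {for A, continuous (fun M : 'M[R]_(m, n) => M i j)}.
Proof. exact: smooth_at_continuous (smooth_at_coord i j A). Qed.

Section coordinates.
Context {R : realType} {n : nat}.
Implicit Types (x y v : 'rV[R]_n) (i j : 'I_n).

Lemma rV_norm_lt v (r : R) : 0 < r -> (forall j, `|v 0 j| < r) -> `|v| < r.
Proof.
move=> r0 H; rewrite /Num.Def.normr /= mx_normrE.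
by apply: bigmax_lt => // -[a b] _ /=; rewrite ord1.
Qed.

Lemma rV_norm_le v (r : R) : 0 <= r -> (forall j, `|v 0 j| <= r) -> `|v| <= r.
Proof.
move=> r0 H; rewrite /Num.Def.normr /= mx_normrE.
by apply: bigmax_le => // -[a b] _ /=; rewrite ord1.
Qed.

Lemma coord_le_norm v j : `|v 0 j| <= `|v|.
Proof.
rewrite [leRHS]/Num.Def.normr /= mx_normrE.
exact: (le_bigmax _ (fun ij : 'I_1 * 'I_n => `|v ij.1 ij.2|) (0, j)).
Qed.

Lemma norm_delta i : `|delta_mx 0 i : 'rV[R]_n| <= 1.
Proof.
apply: rV_norm_le => // j; rewrite mxE eqxx /=.
by case: eqP; rewrite ?normr1 ?normr0.
Qed.

(** Replacement of one coordinate, written as a translation so that the slices [upd i x] are lines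
    and their derivatives are directional derivatives. *)
Definition upd i x (z : R) : 'rV[R]_n := x + (z - x 0 i) *: delta_mx 0 i.

Lemma updE i x z j : upd i x z 0 j = if j == i then z else x 0 j.
Proof.
rewrite !mxE eqxx /= ; case: eqP => [->|_]; last by rewrite mulr0 addr0.
by rewrite mulr1 subrKC.
Qed.

Lemma upd_id i x : upd i x (x 0 i) = x.
Proof. by rewrite /upd subrr scale0r addr0. Qed.

Lemma upd_upd i x z t : upd i (upd i x z) t = upd i x t.
Proof.
by apply/rowP => j; rewrite !updE; case: eqP.
Qed.

Lemma is_derive_upd i (F : 'rV[R]_n -> R) x z : differentiable F (upd i x z) ->
  is_derive z 1 (fun t => F (upd i x t)) ('D_(delta_mx 0 i) F (upd i x z)).
Proof.
have E t : upd i x t = (x - x 0 i *: delta_mx 0 i) + t *: delta_mx 0 i.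
  by rewrite /upd scalerBl addrA addrAC.
rewrite (_ : (fun t => F (upd i x t)) =
  (fun t => F ((x - x 0 i *: delta_mx 0 i) + t *: delta_mx 0 i))).
  by rewrite E; exact: is_derive_line.
by apply/funext => t; rewrite E.
Qed.

Lemma smooth_at_upd (V : normedModType R) i (X : V -> 'rV[R]_n) (z : V -> R) a :
  smooth_at X a -> smooth_at z a -> smooth_at (fun u => upd i (X u) (z u)) a.
Proof.
move=> sX sz; apply/smooth_at_mxP => i0 j; rewrite ord1.
case: (eqVneq j i) => [->|ji].
  by apply: smooth_at_eq sz; near=> u; rewrite updE eqxx.
have /smooth_at_mxP/(_ 0 j) := sX; apply: smooth_at_eq; near=> u.
by rewrite updE (negbTE ji).
Unshelve. all: by end_near. Qed.

Lemma Ck_on_upd k i (U : set 'rV[R]_n) (z : 'rV[R]_n -> R) : open U ->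
  Ck_on k U z -> Ck_on k U (fun y => upd i y (z y)).
Proof.
move=> oU Cz; apply/Ck_on_mxP => // i0 j; rewrite ord1.
case: (eqVneq j i) => [->|ji].
  by apply: Ck_on_eq Cz => // x _; rewrite updE eqxx.
have Cj : Ck_on k U (fun y : 'rV[R]_n => y 0 j).
  apply: ((Ck_on_mxP k (fun y : 'rV[R]_n => y) oU).1 _ 0 j).
  by apply: (@Ck_on_lin _ _ _ k U idfun) => // y; exact: cvg_id.
by apply: Ck_on_eq Cj => // x _; rewrite updE (negbTE ji).
Qed.

End coordinates.

(** * Inverse functions *)

(* Inversion in the single variable [x_i]: monotonicity in that variable replaces
   the contraction principle, and two such inversions compose to the inverse
   function theorem in the plane. *)
Section elementary_inverse.
Context {R : realType} {n : nat}.
Variables (i : 'I_n) (F : 'rV[R]_n -> R) (x0 : 'rV[R]_n).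
Hypothesis sF : smooth_at F x0.
Let e : 'rV[R]_n := delta_mx 0 i.
Let c := 'D_e F x0.
Hypothesis c0 : c != 0.
Let y0 := upd i x0 (F x0).
Let z0 := x0 0 i.

(** On such a ball [F / c] differs from the coordinate [x_i] by a function of slope at most 1/2 in
    [x_i]. One radius serves all orders [k]. *)
Let good r := [/\ 0 < r, forall k, Ck_on k (ball x0 r) F &
  forall x, ball x0 r x -> `|'D_e F x / c - 1| <= 2^-1].

Local Lemma good_radius : exists r, good r.
Proof.
have [U [oU Ux UF]] := sF.
have cD : {for x0, continuous ('D_e F)}.
  by apply: smooth_at_continuous; exact: smooth_at_derive.
have near1 : \forall x \near x0, `|'D_e F x / c - 1| <= 2^-1.
  have : 'D_e F x / c @[x --> x0] --> (1 : R).
    by rewrite -(divff c0); exact: (cvgM cD (cvg_cst _)).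
  move=> /cvgrPdist_le /(_ 2^-1); rewrite invr_gt0 ltr0n => /(_ isT).
  by apply: filterS => x; rewrite distrC.
have : nbhs x0 (U `&` [set x | `|'D_e F x / c - 1| <= 2^-1]).
  exact: filterI (near_open oU Ux) near1.
move=> /nbhs_ballP [r /= r0 Hr].
exists r; split=> // [k|x /Hr [] //].
by apply: Ck_on_sub (UF k) => x /Hr [].
Qed.

Section with_radius.
Variable r : R.
Hypothesis gr : good r.

(** The [i]-th coordinate is left free: in the target it is a value of [F], not a position near that
    of [x0]. *)
Let bd (y : 'rV[R]_n) := forall j, j != i -> `|y 0 j - x0 0 j| < r.

Local Lemma upd_ball y z : bd y -> `|z - z0| < r -> ball x0 r (upd i y z).
Proof.
have [r0 _ _] := gr; move=> by_ hz.
rewrite -ball_normE /=; apply: rV_norm_lt => // j.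
rewrite mxE [X in _ + X]mxE distrC updE; case: eqP => [->|/eqP ji]; first exact: hz.
exact: by_.
Qed.

Local Lemma ball_bd y : ball y0 r y -> bd y.
Proof.
rewrite -ball_normE /= => yr j ji.
have := le_lt_trans (coord_le_norm (y0 - y) j) yr.
by rewrite mxE [X in _ + X]mxE updE (negbTE ji) distrC.
Qed.

(** Mean value inequality for [F / c - z]. This single bound yields uniqueness of the solution, the
    sign change behind its existence and its Lipschitz continuity. *)
Local Lemma elem_estimate y z1 z2 : bd y -> `|z1 - z0| < r -> `|z2 - z0| < r ->
  `|(F (upd i y z2) - F (upd i y z1)) / c - (z2 - z1)| <= 2^-1 * `|z2 - z1|.
Proof.
have [r0 CF Dle] := gr; move=> by_ h1 h2.
pose g z := F (upd i y z) / c - z.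
have -> : (F (upd i y z2) - F (upd i y z1)) / c - (z2 - z1) = g z2 - g z1.
  by rewrite /g; ring.
have hz z : Num.min z1 z2 <= z <= Num.max z1 z2 -> `|z - z0| < r.
  exact: between_dist.
apply: (@derivable_bound _ g (fun z => 'D_e F (upd i y z) / c - 1)) => z zI.
  have dF : differentiable F (upd i y z).
    by have [+ _] := CF 1%N; apply; apply: upd_ball => //; exact: hz.
  have dFz := is_derive_upd dF.
  rewrite /g.
  have -> : (fun z => F (upd i y z) / c - z) =
     (fun z => c^-1 *: F (upd i y z)) \- (id : R -> R).
    by apply/funext => t /=; rewrite mulrC.
  apply: is_derive_eq.
  by rewrite mulrC.
by apply: Dle; apply: upd_ball => //; exact: hz.
Qed.

Let sol y z := `|z - z0| < r /\ F (upd i y z) = y 0 i.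

Local Lemma sol_unique y z1 z2 : bd y -> sol y z1 -> sol y z2 -> z1 = z2.
Proof.
move=> by_ [h1 e1] [h2 e2]; have := elem_estimate by_ h1 h2.
rewrite e1 e2 subrr mul0r sub0r normrN.
have [->//|ne] := eqVneq z1 z2.
have : 0 < `|z2 - z1| by rewrite normr_gt0 subr_eq0 eq_sym.
by move=> ? ?; exfalso; lra.
Qed.

Local Lemma y0i : y0 0 i = F x0.
Proof. by rewrite updE eqxx. Qed.

Local Lemma upd_y0 : upd i y0 z0 = x0.
Proof. by rewrite /y0 upd_upd upd_id. Qed.

Local Lemma bd_y0 : bd y0.
Proof. by have [r0 _ _] := gr; apply: ball_bd => //; exact: ballxx. Qed.

Local Lemma slice_continuous y z : bd y -> `|z - z0| < r ->
  {for y, continuous (fun y => (F (upd i y z) - y 0 i) / c)}.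
Proof.
have [r0 CF _] := gr; move=> by_ hz.
apply: smooth_at_continuous; apply: smooth_atM; last exact: smooth_at_cst.
apply: smooth_atB; last exact: smooth_at_coord.
apply: (smooth_at_comp (f := fun y => upd i y z)).
  by exists (ball x0 r); split=> //; [exact: ball_open|exact: upd_ball].
by apply: smooth_at_upd; [exact: smooth_at_id|exact: smooth_at_cst].
Qed.

Local Lemma slice_y0 t : `|t| < r ->
  `|(F (upd i y0 (z0 + t)) - y0 0 i) / c - t| <= 2^-1 * `|t|.
Proof.
have [r0 _ _] := gr => tr.
have h0 : `|z0 - z0| < r by rewrite subrr normr0.
have h1 : `|(z0 + t) - z0| < r by rewrite addrAC subrr add0r.
have := elem_estimate bd_y0 h0 h1.
by rewrite upd_y0 -y0i [z0 + t]addrC addrK.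
Qed.

(** At [y0] the slice is positive at [z0 + r / 2] and negative at [z0 - r / 2]. Both signs persist
    for [y] near [y0], and the intermediate value theorem applies. *)
Local Lemma sol_exists : \forall y \near y0, bd y /\ exists z, sol y z.
Proof.
have [r0 CF _] := gr.
pose t := r / 2.
have t0 : 0 < t by rewrite divr_gt0.
have tr : `|t| < r by rewrite gtr0_norm // /t; lra.
have tr' : `|- t| < r by rewrite normrN.
have h1 : `|(z0 + t) - z0| < r by rewrite addrAC subrr add0r.
have h2 : `|(z0 - t) - z0| < r by rewrite addrAC subrr add0r.
have := slice_y0 tr; have := slice_y0 tr'.
rewrite normrN (gtr0_norm t0) !ler_distl => /andP[_ lo] /andP[up _].
have c1 := slice_continuous bd_y0 h1; have c2 := slice_continuous bd_y0 h2.
have n1 : \forall y \near y0, 0 < (F (upd i y (z0 + t)) - y 0 i) / c.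
  by apply: (cvgr_gt _ c1); rewrite /=; lra.
have n2 : \forall y \near y0, (F (upd i y (z0 - t)) - y 0 i) / c < 0.
  by apply: (cvgr_lt _ c2); rewrite /=; lra.
have n3 : \forall y \near y0, bd y.
  have := nbhsx_ballx y0 r r0; apply: filterS; exact: ball_bd.
near=> y.
have by_ : bd y by near: y.
split=> //.
have hz z : z0 - t <= z <= z0 + t -> `|z - z0| < r.
  by move=> zI; apply: between_dist h2 h1 _; rewrite (min_idPl _) ?(max_idPr _) //; lra.
pose g z := (F (upd i y z) - y 0 i) / c.
have cg : {within `[z0 - t, z0 + t], continuous g}.
  apply: continuous_in_subspaceT => z; rewrite inE /= in_itv /= => zI.
  apply: smooth_at_continuous; apply: smooth_atM; last exact: smooth_at_cst.
  apply: smooth_atB; last exact: smooth_at_cst.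
  apply: (smooth_at_comp (f := fun z => upd i y z)).
    exists (ball x0 r); split=> //; first exact: ball_open.
    by apply: upd_ball => //; exact: hz.
  by apply: smooth_at_upd; [exact: smooth_at_cst|exact: smooth_at_id].
have ab : z0 - t <= z0 + t by lra.
have g1 : g (z0 - t) < 0 by rewrite /g; near: y.
have g2 : 0 < g (z0 + t) by rewrite /g; near: y.
have [|z zI gz] := IVT ab cg (v := 0).
  by rewrite ge_min le_max (ltW g1) (ltW g2) orbT.
exists z; split; first by apply: hz; move: zI; rewrite in_itv.
move/eqP: gz; rewrite mulf_eq0 invr_eq0 (negbTE c0) orbF subr_eq0.
by move/eqP.
Unshelve. all: by end_near. Qed.

Section with_solution.
Variables (B : set 'rV[R]_n) (Z : 'rV[R]_n -> R).
Hypothesis oB : open B.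
Hypothesis bdB : forall y, B y -> bd y.
Hypothesis solZ : forall y, B y -> sol y (Z y).

Let X y := upd i y (Z y).

Local Lemma X_ball y : B y -> ball x0 r (X y).
Proof. by move=> By; apply: upd_ball => //; [exact: bdB|have [] := solZ By]. Qed.

Local Lemma DF_neq0 x : ball x0 r x -> 'D_e F x != 0.
Proof.
have [_ _ H] := gr; move=> /H; apply: contraTneq => ->.
rewrite mul0r sub0r normrN normr1 -ltNge invf_lt1 ?ltr0n //.
by rewrite (ltr_nat R 1 2).
Qed.

Local Lemma F_diff x : ball x0 r x -> differentiable F x.
Proof. by have [_ /(_ 1%N) [dF _] _] := gr; exact: dF. Qed.

(** Keeping the old value [Z y] at the new point [y2] leaves a defect that is differentiable in [y2]
    and zero at [y], hence Lipschitz. By [elem_estimate] the correction to the solution is at most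
    twice this defect. *)
Local Lemma Z_lipschitz y : B y ->
  exists2 M : R, 0 < M & \forall y2 \near y, `|Z y2 - Z y| <= M * `|y2 - y|.
Proof.
move=> By; have [hz Fz] := solZ By.
have sK : differentiable (fun y2 => (F (upd i y2 (Z y)) - y2 0 i) / c) y.
  have [r0 CF _] := gr.
  apply: smooth_at_differentiable; apply: smooth_atM; last exact: smooth_at_cst.
  apply: smooth_atB; last exact: smooth_at_coord.
  apply: (smooth_at_comp (f := fun y2 => upd i y2 (Z y))).
    by exists (ball x0 r); split=> //; [exact: ball_open|exact: X_ball].
  by apply: smooth_at_upd; [exact: smooth_at_id|exact: smooth_at_cst].
have [M M0 HM] := differentiable_lipschitz sK.
exists (2 * M); first by rewrite mulr_gt0.
have := near_open oB By; move: HM; apply: filterS2 => y2 HM By2.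
have [hz2 Fz2] := solZ By2.
have := elem_estimate (bdB By2) hz hz2.
move: HM; rewrite /= Fz subrr mul0r subr0 Fz2 => HM H.
have : `|Z y2 - Z y| <= `|(F (upd i y2 (Z y)) - y2 0 i) / c| + 2^-1 * `|Z y2 - Z y|.
  rewrite -{1}(subKr ((y2 0 i - F (upd i y2 (Z y))) / c) (Z y2 - Z y)).
  rewrite (le_trans (ler_normB _ _)) // lerD //.
  by rewrite -normrN -mulNr opprB.
by lra.
Qed.

(** The formula comes from differentiating [F (upd i y (Z y)) = y_i] and solving for the derivative
    of [Z]. The remainder of [F] at [X y] is small relative to [y2 - y] because [X] is Lipschitz at
    [y] with constant [2 + M]. *)
Local Lemma Z_diff y : B y -> differentiable Z y /\
  forall v, 'D_v Z y = (v 0 i - 'D_(v - v 0 i *: e) F (X y)) / 'D_e F (X y).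
Proof.
move=> By.
have dF := F_diff (X_ball By).
have D0 := DF_neq0 (X_ball By).
set D := 'D_e F (X y).
pose L (v : 'rV[R]_n) : R := (v 0 i - 'd F (X y) (v - v 0 i *: e)) / D.
have linL : linear L.
  move=> a u v; rewrite /L !mxE.
  have -> : a *: u + v - (a * u 0 i + v 0 i) *: e =
     a *: (u - u 0 i *: e) + (v - v 0 i *: e).
    by rewrite scalerDl scalerBr scalerA opprD addrACA.
  by rewrite linearD linearZ /= -[a *: (_ / _)]/(a * (_ / _)) -[a *: 'd _ _ _]/(a * _); ring.
pose glM := GRing.isLinear.Build _ _ _ _ _ linL.
pose gL : {linear 'rV[R]_n -> R} := HB.pack L glM.
have cL : continuous L.
  move=> v.
  have cv : {for v, continuous (fun v : 'rV[R]_n => v - v 0 i *: e)}.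
    exact: (cvgB cvg_id (cvgZ (@entry_continuous _ _ _ 0 i v) (cvg_cst e))).
  have cd : {for v, continuous (fun v : 'rV[R]_n => 'd F (X y) (v - v 0 i *: e))}.
    by apply: continuous_comp; [exact: cv|exact: diff_continuous].
  exact: (cvgM (cvgB (@entry_continuous _ _ _ 0 i v) cd) (cvg_cst D^-1)).
have [M M0 HM] := Z_lipschitz By.
suff [dZ ZE] : differentiable Z y /\ 'd Z y = gL :> (_ -> _).
  split=> // v; rewrite (deriveE v dZ) ZE /= /L.
  by rewrite -(deriveE _ dF).
apply: differentiable_criterion => // eps eps0.
have nD : 0 < `|D| by rewrite normr_gt0.
have eps' : 0 < eps * `|D| / (2 + M) by rewrite !(mulr_gt0, invr_gt0, addr_gt0).
have cX : {for y, continuous X}.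
  have cZ := lipschitz_at_continuous M0 HM.
  exact: (cvgD cvg_id (cvgZ (cvgB cZ (@entry_continuous _ _ _ 0 i y)) (cvg_cst e))).
have := cX _ (differentiable_approx dF eps').
rewrite /= nbhs_simpl /= => nX.
move: (near_open oB By) HM nX; apply: filterS3 => y2 By2 Hz Hx.
have Fz : F (X y) = y 0 i by have [_] := solZ By.
have Fz2 : F (X y2) = y2 0 i by have [_] := solZ By2.
set h := y2 - y.
have hX : X y2 - X y = (h - h 0 i *: e) + (Z y2 - Z y) *: e.
  rewrite /X /upd /h -/e !mxE.
  apply/rowP => j; rewrite !mxE; ring.
have nX : `|X y2 - X y| <= (2 + M) * `|h|.
  rewrite hX (le_trans (ler_normD _ _)) // mulrDl lerD //.
    rewrite (le_trans (ler_normB _ _)) // mulrDl mul1r lerD // normrZ.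
    rewrite (le_trans (ler_wpM2l (normr_ge0 _) (norm_delta i))) // mulr1.
    exact: coord_le_norm.
  rewrite normrZ (le_trans (ler_wpM2l (normr_ge0 _) (norm_delta i))) // mulr1.
  exact: Hz.
have {}Hx : `|F (X y2) - F (X y) - 'd F (X y) (X y2 - X y)| <=
  eps * `|D| / (2 + M) * `|X y2 - X y| by exact: Hx.
have hd : 'd F (X y) (X y2 - X y) =
    'd F (X y) (h - h 0 i *: e) + (Z y2 - Z y) * D.
  by rewrite hX linearD [X in _ + X]linearZ /= /D (deriveE _ dF).
move: Hx; rewrite Fz Fz2 hd => Hx.
rewrite /L.
have -> : Z y2 - Z y - (h 0 i - 'd F (X y) (h - h 0 i *: e)) / D =
  - (y2 0 i - y 0 i - ('d F (X y) (h - h 0 i *: e) + (Z y2 - Z y) * D)) / D.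
  have -> : h 0 i = y2 0 i - y 0 i by rewrite !mxE.
  by field.
rewrite normrM normfV normrN ler_pdivrMr // (le_trans Hx) //.
rewrite (le_trans (ler_wpM2l (ltW eps') nX)) //.
by rewrite mulrA divfK ?gt_eqF ?addr_gt0 // mulrAC.
Qed.

(** The derivative of [Z] is a rational expression in derivatives of [F] along
    [X y = upd i y (Z y)], so it is as regular as [Z] itself. *)
Local Lemma Z_Ck k : Ck_on k B Z.
Proof.
elim: k => [y By|k IH]; first exact: differentiable_continuous (Z_diff By).1.
split=> [y By|v]; first exact: (Z_diff By).1.
have CX := Ck_on_upd i oB IH.
have [_ CF _] := gr.
have CDF u : Ck_on k B (fun y => 'D_u F (X y)).
  have [_ /(_ u) CD] := CF k.+1.
  exact: (Ck_on_comp oB (ball_open x0 r) X_ball CD CX).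
have H : Ck_on k B (fun y => (v 0 i - 'D_(v - v 0 i *: e) F (X y)) / 'D_e F (X y)).
  apply: Ck_onM => //.
    apply: Ck_onD => //; first exact: Ck_on_cst.
    have := Ck_onZ (-1) oB (CDF (v - v 0 i *: e)).
    by apply: Ck_on_eq => // y By; rewrite scaleN1r.
  apply: Ck_onV => // y By; exact: DF_neq0 (X_ball By).
by apply: Ck_on_eq H => // y By; rewrite (Z_diff By).2.
Qed.

End with_solution.

End with_radius.

(** [Z] is the [i]-th coordinate of the inverse of [x |-> upd i x (F x)], a map that changes a
    single coordinate. The same function serves below as an implicit function. *)
Theorem elementary_inverse : exists Z : 'rV[R]_n -> R,
  [/\ smooth_at Z y0, Z y0 = x0 0 i,
      \forall y \near y0, F (upd i y (Z y)) = y 0 i &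
      \forall x \near x0, Z (upd i x (F x)) = x 0 i].
Proof.
have [r gr] := good_radius; have [r0 CF _] := gr.
have := sol_exists gr.
rewrite -nbhs_nearE nbhsE => -[B [oB By0] HB].
pose Z y := xget z0 [set z | `|z - z0| < r /\ F (upd i y z) = y 0 i].
have solZ y : B y -> `|Z y - z0| < r /\ F (upd i y (Z y)) = y 0 i.
  move=> /HB [_ [z hz]]; rewrite /Z; case: xgetP => [t -> []//|].
  by move=> /(_ z).
have bdB y : B y -> forall j, j != i -> `|y 0 j - x0 0 j| < r by move=> /HB [].
have sol0 : `|z0 - z0| < r /\ F (upd i y0 z0) = y0 0 i.
  by rewrite subrr normr0 upd_y0 y0i.
exists Z; split.
- by exists B; split=> // k; exact: (Z_Ck gr oB bdB solZ).
- by apply: (sol_unique gr (bdB _ By0)) => //; exact: solZ.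
- by apply: filterS (near_open oB By0) => y /solZ [].
have nB : \forall x \near x0, B (upd i x (F x)).
  have : {for x0, continuous (fun x => upd i x (F x))}.
    by apply: smooth_at_continuous; apply: smooth_at_upd => //; exact: smooth_at_id.
  by move=> /(_ _ (near_open oB By0)).
have nx := nbhsx_ballx x0 r r0.
apply: filterS2 nB nx => x Bx xr.
apply: (sol_unique gr (bdB _ Bx)); first exact: solZ.
rewrite upd_upd upd_id updE eqxx; split=> //.
move: xr; rewrite -ball_normE /= => xr.
have := le_lt_trans (coord_le_norm (x0 - x) i) xr.
by rewrite mxE [X in _ + X]mxE distrC.
Qed.

End elementary_inverse.

(** * Diffeomorphism germs and the inverse function theorem in the plane *)

Section germs.
Context {R : realType}.
Implicit Types (phi psi f g h : 'rV[R]_2 -> 'rV[R]_2).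

Lemma near_comp (V W : normedModType R) (f : V -> W) x (P : W -> Prop) :
  {for x, continuous f} -> (\forall y \near f x, P y) ->
  \forall y \near x, P (f y).
Proof. by move=> cf H; exact: cf _ H. Qed.

Lemma near_comp0 (V W : normedModType R) (f : V -> W) (P : W -> Prop) :
  smooth_at f 0 -> f 0 = 0 -> (\forall y \near (0 : W), P y) ->
  \forall y \near (0 : V), P (f y).
Proof.
by move=> sf f0 H; apply: near_comp; [exact: smooth_at_continuous|rewrite f0].
Qed.

Lemma derive_chain (V : normedModType R) n (W : normedModType R)
    (g : 'rV[R]_n -> W) (f : V -> 'rV[R]_n) x v :
  differentiable f x -> differentiable g (f x) ->
  'D_v (fun y => g (f y)) x = 'D_('D_v f x) g (f x).
Proof.
move=> df dg; rewrite [LHS]deriveE; last exact: differentiable_comp.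
by rewrite (@diff_comp _ _ _ _ f g) //= -(deriveE v df) -deriveE.
Qed.

Lemma row2_00 (a b : R) : row2 a b 0 0 = a. Proof. by rewrite mxE. Qed.
Lemma row2_01 (a b : R) : row2 a b 0 1 = b. Proof. by rewrite mxE. Qed.
Definition row2E := (row2_00, row2_01).

Lemma rV2P (x y : 'rV[R]_2) : x 0 0 = y 0 0 -> x 0 1 = y 0 1 -> x = y.
Proof.
move=> H0 H1; apply/rowP => -[[|[|//]] lj].
  by rewrite (_ : Ordinal lj = 0) //; exact: val_inj.
by rewrite (_ : Ordinal lj = 1) //; exact: val_inj.
Qed.

Lemma row2_eta (x : 'rV[R]_2) : row2 (x 0 0) (x 0 1) = x.
Proof. by apply: rV2P; rewrite row2E. Qed.

Lemma row2_0 : row2 0 0 = 0 :> 'rV[R]_2.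
Proof. by apply: rV2P; rewrite row2E mxE. Qed.

Lemma delta_row2_0 : delta_mx 0 0 = row2 1 0 :> 'rV[R]_2.
Proof. by apply: rV2P; rewrite row2E mxE. Qed.

Lemma delta_row2_1 : delta_mx 0 1 = row2 0 1 :> 'rV[R]_2.
Proof. by apply: rV2P; rewrite row2E mxE. Qed.

Lemma diffeo_germ0 phi : diffeo_germ phi -> phi 0 = 0.
Proof. by case. Qed.

Lemma diffeo_germ_smooth phi : diffeo_germ phi -> smooth_at phi 0.
Proof. by case. Qed.

Lemma diffeo_germ_id : diffeo_germ (fun x : 'rV[R]_2 => x).
Proof.
have si : smooth_at (fun x : 'rV[R]_2 => x) 0 by exact: smooth_at_id.
split=> //; exists (fun x => x); split=> //; by apply: filterE => x /=.
Qed.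

Lemma diffeo_germ_comp phi psi : diffeo_germ phi -> diffeo_germ psi ->
  diffeo_germ (fun x => phi (psi x)).
Proof.
move=> [f0 sf [f' [f'0 sf' ff' f'f]]] [g0 sg [g' [g'0 sg' gg' g'g]]].
split; first by rewrite g0.
  by apply: smooth_at_comp_rV => //; rewrite g0.
exists (fun x => g' (f' x)); split; first by rewrite f'0.
- by apply: smooth_at_comp_rV => //; rewrite f'0.
- by have := near_comp0 sg g0 ff'; apply: filterS2 gg' => x ggx ->.
- by have := near_comp0 sf' f'0 g'g; apply: filterS2 f'f => x ffx ->.
Qed.

Lemma diffeo_germ_inv phi : diffeo_germ phi -> exists2 psi, diffeo_germ psi &
  (\forall x \near (0 : 'rV[R]_2), psi (phi x) = x) /\
  (\forall x \near (0 : 'rV[R]_2), phi (psi x) = x).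
Proof.
move=> [f0 sf [g [g0 sg fg gf]]]; exists g => //.
by split=> //; exists phi.
Qed.

Lemma diffeo_germ_eq phi psi : diffeo_germ phi ->
  (\forall x \near (0 : 'rV[R]_2), phi x = psi x) -> diffeo_germ psi.
Proof.
move=> [f0 sf [g [g0 sg fg gf]]] E; split.
- by rewrite -(nbhs_singleton E).
- exact: smooth_at_eq sf.
exists g; split=> //; first by apply: filterS2 E fg => x ->.
by have := near_comp0 sg g0 E; apply: filterS2 gf => x gx <-.
Qed.

Lemma A_equivalent_trans f g h : A_equivalent f g -> A_equivalent g h ->
  A_equivalent f h.
Proof.
move=> [p [P [dp dP E]]] [q [Q [dq dQ E']]].
exists (fun x => q (p x)), (fun x => Q (P x)).
split; [exact: diffeo_germ_comp|exact: diffeo_germ_comp|].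
have := near_comp0 (diffeo_germ_smooth dp) (diffeo_germ0 dp) E'.
by apply: filterS2 E => x -> ->.
Qed.

Lemma A_equivalent_sym f g : smooth_at f 0 -> f 0 = 0 ->
  A_equivalent f g -> A_equivalent g f.
Proof.
move=> sf f0 [p [P [dp dP E]]].
have [q dq [qp pq]] := diffeo_germ_inv dp.
have [Q dQ [QP PQ]] := diffeo_germ_inv dP.
exists q, Q; split=> //.
have sq := diffeo_germ_smooth dq; have q0 := diffeo_germ0 dq.
have H := near_comp0 sq q0 (near_comp0 sf f0 QP).
have := near_comp0 sq q0 E.
by apply: filterS3 pq H => x Hx HQ He; rewrite -[in LHS]Hx -He HQ.
Qed.

Lemma A_equivalent_diffeo f phi Phi : diffeo_germ phi -> diffeo_germ Phi ->
  A_equivalent f (fun x => Phi (f (phi x))).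
Proof.
move=> dp dP; have [q dq [qp pq]] := diffeo_germ_inv dp.
by exists q, Phi; split=> //; apply: filterS pq => x ->.
Qed.

Definition pd (i : 'I_2) (f : 'rV[R]_2 -> R) : 'rV[R]_2 -> R := 'D_(delta_mx 0 i) f.

Lemma diffeo_germ_upd (i : 'I_2) (F : 'rV[R]_2 -> R) : smooth_at F 0 ->
  F 0 = 0 -> pd i F 0 != 0 -> diffeo_germ (fun x => upd i x (F x)).
Proof.
move=> sF F0 DF.
have u0 : upd i 0 0 = 0 :> 'rV[R]_2.
  by rewrite -[X in upd i 0 X](_ : (0 : 'rV[R]_2) 0 i = 0) ?upd_id // mxE.
have [Z []] := elementary_inverse sF DF; rewrite F0 u0 => sZ Z0 FZ ZF.
rewrite mxE in Z0.
have su G : smooth_at G 0 -> smooth_at (fun x : 'rV[R]_2 => upd i x (G x)) 0.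
  by move=> sG; apply: smooth_at_upd => //; exact: smooth_at_id.
split; [by rewrite F0|exact: su|].
exists (fun x => upd i x (Z x)); split; [by rewrite Z0|exact: su| |].
- by apply: filterS ZF => x ->; rewrite upd_upd upd_id.
- by apply: filterS FZ => x ->; rewrite upd_upd upd_id.
Qed.

Lemma derive_coord_linear (V : normedModType R) (f : V -> R) x (a : R) u v :
  differentiable f x -> 'D_(u + a *: v) f x = 'D_u f x + a * 'D_v f x.
Proof. by move=> df; rewrite !deriveE // linearD linearZ. Qed.

Theorem inverse_function_2d phi : smooth_at phi 0 -> phi 0 = 0 ->
  let p (i j : 'I_2) := pd i (fun x => phi x 0 j) 0 in
  p 0 0 != 0 -> p 0 0 * p 1 1 - p 1 0 * p 0 1 != 0 -> diffeo_germ phi.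
Proof.
move=> sphi phi0 p p00 det.
have s j : smooth_at (fun x => phi x 0 j) 0 by have /smooth_at_mxP := sphi; exact.
have z j : phi 0 0 j = 0 by rewrite phi0 mxE.
have d1 := diffeo_germ_upd (s 0) (z 0) p00.
set f1 := fun x => _ in d1.
have [g1 dg1 [gf fg]] := diffeo_germ_inv d1.
pose h x := phi (g1 x) 0 1.
have sh : smooth_at h 0.
  apply: (@smooth_at_comp _ _ _ (fun x => phi x 0 1)); rewrite ?(diffeo_germ0 dg1) //.
  exact: diffeo_germ_smooth.
have h0 : h 0 = 0 by rewrite /h (diffeo_germ0 dg1).
have sf1 := diffeo_germ_smooth d1; have f10 := diffeo_germ0 d1.
have hf : \forall x \near (0 : 'rV[R]_2), h (f1 x) = phi x 0 1.
  by apply: filterS gf => x; rewrite /h => ->.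
(* The direction that [f1] sends to the second basis vector. The partial derivative of [h] is
   therefore the derivative of the second component of [phi] along [v], which is the determinant
   divided by [p 0 0]. *)
pose v : 'rV[R]_2 := delta_mx 0 1 + (- (p 1 0 / p 0 0)) *: delta_mx 0 0.
have D0 : 'D_v f1 0 = delta_mx 0 1.
  have df1 := smooth_at_differentiable sf1.
  apply: rV2P; rewrite derive_mx_entry //.
    rewrite (_ : (fun y => f1 y 0 0) = (fun x => phi x 0 0)); last first.
      by apply/funext => y; rewrite updE eqxx.
    rewrite derive_coord_linear; last exact: smooth_at_differentiable.
    rewrite -/(pd 1 _ 0) -/(pd 0 _ 0) -/(p 0 0) -/(p 1 0) mxE /=.
    by rewrite mulNr divfK // subrr.
  rewrite (_ : (fun y => f1 y 0 1) = (fun x : 'rV[R]_2 => x 0 1)); last first.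
    by apply/funext => y; rewrite updE.
  rewrite -derive_mx_entry; last exact: smooth_at_differentiable (smooth_at_id _).
  by rewrite derive_id /v delta_row2_0 delta_row2_1 !mxE /= mulr0 addr0.
have hd : pd 1 h 0 != 0.
  have : 'D_v (fun x => h (f1 x)) 0 = 'D_v (fun x => phi x 0 1) 0.
    exact: near_eq_derive.
  rewrite derive_chain; [|exact: smooth_at_differentiable|
    by rewrite f10; exact: smooth_at_differentiable].
  rewrite D0 f10 -/(pd 1 h 0) => ->.
  rewrite derive_coord_linear; last exact: smooth_at_differentiable.
  rewrite -/(pd 1 _ 0) -/(pd 0 _ 0) -/(p 1 1) -/(p 0 1).
  apply: contra_neq det => H.
  have -> : p 0 0 * p 1 1 - p 1 0 * p 0 1 =
    p 0 0 * (p 1 1 + - (p 1 0 / p 0 0) * p 0 1) by field.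
  by rewrite H mulr0.
have d2 := diffeo_germ_upd sh h0 hd.
apply: diffeo_germ_eq (diffeo_germ_comp d2 d1) _.
apply: filterS hf => x hx; rewrite hx.
by apply: rV2P; rewrite !updE.
Qed.

End germs.

(** * Hadamard division *)

Section integral01.
Context {R : realType}.
Implicit Types f g : R -> R.

Definition I01 f : R := \int[@lebesgue_measure R]_(t in `[0, 1]) f t.

Definition cont01 f := forall t, 0 <= t <= 1 -> {for t, continuous f}.

Lemma cont01_integrable f : cont01 f ->
  (@lebesgue_measure R).-integrable `[0, 1] (EFin \o f).
Proof.
move=> cf; apply: continuous_compact_integrable; first exact: segment_compact.
apply: continuous_in_subspaceT => t; rewrite inE /= in_itv /=.
exact: cf.
Qed.

Lemma I01D f g : cont01 f -> cont01 g -> I01 (fun t => f t + g t) = I01 f + I01 g.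
Proof. by move=> cf cg; apply: RintegralD => //; exact: cont01_integrable. Qed.

Lemma I01Z c f : cont01 f -> I01 (fun t => c * f t) = c * I01 f.
Proof. by move=> cf; apply: RintegralZl => //; exact: cont01_integrable. Qed.

Lemma cont01D f g : cont01 f -> cont01 g -> cont01 (fun t => f t + g t).
Proof. by move=> cf cg t tI; apply: cvgD; [exact: cf|exact: cg]. Qed.

Lemma cont01Z c f : cont01 f -> cont01 (fun t => c * f t).
Proof. by move=> cf t tI; apply: cvgM; [exact: cvg_cst|exact: cf]. Qed.

Lemma cont01_lincomb f1 f2 g1 g2 (a b : R) :
  cont01 f1 -> cont01 f2 -> cont01 g1 -> cont01 g2 ->
  cont01 (fun t => (f1 t + -1 * f2 t) + (- a * g1 t + - b * g2 t)).
Proof.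
move=> cf1 cf2 cg1 cg2.
exact: cont01D (cont01D cf1 (@cont01Z _ _ cf2)) (cont01D (@cont01Z _ _ cg1) (@cont01Z _ _ cg2)).
Qed.

Lemma I01_lincomb f1 f2 g1 g2 (a b : R) :
  cont01 f1 -> cont01 f2 -> cont01 g1 -> cont01 g2 ->
  I01 (fun t => (f1 t + -1 * f2 t) + (- a * g1 t + - b * g2 t)) =
  I01 f1 - I01 f2 - (a * I01 g1 + b * I01 g2).
Proof.
move=> cf1 cf2 cg1 cg2.
have z c f : cont01 f -> cont01 (fun t => c * f t) by exact: cont01Z.
rewrite (I01D (cont01D cf1 (z (-1) _ cf2)) (cont01D (z (- a) _ cg1) (z (- b) _ cg2))).
rewrite (I01D cf1 (z (-1) _ cf2)) (I01D (z (- a) _ cg1) (z (- b) _ cg2)).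
by rewrite !I01Z //; ring.
Qed.

Lemma I01_cst c : I01 (fun=> c) = c.
Proof.
have m01 : lebesgue_measure (`[0, 1]%classic : set R) = 1%E.
  by rewrite lebesgue_measure_itv /= lte_fin ltr01 oppr0 adde0.
by rewrite /I01 Rintegral_cst //= m01 mulr1.
Qed.

Lemma I01_bound f M : cont01 f -> (forall t, 0 <= t <= 1 -> `|f t| <= M) ->
  `|I01 f| <= M.
Proof.
move=> cf fM; rewrite ler_norml -(I01_cst M) -(I01_cst (- I01 (fun=> M))).
have cc c : cont01 (fun=> c) by move=> t _; exact: cvg_cst.
apply/andP; split; apply: le_Rintegral => //; try exact: cont01_integrable.
  by move=> t; rewrite /= in_itv /= I01_cst => /fM; rewrite ler_norml => /andP[].
by move=> t; rewrite /= in_itv /= => /fM; rewrite ler_norml => /andP[].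
Qed.

Lemma I01_FTC g (g' : R -> R) : (forall t : R, 0 <= t <= 1 -> is_derive t 1 g (g' t)) ->
  cont01 g' -> I01 g' = g 1 - g 0.
Proof.
move=> dg cg'.
have cg (t : R) : 0 <= t <= 1 -> {for t, continuous g}.
  move=> /dg [dgt _]; apply: differentiable_continuous.
  exact/derivable1_diffP.
rewrite /I01 /Rintegral (@continuous_FTC2 _ g' g 0 1) //.
- apply: continuous_in_subspaceT => t; rewrite inE /= in_itv /=; exact: cg'.
- split.
  + by move=> t; rewrite in_itv /= => /andP[t0 t1]; have [] := dg t; rewrite ?ltW.
  + by apply: cvg_at_right_filter; apply: cg; rewrite lexx ler01.
  + by apply: cvg_at_left_filter; apply: cg; rewrite lexx ler01.
- move=> t; rewrite in_itv /= => /andP[t0 t1].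
  by rewrite derive1E; have [] := dg t; rewrite ?ltW.
Qed.

End integral01.

Lemma rV_entryD (R : realType) n (x y : 'rV[R]_n) j : (x + y) 0 j = x 0 j + y 0 j.
Proof. by rewrite mxE. Qed.

Lemma rV_entryZ (R : realType) n a (x : 'rV[R]_n) j : (a *: x) 0 j = a * x 0 j.
Proof. by rewrite mxE. Qed.

Lemma bilinear_bound (R : realType) (w0 w1 d0 d1 n e : R) :
  `|w0| <= n -> `|w1| <= n -> `|d0| <= e / 2 -> `|d1| <= e / 2 ->
  `|w0 * d0 + w1 * d1| <= e * n.
Proof.
move=> h0 h1 k0 k1; rewrite (le_trans (ler_normD _ _)) // !normrM [e]splitr mulrDl.
by rewrite lerD // mulrC ler_pM.
Qed.

Lemma sum_I2 (V : zmodType) (f : 'I_2 -> V) : \sum_j f j = f 0 + f 1.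
Proof.
rewrite big_ord_recl big_ord1; congr (f _ + f _); exact: val_inj.
Qed.

Lemma derive_rV2 (R : realType) (F : 'rV[R]_2 -> R) x v : differentiable F x ->
  'D_v F x = v 0 0 * pd 0 F x + v 0 1 * pd 1 F x.
Proof. by move=> dF; rewrite derive_rV_sum // sum_I2. Qed.

Section hadamard.
Context {R : realType}.
Variables (i : 'I_2) (r : R).
Hypothesis r0 : 0 < r.
Let B : set 'rV[R]_2 := ball 0 r.
Implicit Types (F G H : 'rV[R]_2 -> R) (x y v : 'rV[R]_2) (m : nat).

Definition squeeze_coord (t : R) (x : 'rV[R]_2) := upd i x (t * x 0 i).
Local Notation sg := squeeze_coord.

Lemma squeeze_coordE t x j : sg t x 0 j = t ^+ (j == i) * x 0 j.
Proof. by rewrite updE; case: eqP => [->|_]; rewrite ?expr1 ?expr0 ?mul1r. Qed.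

Lemma squeeze_coordD t x y : sg t (x + y) = sg t x + sg t y.
Proof.
by apply/rowP => j; rewrite [RHS]rV_entryD !squeeze_coordE rV_entryD mulrDr.
Qed.

Lemma squeeze_coordZ t a x : sg t (a *: x) = a *: sg t x.
Proof.
by apply/rowP => j; rewrite [RHS]rV_entryZ !squeeze_coordE rV_entryZ mulrCA.
Qed.

Lemma norm_squeeze_coord t x : 0 <= t <= 1 -> `|sg t x| <= `|x|.
Proof.
move=> /andP[t0 t1]; apply: rV_norm_le => // j.
rewrite squeeze_coordE normrM -[leRHS]mul1r ler_pM ?coord_le_norm //.
by case: eqP; rewrite ?expr1 ?expr0 ?normr1 // ger0_norm.
Qed.

Lemma squeeze_coord_ball t x : 0 <= t <= 1 -> B x -> B (sg t x).
Proof.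
move=> tI; rewrite /B -ball_normE /= !sub0r !normrN.
by apply: le_lt_trans; exact: norm_squeeze_coord.
Qed.

Lemma continuous_squeeze_coord t x :
  {for (t, x), continuous (fun p : R * 'rV[R]_2 => sg p.1 p.2)}.
Proof.
apply: smooth_at_continuous; apply: smooth_at_upd.
  by apply: smooth_at_lin => p; exact: cvg_snd.
apply: smooth_atM.
  by apply: smooth_at_lin => p; exact: cvg_fst.
apply: (@smooth_at_comp _ _ _ (fun y : 'rV[R]_2 => y 0 i)).
  exact: smooth_at_coord.
by apply: smooth_at_lin => p; exact: cvg_snd.
Qed.

(** Compactness of the interval, in the form of near-coverings, makes continuity at [sg t x] uniform
    in [t]. *)
Lemma squeeze_uniform H x (e : R) : (forall x, B x -> {for x, continuous H}) -> B x ->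
  0 < e ->
  \forall y \near x, forall t, 0 <= t <= 1 -> `|H (sg t y) - H (sg t x)| <= e.
Proof.
move=> cH Bx e0.
have /compact_near_coveringP cpt := @segment_compact R 0 1.
have /= := cpt _ (nbhs x) (fun y t => `|H (sg t y) - H (sg t x)| <= e) _.
have K (t : R) : `[0, 1]%classic t ->
    \forall t' \near t & y \near x, `|H (sg t' y) - H (sg t' x)| <= e.
  rewrite /= in_itv /= => tI.
  have cc : {for (t, x), continuous (fun p : R * 'rV[R]_2 => H (sg p.1 p.2))}.
    apply: continuous_comp; first exact: continuous_squeeze_coord.
    by apply: cH; exact: squeeze_coord_ball.
  have e2 : 0 < e / 2 by rewrite divr_gt0.
  have n1 : \forall p \near (t, x), `|H (sg t x) - H (sg p.1 p.2)| <= e / 2.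
    by have /cvgrPdist_le/(_ _ e2) := cc.
  have [[A1 A2] /= [nA1 nA2] HA] := n1.
  exists (A1, A2) => // -[t' y] /= [A1t A2y].
  have /= h1 := HA (t', y) (conj A1t A2y).
  have /= h2 := HA (t', x) (conj A1t (nbhs_singleton nA2)).
  rewrite (splitr e) distrC.
  rewrite -(subrKA (H (sg t x)) (H (sg t' x))) (le_trans (ler_normD _ _)) //.
  by rewrite lerD // distrC.
move=> /(_ _ K) {}K.
apply: filterS K => y Hy t tI; apply: Hy; by rewrite /= in_itv.
Qed.

(* [F x - F (sg 0 x)] is [x_i] times the case [m = 0] applied to the [i]-th partial
   derivative; the weights [t ^ m] appear when differentiating under the integral. *)
Definition fiber_int m F x := I01 (fun t => t ^+ m * F (sg t x)).

Lemma fiber_cont01 m H x : (forall x, B x -> {for x, continuous H}) -> B x ->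
  cont01 (fun t => t ^+ m * H (sg t x)).
Proof.
move=> cH Bx t tI; apply: cvgM; first exact: exprn_continuous.
have cs : {for t, continuous (fun t => sg t x)}.
  apply: smooth_at_continuous; apply: smooth_at_upd; first exact: smooth_at_cst.
  by apply: smooth_atM; [exact: smooth_at_id|exact: smooth_at_cst].
by apply: continuous_comp; [exact: cs|apply: cH; exact: squeeze_coord_ball].
Qed.

Section smooth_integrand.
Variable F : 'rV[R]_2 -> R.
Hypothesis CF : forall k, Ck_on k B F.

Local Lemma CF_diff x : B x -> differentiable F x.
Proof. by have [dF _] := CF 1%N; exact: dF. Qed.

Local Lemma CF_cont x : B x -> {for x, continuous F}.
Proof. exact: (CF 0%N). Qed.

Local Lemma CF_pd j k : Ck_on k B (pd j F).
Proof. by have [_ DF] := CF k.+1; exact: DF. Qed.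

Local Lemma CF_pd_cont j x : B x -> {for x, continuous (pd j F)}.
Proof. exact: (CF_pd j 0%N). Qed.

(** Mean value inequality on the segment from [sg t x] to [sg t y], where the variation of the
    partial derivatives is controlled uniformly in [t]. The uniformity is what permits
    differentiation under the integral. *)
Lemma taylor1_uniform x e : B x -> 0 < e ->
  \forall y \near x, forall t, 0 <= t <= 1 ->
    `|F (sg t y) - F (sg t x) - 'D_(sg t (y - x)) F (sg t x)| <= e * `|y - x|.
Proof.
move=> Bx e0; have e2 : 0 < e / 2 by rewrite divr_gt0.
have u j := squeeze_uniform (@CF_pd_cont j) Bx e2.
have nB : \forall y \near x, B y by apply: near_open => //; exact: ball_open.
(* A ball is needed here, since it contains the whole segment from [x] to [y]. *)
have /nbhs_ballP [d /= d0 Hd] : nbhs x [set y | B y /\ forall j t, 0 <= t <= 1 ->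
    `|pd j F (sg t y) - pd j F (sg t x)| <= e / 2].
  have nu : \forall y \near x, forall j t, 0 <= t <= 1 ->
      `|pd j F (sg t y) - pd j F (sg t x)| <= e / 2.
    exact: (@filter_forall _ _ _ _ (nbhs_filter x) u).
  by apply: filterS2 nB nu.
have nd := nbhsx_ballx x d d0.
apply: filterS nd => y yd t tI.
set h := y - x; set w := sg t h.
pose phi s := F (sg t x + s *: w) - s * 'D_w F (sg t x).
have yE : sg t y = sg t x + 1 *: w.
  by rewrite scale1r /w -squeeze_coordD /h addrC subrK.
have -> : F (sg t y) - F (sg t x) - 'D_w F (sg t x) = phi 1 - phi 0.
  by rewrite /phi yE scale0r addr0 mul1r mul0r subr0; ring.
have xs s : 0 <= s <= 1 -> ball x d (x + s *: h).
  move=> /andP[s0 s1]; move: yd; rewrite -!ball_normE /= opprD addNKr normrN.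
  rewrite normrZ ger0_norm // -/h distrC -/h => hd.
  by apply: le_lt_trans hd; rewrite -[leRHS]mul1r ler_wpM2r.
have pE s : sg t x + s *: w = sg t (x + s *: h).
  by rewrite /w -squeeze_coordZ -squeeze_coordD.
have I01E (s : R) : Num.min 0 1 <= s <= Num.max 0 1 -> 0 <= s <= 1.
  by rewrite (min_idPl ler01) (max_idPr ler01).
have := @derivable_bound R phi
  (fun s => 'D_w F (sg t x + s *: w) - 'D_w F (sg t x)) 0 1 (e * `|h|).
rewrite subr0 normr1 mulr1; apply => s /I01E sI.
  have [Bs _] := Hd _ (xs s sI).
  have dF : differentiable F (sg t x + s *: w).
    by rewrite pE; apply: CF_diff; exact: squeeze_coord_ball.
  have dl := is_derive_line dF.
  rewrite /phi.
  have -> : (fun s => F (sg t x + s *: w) - s * 'D_w F (sg t x)) =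
     (fun s => F (sg t x + s *: w)) \- ('D_w F (sg t x) *: (id : R -> R)).
    by apply/funext => s' /=; rewrite mulrC.
  apply: is_derive_eq.
  by rewrite -[_ *: 1]/(_ * 1) mulr1.
have [Bs Hs'] := Hd _ (xs s sI); have Hs j := Hs' j t tI.
have dFs : differentiable F (sg t x + s *: w).
  by rewrite pE; apply: CF_diff; exact: squeeze_coord_ball.
have dFx : differentiable F (sg t x) by apply: CF_diff; exact: squeeze_coord_ball.
rewrite (derive_rV2 w dFs) (derive_rV2 w dFx) pE.
set a0 := pd 0 F (sg t x); set a1 := pd 1 F (sg t x).
set b0 := pd 0 F _; set b1 := pd 1 F _.
have -> : w 0 0 * b0 + w 0 1 * b1 - (w 0 0 * a0 + w 0 1 * a1) =
   w 0 0 * (b0 - a0) + w 0 1 * (b1 - a1) by ring.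
have wj j : `|w 0 j| <= `|h|.
  by rewrite (le_trans (coord_le_norm _ _)) // norm_squeeze_coord.
exact: (bilinear_bound (wj 0) (wj 1) (Hs 0) (Hs 1)).
Qed.

(** Only the [i]-th coordinate is multiplied by [t], so the chain rule gives an extra factor [t]
    exactly for [j = i]. *)
Let c m x j := fiber_int (m + (j == i)) (pd j F) x.
Let L m x (v : 'rV[R]_2) := v 0 0 * c m x 0 + v 0 1 * c m x 1.

Lemma fiber_int_diff m x : B x -> differentiable (fiber_int m F) x /\
  forall v, 'D_v (fiber_int m F) x = L m x v.
Proof.
move=> Bx.
have linL : linear (L m x : 'rV[R]_2 -> R).
  by move=> a u v; rewrite /L; move: (c m x 0) (c m x 1) => c0 c1; rewrite !rV_entryD !rV_entryZ -[a *: _]/(a * _); ring.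
pose glM := GRing.isLinear.Build _ _ _ _ _ linL.
pose gL : {linear 'rV[R]_2 -> R} := HB.pack (L m x) glM.
have cL : continuous (L m x).
  move=> v; apply: smooth_at_continuous; apply: smooth_atD;
  by apply: smooth_atM; [exact: smooth_at_coord|exact: smooth_at_cst].
suff [dT TE] : differentiable (fiber_int m F) x /\
    'd (fiber_int m F) x = gL :> (_ -> _).
  by split=> // v; rewrite (deriveE v dT) TE.
apply: differentiable_criterion => // e e0.
have nB : \forall y \near x, B y by apply: near_open => //; exact: ball_open.
have nT := taylor1_uniform Bx e0.
apply: filterS2 nB nT => y By Hy.
set h := y - x.
pose g j t := t ^+ (m + (j == i)) * pd j F (sg t x).
have cg j : cont01 (g j) by apply: fiber_cont01 => // ?; exact: CF_pd_cont.
have cF z : B z -> cont01 (fun t => t ^+ m * F (sg t z)).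
  by move=> Bz; apply: fiber_cont01 => // ?; exact: CF_cont.
have -> : fiber_int m F y - fiber_int m F x - gL h =
    I01 (fun t => (t ^+ m * F (sg t y) + -1 * (t ^+ m * F (sg t x))) +
                  (- h 0 0 * g 0 t + - h 0 1 * g 1 t)).
  exact: esym (I01_lincomb _ _ (cF _ By) (cF _ Bx) (cg 0) (cg 1)).
apply: I01_bound => [|t tI].
  exact: (cont01_lincomb (cF _ By) (cF _ Bx) (cg 0) (cg 1)).
have dFx : differentiable F (sg t x) by apply: CF_diff; exact: squeeze_coord_ball.
have -> : (t ^+ m * F (sg t y) + -1 * (t ^+ m * F (sg t x))) +
                  (- h 0 0 * g 0 t + - h 0 1 * g 1 t) =
   t ^+ m * (F (sg t y) - F (sg t x) - 'D_(sg t h) F (sg t x)).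
  rewrite derive_rV2 // /g !squeeze_coordE !exprD.
  by move: (F _) (F _) (pd 0 F _) (pd 1 F _) (h 0 0) (h 0 1) => *; ring.
have /andP[t0 t1] := tI.
rewrite normrM -[leRHS]mul1r ler_pM //; last exact: Hy.
by rewrite ger0_norm ?exprn_ge0 // exprn_ile1.
Qed.

End smooth_integrand.

(** The induction lets [m] and [F] vary, since a derivative of the integral has a new weight and a
    partial derivative of [F] as integrand. *)
Lemma fiber_int_Ck k m F : (forall k, Ck_on k B F) -> Ck_on k B (fiber_int m F).
Proof.
have oB : open B by exact: ball_open.
elim: k m F => [|k IH] m F CF.
  by move=> x Bx; apply: differentiable_continuous; exact: (fiber_int_diff CF m Bx).1.
split=> [x Bx|v]; first exact: (fiber_int_diff CF m Bx).1.
have cp j : Ck_on k B (fun x => v 0 j * fiber_int (m + (j == i)) (pd j F) x).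
  apply: Ck_onM => //; first exact: Ck_on_cst.
  by apply: IH => k'; exact: CF_pd.
apply: Ck_on_eq (Ck_onD oB (cp 0) (cp 1)) => // x Bx.
by rewrite (fiber_int_diff CF m Bx).2.
Qed.

Lemma fiber_int_FTC F x : (forall k, Ck_on k B F) -> B x ->
  F x - F (upd i x 0) = x 0 i * fiber_int 0 (pd i F) x.
Proof.
move=> CF Bx.
have cp := @fiber_cont01 0 (pd i F) x (@CF_pd_cont F CF i) Bx.
rewrite /fiber_int -(I01Z _ cp).
have dg (t : R) : 0 <= t <= 1 ->
    is_derive t 1 (fun t => F (sg t x)) (x 0 i * (t ^+ 0 * pd i F (sg t x))).
  move=> tI; rewrite expr0 mul1r mulrC.
  have dF : differentiable F (sg t x) by apply: (CF_diff CF); exact: squeeze_coord_ball.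
  have dFu := is_derive_upd dF.
  pose lin : R -> R := x 0 i *: (id : R -> R).
  have E s : lin s = s * x 0 i by rewrite /lin /= mulrC.
  have dlin : is_derive t 1 lin (x 0 i).
    by apply: is_derive_eq; rewrite -[_ *: 1]/(_ * 1) mulr1.
  rewrite -E in dFu.
  have := is_derive1_comp dFu dlin.
  rewrite E; congr (is_derive t 1 _ _).
  by apply/funext => s; rewrite /= E.
have cg : cont01 (fun t => x 0 i * (t ^+ 0 * pd i F (sg t x))) by exact: cont01Z.
by rewrite (I01_FTC dg cg) /squeeze_coord mul1r mul0r upd_id.
Qed.

End hadamard.

Section hadamard_germs.
Context {R : realType}.

Lemma hadamard_coord (i : 'I_2) (F : 'rV[R]_2 -> R) : smooth_at F 0 ->
  exists2 G : 'rV[R]_2 -> R, smooth_at G 0 &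
    \forall x \near (0 : 'rV[R]_2), F x - F (upd i x 0) = x 0 i * G x.
Proof.
move=> [U [oU U0 UF]].
have /nbhs_ballP [r /= r0 Hr] := near_open oU U0.
have CF k : Ck_on k (ball 0 r) F by apply: Ck_on_sub (UF k).
exists (fiber_int i 0 (pd i F)).
  exists (ball 0 r); split; [exact: ball_open|exact: ballxx|move=> k].
  apply: fiber_int_Ck => // k'.
  by have [_ DF] := CF k'.+1; exact: DF.
have := nbhsx_ballx (0 : 'rV[R]_2) r r0; apply: filterS => x xB.
by apply: (@fiber_int_FTC _ i r).
Qed.

(** The plane version, applied to a function of the first coordinate alone and restricted to the
    first axis. *)
Lemma hadamard1 (k : R -> R) : smooth_at k 0 ->
  exists2 g : R -> R, smooth_at g 0 & \forall x \near (0 : R), k x = k 0 + x * g x.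
Proof.
move=> sk.
have sF : smooth_at (fun x : 'rV[R]_2 => k (x 0 0)) 0.
  by apply: (@smooth_at_comp1 _ _ k); [rewrite mxE|exact: smooth_at_coord].
have [G sG HG] := hadamard_coord 0 sF.
have s2 : smooth_at (fun u : R => row2 u 0) 0.
  by apply: smooth_at_row2; [exact: smooth_at_id|exact: smooth_at_cst].
exists (fun u => G (row2 u 0)).
  by apply: smooth_at_comp => //; rewrite row2_0.
have := near_comp0 s2 row2_0 HG; apply: filterS => u.
by rewrite updE !row2E /= => <-; rewrite addrC subrK.
Qed.

Lemma hadamard_axis (i : 'I_2) (F : 'rV[R]_2 -> R) : smooth_at F 0 ->
  (\forall x \near (0 : 'rV[R]_2), F (upd i x 0) = 0) ->
  exists2 G : 'rV[R]_2 -> R, smooth_at G 0 &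
    \forall x \near (0 : 'rV[R]_2), F x = x 0 i * G x.
Proof.
move=> /(hadamard_coord i) [G sG HG] F0; exists G => //.
by apply: filterS2 HG F0 => x <- ->; rewrite subr0.
Qed.

End hadamard_germs.

(** * Borel's theorem and even germs *)

Section geometric_domination.
Context {R : realType}.
Implicit Types u v : R ^nat.

Lemma sum_half n : \sum_(0 <= k < n) (2^-1 : R) ^+ k = 2 - 2 * 2^-1 ^+ n.
Proof.
elim: n => [|n IH]; first by rewrite big_geq // expr0 mulr1 subrr.
by rewrite big_nat_recr //= IH exprS; field.
Qed.

Lemma sum_half_le m n : \sum_(m <= k < n) (2^-1 : R) ^+ k <= 2.
Proof.
have p0 k : 0 <= (2^-1 : R) ^+ k by rewrite exprn_ge0.
apply: (@le_trans _ _ (\sum_(0 <= k < n) (2^-1 : R) ^+ k)).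
  have [mn|nm] := leqP m n; last by rewrite big_geq ?sumr_ge0 // ltnW.
  by rewrite (big_cat_nat (leq0n m) mn) /= lerDr sumr_ge0.
by rewrite sum_half gerBl mulr_ge0.
Qed.

Definition half_dominated (C : R) u := forall m, `|u m| <= C * 2^-1 ^+ m.

Lemma half_dominated_cvg C u : half_dominated C u -> cvgn (series u).
Proof.
move=> Hu; apply: normed_cvg.
have C0 : 0 <= C by have := Hu 0%N; rewrite expr0 mulr1; apply: le_trans.
apply: (@series_le_cvg _ _ (geometric C 2^-1)).
- by move=> n; exact: normr_ge0.
- by move=> n; rewrite /= mulr_ge0 // exprn_ge0.
- exact: Hu.
apply: is_cvg_geometric_series; rewrite ger0_norm // invf_lt1 ?ltr0n //.
by rewrite (ltr_nat R 1 2).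
Qed.

(** The bound is asked only from [n] on: in Borel's theorem it is these terms that carry a factor
    [|x| ^ n], which enters [C]. *)
Lemma half_dominated_tail C u n : 0 <= C -> cvgn (series u) ->
  (forall m, (n <= m)%N -> `|u m| <= C * 2^-1 ^+ m) ->
  `|limn (series u) - series u n| <= 2 * C.
Proof.
move=> C0 cu Hu.
have cd : series u k - series u n @[k --> \oo] --> limn (series u) - series u n.
  by apply: cvgB => //; exact: cvg_cst.
have cn : `|series u k - series u n| @[k --> \oo] --> `|limn (series u) - series u n|.
  exact: cvg_norm cd.
rewrite -(cvg_lim _ cn) //; apply: limr_le; first by apply/cvg_ex; eexists; exact: cn.
near=> k.
have nk : (n <= k)%N by near: k; exact: nbhs_infty_ge.
rewrite sub_series_geq // (le_trans (ler_norm_sum _ _ _)) //.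
apply: (@le_trans _ _ (\sum_(n <= i < k) C * 2^-1 ^+ i)).
  by rewrite !big_nat; apply: ler_sum => i /andP[ni _]; exact: Hu.
by rewrite -mulr_sumr mulrC ler_wpM2r // sum_half_le.
Unshelve. all: by end_near. Qed.

Lemma half_dominated_lim C u : half_dominated C u -> `|limn (series u)| <= 2 * C.
Proof.
move=> Hu; have C0 : 0 <= C by have := Hu 0%N; rewrite expr0 mulr1; apply: le_trans.
have := @half_dominated_tail C u 0 C0 (half_dominated_cvg Hu) (fun m _ => Hu m).
by rewrite /series /= big_geq // subr0.
Qed.

Lemma between_le (a b s : R) : Num.min a b <= s <= Num.max a b ->
  `|s - a| <= `|b - a|.
Proof.
case: (leP a b) => ab /andP[h1 h2].
  by rewrite !ger0_norm; lra.
by rewrite !ler0_norm; lra.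
Qed.

(** Quadratic remainders are how derivatives are obtained for series of functions and for
    [sqrt_lift] at 0. *)
Lemma is_derive_quadratic (f : R -> R) (x l K : R) : 0 <= K ->
  (\forall y \near x, `|f y - f x - (y - x) * l| <= K * `|y - x| ^+ 2) ->
  is_derive x 1 f l.
Proof.
move=> K0 H.
have linL : linear (fun h : R => h * l).
  by move=> a u v; rewrite -[a *: u]/(a * u) -[a *: _]/(a * _); ring.
pose glM := GRing.isLinear.Build _ _ _ _ _ linL.
pose gL : {linear R -> R} := HB.pack (fun h : R => h * l) glM.
have cL : continuous gL.
  by move=> h; apply: cvgM; [exact: cvg_id|exact: cvg_cst].
have [df dE] : differentiable f x /\ 'd f x = gL :> (R -> R).
  apply: differentiable_criterion => // e e0.
  have eK : 0 < e / (K + 1) by rewrite divr_gt0 // ltr_wpDl.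
  have := nbhsx_ballx x _ eK; apply: filterS2 H => y Hy; rewrite -ball_normE /= => yx.
  apply: le_trans Hy _; rewrite expr2 mulrA ler_wpM2r //.
  rewrite ltr_pdivlMr ?ltr_wpDl // distrC mulrC mulrDl mul1r in yx.
  by rewrite (le_trans _ (ltW yx)) // lerDl.
split; first exact/derivable1_diffP.
have -> : 'D_1 f x = 'd f x 1 by rewrite deriveE.
by rewrite dE /= mul1r.
Qed.

(** [phi k m] stands for the [k]-th derivative of the [m]-th term of a series. The constants of
    domination may depend on [k], but not on the point. *)
Variable phi : nat -> nat -> R -> R.
Hypothesis dphi : forall k m (x : R), is_derive x 1 (phi k m) (phi k.+1 m x).
Hypothesis bphi : forall k, exists C, forall x, half_dominated C (fun m => phi k m x).

Definition sum_phi k x := limn (series (fun m => phi k m x)).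

(** Two mean value estimates bound the distance of the [m]-th term from its tangent by
    [C 2^-m |y - x|^2], where [C] comes from the order [k + 2]. Summation leaves a quadratic
    remainder. *)
Lemma sum_phi_derive k (x : R) : is_derive x 1 (sum_phi k) (sum_phi k.+1 x).
Proof.
have [C HC] := bphi k.+2.
have [C1 HC1] := bphi k.+1.
have [C0 HC0] := bphi k.
have dif m a b : `|phi k.+1 m b - phi k.+1 m a| <= C * 2^-1 ^+ m * `|b - a|.
  apply: (@derivable_bound _ (phi k.+1 m) (phi k.+2 m)) => s _.
  exact: HC.
have C_ge0 : 0 <= C.
  by have := HC 0 0%N; rewrite expr0 mulr1; apply: le_trans.
apply: (@is_derive_quadratic _ _ _ (2 * C)); first by rewrite mulr_ge0.
apply: filterE => y.
have c0 z := half_dominated_cvg (HC0 z).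
have c1 z := half_dominated_cvg (HC1 z).
pose u m := phi k m y - phi k m x - (y - x) * phi k.+1 m x.
have -> : sum_phi k y - sum_phi k x - (y - x) * sum_phi k.+1 x = limn (series u).
  rewrite /sum_phi.
  pose v : R ^nat := fun m => phi k.+1 m x.
  have eZ : limn (series ((y - x) *: v)) = (y - x) * limn (series v).
    exact: lim_seriesZ (c1 x).
  rewrite -/v -eZ -lim_seriesB // -lim_seriesB //; first exact: is_cvg_seriesB.
  exact: is_cvg_seriesZ (c1 x).
have -> : 2 * C * `|y - x| ^+ 2 = 2 * (C * `|y - x| ^+ 2) by rewrite mulrA.
apply: half_dominated_lim => m; rewrite /u.
pose g s := phi k m s - s * phi k.+1 m x.
have -> : phi k m y - phi k m x - (y - x) * phi k.+1 m x = g y - g x.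
  by rewrite /g; ring.
have -> : C * `|y - x| ^+ 2 * 2^-1 ^+ m = C * 2^-1 ^+ m * `|y - x| * `|y - x|.
  by ring.
apply: (@derivable_bound _ g (fun s => phi k.+1 m s - phi k.+1 m x)) => s sI.
  have dk := dphi k m s.
  rewrite /g.
  have -> : (fun s => phi k m s - s * phi k.+1 m x) =
     phi k m \- (phi k.+1 m x *: (id : R -> R)).
    by apply/funext => s' /=; rewrite mulrC.
  apply: is_derive_eq.
  by rewrite -[_ *: 1]/(_ * 1) mulr1.
apply: le_trans (dif m x s) _; apply: ler_wpM2l.
  exact: le_trans (normr_ge0 _) (HC 0 m).
exact: between_le.
Qed.

Lemma sum_phi_Ck j k : Ck_on j [set: R] (sum_phi k).
Proof.
elim: j k => [|j IH] k.
  move=> x _; apply: differentiable_continuous; apply/derivable1_diffP.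
  by have [] := sum_phi_derive k x.
apply: (Ck_on_S1 (f' := sum_phi k.+1)) => //; first exact: openT.
by move=> x _; exact: sum_phi_derive.
Qed.

End geometric_domination.

Section bounded_derivatives.
Context {R : realType}.
Implicit Types f g : R -> R.

(** Meant for powers of sine, which take the place of the cutoff functions in the usual proof of
    Borel's theorem. *)
Fixpoint bdd_derivs k f : Prop := (exists M, forall x, `|f x| <= M) /\
  (if k is k'.+1 then (forall x, derivable f x 1) /\ bdd_derivs k' (derive1 f) else True).

Lemma bdd_derivs_bound k f : bdd_derivs k f -> exists M, forall x, `|f x| <= M.
Proof. by case: k => [|k] []. Qed.

Lemma bdd_derivs_pred k f : bdd_derivs k.+1 f -> bdd_derivs k f.
Proof.
elim: k f => [|k IH] f; first by move=> [].
by move=> [bf [df /IH ?]]; split.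
Qed.

Lemma bdd_derivsD k f g : bdd_derivs k f -> bdd_derivs k g ->
  bdd_derivs k (fun x => f x + g x).
Proof.
have bD f' g' : (exists M, forall x, `|f' x| <= M) ->
    (exists M, forall x, `|g' x| <= M) -> exists M, forall x : R, `|f' x + g' x : R| <= M.
  move=> [M HM] [N HN]; exists (M + N) => x.
  by rewrite (le_trans (ler_normD _ _)) // lerD.
elim: k f g => [|k IH] f g [bf df] [bg dg]; split=> //; try exact: bD.
move: df dg => [df Bf] [dg Bg]; split.
  by move=> x; apply: derivableD; [exact: df|exact: dg].
have -> : derive1 (fun x => f x + g x) = (fun x => derive1 f x + derive1 g x).
  by apply/funext => x; rewrite !derive1E deriveD.
exact: IH.
Qed.

Lemma bdd_derivsM k f g : bdd_derivs k f -> bdd_derivs k g ->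
  bdd_derivs k (fun x => f x * g x).
Proof.
have bM f' g' : (exists M, forall x, `|f' x| <= M) ->
    (exists M, forall x, `|g' x| <= M) -> exists M, forall x : R, `|f' x * g' x : R| <= M.
  move=> [M HM] [N HN]; exists (M * N) => x.
  by rewrite normrM ler_pM.
elim: k f g => [|k IH] f g Hf Hg; have [bf df] := Hf; have [bg dg] := Hg;
  split=> //; try exact: bM.
move: df dg => [df Bf] [dg Bg]; split.
  by move=> x; apply: derivableM; [exact: df|exact: dg].
have -> : derive1 (fun x => f x * g x) = (fun x => f x * derive1 g x + g x * derive1 f x).
  by apply/funext => x; rewrite !derive1E deriveM.
by apply: bdd_derivsD; apply: IH => //; exact: bdd_derivs_pred.
Qed.

Lemma bdd_derivs_cst k (c : R) : bdd_derivs k (fun=> c).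
Proof.
elim: k c => [|k IH] c; split=> //; try by exists `|c|.
split=> [x|]; first exact: derivable_cst.
have -> : derive1 (fun=> c) = (fun=> 0 : R) by apply/funext => x; rewrite derive1_cst.
exact: IH.
Qed.

Lemma bdd_derivs_sin_cos k : bdd_derivs k (sin : R -> R) /\ bdd_derivs k (cos : R -> R).
Proof.
have bs : exists M, forall x : R, `|sin x| <= M.
  by exists 1 => x; rewrite ler_norml sin_geN1 sin_le1.
have bc : exists M, forall x : R, `|cos x| <= M.
  by exists 1 => x; rewrite ler_norml cos_geN1 cos_le1.
elim: k => [|k [IHs IHc]]; first by [].
split; split=> //; split.
- by move=> x; have [] := is_derive_sin x.
- have -> : derive1 (sin : R -> R) = cos; last exact: IHc.
  by apply/funext => x; rewrite derive1E; have [] := is_derive_sin x.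
- by move=> x; have [] := is_derive_cos x.
- have -> : derive1 (cos : R -> R) = (fun x => -1 * sin x).
    by apply/funext => x; rewrite derive1E mulN1r; have [] := is_derive_cos x.
  by apply: bdd_derivsM => //; exact: bdd_derivs_cst.
Qed.

Lemma bdd_derivs_sinX k m : bdd_derivs k (fun x : R => sin x ^+ m).
Proof.
elim: m => [|m IH]; first exact: bdd_derivs_cst.
have -> : (fun x : R => sin x ^+ m.+1) = (fun x => sin x * sin x ^+ m).
  by apply/funext => x; rewrite exprS.
by apply: bdd_derivsM => //; have [] := bdd_derivs_sin_cos k.
Qed.

Lemma bdd_derivs_derive1n k j f : bdd_derivs (k + j) f -> bdd_derivs j (derive1n k f).
Proof.
elim: k f => [|k IH] f //; rewrite addSn => -[_ [_ /IH]].
by rewrite derive1Sn.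
Qed.

Lemma derivable_sinX k m (x : R) : derivable (derive1n k (fun x : R => sin x ^+ m)) x 1.
Proof.
have /bdd_derivs_derive1n [_ [+ _]] := bdd_derivs_sinX (k + 1) m; exact.
Qed.

Lemma abs_sin_le (x : R) : `|sin x| <= `|x|.
Proof.
have := @derivable_bound R sin cos 0 x 1.
rewrite sin0 !subr0 mul1r; apply => // s _.
by rewrite ler_norml cos_geN1 cos_le1.
Qed.

End bounded_derivatives.

Section borel.
Context {R : realType}.

Local Lemma sinX_bound_ex m k : exists M : R, 0 <= M /\
  forall x, `|(derive1n k (fun x : R => sin x ^+ m)) x| <= M.
Proof.
have /bdd_derivs_derive1n/bdd_derivs_bound [M HM] := @bdd_derivs_sinX R (k + 0) m.
by exists M; split=> //; apply: le_trans (HM 0).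
Qed.

Definition sinX_bound m k : R := sval (cid (sinX_bound_ex m k)).

Lemma sinX_bound_ge0 m k : 0 <= sinX_bound m k.
Proof. by rewrite /sinX_bound; case: cid => M []. Qed.

Lemma sinX_boundP m k x : `|(derive1n k (fun x : R => sin x ^+ m)) x| <= sinX_bound m k.
Proof. by rewrite /sinX_bound; case: cid => M /= []. Qed.

(* Large enough for the derivatives of order [< m] of the [m]-th term to be
   dominated by [2 ^- m]. *)
Definition borel_scale m (c : R) : R :=
  1 + `|c| * 2 ^+ m * (1 + \sum_(k < m) sinX_bound m k).

Lemma borel_scale_ge1 m c : 1 <= borel_scale m c.
Proof.
have s0 : 0 <= \sum_(k < m) sinX_bound m k.
  by apply: sumr_ge0 => k _; exact: sinX_bound_ge0.
by rewrite lerDl !mulr_ge0 ?exprn_ge0 ?addr_ge0.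
Qed.

Lemma borel_scale_gt0 m c : 0 < borel_scale m c.
Proof. exact: lt_le_trans ltr01 (borel_scale_ge1 m c). Qed.

Lemma borel_scale_bound m c k : (k < m)%N ->
  `|c| * sinX_bound m k / borel_scale m c <= 2^-1 ^+ m.
Proof.
move=> km; rewrite ler_pdivrMr ?borel_scale_gt0 // exprVn [leRHS]mulrC.
rewrite ler_pdivlMr ?exprn_gt0 // /borel_scale.
rewrite (bigD1 (Ordinal km)) //=.
have s0 : 0 <= \sum_(i < m | i != Ordinal km) sinX_bound m i.
  by apply: sumr_ge0 => i _; exact: sinX_bound_ge0.
have b0 := sinX_bound_ge0 m k.
have e0 : 0 <= `|c| * 2 ^+ m by rewrite mulr_ge0 // exprn_ge0.
set s := \sum_(i < m | _) _ in s0 *; set b := sinX_bound m k in b0 *.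
have : `|c| * 2 ^+ m * b <= `|c| * 2 ^+ m * (1 + (b + s)).
  by rewrite ler_wpM2l //; lra.
rewrite mulrAC; set q := `|c| * 2 ^+ m in e0 *; move=> h; lra.
Qed.

Lemma borel_scale_bound1 m c : `|c| / borel_scale m c <= 2^-1 ^+ m.
Proof.
rewrite ler_pdivrMr ?borel_scale_gt0 // exprVn [leRHS]mulrC.
rewrite ler_pdivlMr ?exprn_gt0 // /borel_scale.
have s0 : 0 <= \sum_(i < m) sinX_bound m i.
  by apply: sumr_ge0 => i _; exact: sinX_bound_ge0.
have e0 : 0 <= `|c| * 2 ^+ m by rewrite mulr_ge0 // exprn_ge0.
set q := `|c| * 2 ^+ m in e0 *.
have : q * 1 <= q * (1 + \sum_(i < m) sinX_bound m i) by rewrite ler_wpM2l // lerDl.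
by rewrite mulr1 => h; lra.
Qed.

(* The [k]-th derivative of [c * (sin (l x) / l) ^ m], which has the jet [c x ^ m] to
   order [m] and, unlike it, globally bounded derivatives. *)
Definition borel_term m (c : R) k (x : R) : R :=
  c * borel_scale m c ^- m * borel_scale m c ^+ k *
  (derive1n k (fun x : R => sin x ^+ m)) (borel_scale m c * x).

Lemma borel_term0 m c x : borel_term m c 0 x =
  c * (sin (borel_scale m c * x) / borel_scale m c) ^+ m.
Proof. by rewrite /borel_term derive1n0 expr0 mulr1 expr_div_n; ring. Qed.

Lemma borel_term_derive m c k (x : R) :
  is_derive x 1 (borel_term m c k) (borel_term m c k.+1 x).
Proof.
set l := borel_scale m c.
pose lin : R -> R := l *: (id : R -> R).
pose S := derive1n k (fun x : R => sin x ^+ m).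
have dlin : is_derive x 1 lin l.
  by apply: is_derive_eq; rewrite -[_ *: 1]/(_ * 1) mulr1.
have dS : is_derive (lin x) 1 S (derive1n k.+1 (fun x : R => sin x ^+ m) (lin x)).
  rewrite derive1nS derive1E; split=> //; exact: derivable_sinX.
have dc := is_derive1_comp dS dlin.
have -> : borel_term m c k = (c * l ^- m * l ^+ k) *: (S \o lin).
  by apply/funext => y.
apply: is_derive_eq.
rewrite /borel_term -/l exprS -[lin x]/(l * x) -[LHS]/(_ * _).
by move: (derive1n _ _ _) => z; ring.
Qed.

(** The choice of the scale handles all terms with [m > k]; the finitely many others are covered by
    the sum of the [q m] in the constant. *)
Lemma borel_term_dominated (c : nat -> R) k :
  exists C, forall x, half_dominated C (fun m => borel_term m (c m) k x).
Proof.
pose q m := `|c m * borel_scale m (c m) ^- m * borel_scale m (c m) ^+ k| *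
  sinX_bound m k * 2 ^+ m.
have q0 m : 0 <= q m by rewrite !mulr_ge0 // ?sinX_bound_ge0 // exprn_ge0.
exists (1 + \sum_(m < k.+1) q m) => x m.
have b : `|borel_term m (c m) k x| <= q m * 2^-1 ^+ m.
  rewrite /q -mulrA -exprMn divff // expr1n mulr1 /borel_term normrM.
  by rewrite ler_wpM2l // sinX_boundP.
apply: (le_trans b); rewrite ler_wpM2r ?exprn_ge0 //.
have [mk|km] := leqP m k.
  rewrite (bigD1 (Ordinal (mk : (m < k.+1)%N))) //= addrCA lerDl addr_ge0 //.
  by apply: sumr_ge0.
rewrite (@le_trans _ _ 1) // ?lerDl ?sumr_ge0 //.
rewrite /q -ler_pdivlMr ?exprn_gt0 // mul1r -[leRHS]exprVn.
apply: (le_trans _ (borel_scale_bound (c m) km)).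
have l0 := borel_scale_gt0 m (c m); have l1 := borel_scale_ge1 m (c m).
set l := borel_scale m (c m) in l0 l1 *.
have H : l ^- m * l ^+ k <= l^-1.
  rewrite mulrC ler_pdivrMr ?exprn_gt0 // [leRHS]mulrC ler_pdivlMr // -exprSr.
  exact: ler_weXn2l.
have H0 : 0 <= l ^- m * l ^+ k by rewrite mulr_ge0 ?invr_ge0 ?exprn_ge0 // ltW.
rewrite -[X in `|X|]mulrA normrM (ger0_norm H0) -[leRHS]mulrA [_ / l]mulrC [leRHS]mulrA.
by rewrite ler_wpM2r ?sinX_bound_ge0 // ler_wpM2l.
Qed.

(** For [y = sin (l x) / l] both [|y| <= |x|] and [|y| <= 1 / l] hold. Among the [m] factors, [n]
    give [|x| ^ n] and one of the others pays for [|c|] through the scale [l]. For [m = n] no factor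
    is left, whence the exceptional term. *)
Lemma borel_term_small m n c x : (n <= m)%N ->
  `|borel_term m c 0 x| <= (1 + `|c| * 2 ^+ m * (m == n)%:R) * `|x| ^+ n * 2^-1 ^+ m.
Proof.
move=> nm; rewrite borel_term0.
have l0 := borel_scale_gt0 m c; have l1 := borel_scale_ge1 m c.
have b1 := borel_scale_bound1 m c.
set l := borel_scale m c in l0 l1 b1 *.
set y := sin (l * x) / l.
have yx : `|y| <= `|x|.
  rewrite /y normrM normfV (gtr0_norm l0) ler_pdivrMr //.
  by rewrite (le_trans (abs_sin_le _)) // normrM (gtr0_norm l0) mulrC.
have yl : `|y| <= l^-1.
  rewrite /y normrM normfV (gtr0_norm l0).
  apply: ler_piMl; first by rewrite invr_ge0 ltW.
  by rewrite ler_norml sin_geN1 sin_le1.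
rewrite normrM normrX.
have [->|mn] := eqVneq m n.
  rewrite mulr1 mulrAC mulrDl mul1r -mulrA -exprMn divff // expr1n mulr1.
  rewrite mulrDl; apply: (@le_trans _ _ (`|c| * `|x| ^+ n)).
    by rewrite ler_wpM2l // lerXn2r ?nnegrE.
  by rewrite lerDr mulr_ge0 // exprn_ge0.
have nm' : (n < m)%N by rewrite ltn_neqAle eq_sym mn.
have H : `|c| * `|y| ^+ (m - n) <= 2^-1 ^+ m.
  apply: (le_trans _ b1); rewrite ler_wpM2l //.
  have -> : (m - n = (m - n).-1.+1)%N by rewrite prednK // subn_gt0.
  rewrite exprS -[leRHS]mulr1 ler_pM ?exprn_ge0 // exprn_ile1 //.
  by rewrite (le_trans yl) // invf_le1.
rewrite mulr0 addr0 mul1r [leRHS]mulrC -{1}(subnK nm) exprD mulrA.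
by rewrite ler_pM ?mulr_ge0 ?exprn_ge0 // lerXn2r ?nnegrE.
Qed.

End borel.

(** * Division of germs by powers of the variable *)

Section germ_division.
Context {R : realType}.

Lemma near_nonzero_witness (P : R -> Prop) : (\forall x \near (0 : R), P x) ->
  exists2 x, x != 0 & P x.
Proof.
move=> /nbhs_ballP [d /= d0 H]; exists (d / 2).
  by rewrite gt_eqF // divr_gt0.
apply: H; rewrite -ball_normE /= sub0r normrN gtr0_norm ?divr_gt0 //.
by rewrite ltr_pdivrMr // mulr_natr mulr2n ltrDl.
Qed.

Lemma near_norm_lt (d : R) : 0 < d -> \forall x \near (0 : R), `|x| < d.
Proof.
move=> d0; have := nbhsx_ballx (0 : R) d d0; apply: filterS => y.
by rewrite -ball_normE /= sub0r normrN.
Qed.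

Lemma punctured_zero (f : R -> R) : {for (0 : R), continuous f} ->
  (forall e, 0 < e -> \forall x \near (0 : R), x != 0 -> `|f x| <= e) -> f 0 = 0.
Proof.
move=> cf H; apply/eqP; rewrite -normr_le0; apply/ler_addgt0Pl => e e0; rewrite addr0.
have e2 : 0 < e / 2 by rewrite divr_gt0.
have nf : \forall x \near (0 : R), `|f 0 - f x| <= e / 2.
  by have /cvgrPdist_le/(_ _ e2) := cf.
have [x x0 [/= H1 H2]] := near_nonzero_witness (filterI nf (H _ e2)).
rewrite -(subrK (f x) (f 0)) (le_trans (ler_normD _ _)) // [leRHS]splitr lerD //.
exact: H2.
Qed.

(** Identities between germs are divided by powers of [x] where [x != 0]; continuity recovers their
    value at 0. *)
Lemma smooth_at_eq0 (f g : R -> R) : smooth_at f 0 -> smooth_at g 0 ->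
  (\forall x \near (0 : R), x != 0 -> f x = g x) -> f 0 = g 0.
Proof.
move=> sf sg E; apply/eqP; rewrite -subr_eq0; apply/eqP.
apply: (@punctured_zero (fun x => f x - g x)).
  exact: smooth_at_continuous (smooth_atB sf sg).
by move=> e e0; apply: filterS E => x Ex /Ex ->; rewrite subrr normr0 ltW.
Qed.

Lemma hadamard1_derive (k g : R -> R) : smooth_at g 0 ->
  (\forall x \near (0 : R), k x = k 0 + x * g x) -> derive1 k 0 = g 0.
Proof.
move=> sg E; rewrite derive1E (near_eq_derive _ E).
have dg : derivable g 0 1 by apply: diff_derivable; exact: smooth_at_differentiable.
have d1 : is_derive (0 : R) 1 (fun x => k 0 + x * g x) (g 0).
  have -> : (fun x => k 0 + x * g x) = cst (k 0) + (id : R -> R) * g by [].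
  have dg' := derivableP dg.
  have dM := is_deriveD (is_derive_cst (k 0) (0 : R) 1) (is_deriveM (is_derive_id (0 : R) 1) dg').
  by apply: is_derive_eq dM _; rewrite scale0r !add0r; exact: mulr1.
by have [] := d1.
Qed.

(** If [f = x^n g], a bound of order [n + 1] forces [g 0 = 0], and Hadamard's lemma splits one more
    factor [x] off [g]. *)
Lemma smooth_bigO_divisible n (f : R -> R) (C : R) : smooth_at f 0 ->
  (\forall x \near (0 : R), `|f x| <= C * `|x| ^+ n) ->
  exists2 g : R -> R, smooth_at g 0 & \forall x \near (0 : R), f x = x ^+ n * g x.
Proof.
elim: n => [|n IH] in C * => sf fC.
  by exists f => //; apply: filterE => x; rewrite expr0 mul1r.
have [|g sg fg] := IH `|C| sf.
  apply: filterS2 fC (near_norm_lt ltr01) => x fx /ltW x1.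
  apply: le_trans fx _; rewrite (@le_trans _ _ (`|C| * `|x| ^+ n.+1)) //.
    by rewrite ler_wpM2r ?exprn_ge0 // ler_norm.
  by rewrite ler_wpM2l // exprS ler_piMl // exprn_ge0.
have g0 : g 0 = 0.
  apply: punctured_zero; first exact: smooth_at_continuous.
  move=> e e0.
  have d0 : 0 < e / (1 + `|C|) by rewrite divr_gt0 // ltr_wpDr.
  apply: filterS3 fC fg (near_norm_lt d0) => x + fgx xd x0.
  rewrite fgx normrM normrX exprSr [leLHS]mulrC mulrA [C * _ * _]mulrAC.
  rewrite ler_pM2r ?exprn_gt0 ?normr_gt0 // => h; apply: (le_trans h).
  rewrite ltr_pdivlMr ?ltr_wpDr // in xd.
  apply: le_trans (ltW xd); rewrite mulrC ler_wpM2l //.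
  by rewrite (le_trans (ler_norm C)) // lerDr.
have [g' sg' gg'] := hadamard1 sg.
exists g' => //; apply: filterS2 fg gg' => x -> ->.
by rewrite g0 add0r exprSr mulrA.
Qed.

End germ_division.

Section borel_theorem.
Context {R : realType}.
Variable a : nat -> R.

Let jet n Q := exists2 r : R -> R, smooth_at r 0 &
  \forall x \near (0 : R), Q x = \sum_(m < n) a m * x ^+ m + x ^+ n * r x.

Local Lemma borel_term_divisible m (c : R) : exists2 u : R -> R,
  smooth_at u 0 /\ u 0 = c &
  \forall x \near (0 : R), borel_term m c 0 x = x ^+ m * u x.
Proof.
set l := borel_scale m c; have l0 : l != 0 by rewrite gt_eqF ?borel_scale_gt0.
have slin : smooth_at (fun x : R => l * x) 0.
  by apply: smooth_atM; [exact: smooth_at_cst|exact: smooth_at_id].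
have ss : smooth_at (fun x : R => sin (l * x)) 0.
  by apply: (smooth_at_comp1 (g := sin)) => //; exact: smooth_at_sin.
have [g sg Hg] := hadamard1 ss.
have g0 : g 0 = l.
  rewrite -(hadamard1_derive sg Hg) derive1E.
  pose lin : R -> R := l *: (id : R -> R).
  have dlin : is_derive (0 : R) 1 lin l.
    by apply: is_derive_eq; rewrite -[_ *: 1]/(_ * 1) mulr1.
  have dc := is_derive1_comp (is_derive_sin (lin 0)) dlin.
  have -> : (fun x => sin (l * x)) = sin \o lin by [].
  by have [_ ->] := dc; rewrite /lin -[(_ *: _) 0]/(l * 0) mulr0 cos0 mul1r.
exists (fun x => c * (g x / l) ^+ m).
  split; last by rewrite g0 divff // expr1n mulr1.
  apply: smooth_atM; first exact: smooth_at_cst.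
  by apply: smooth_atX; apply: smooth_atM => //; exact: smooth_at_cst.
apply: filterS Hg => x; rewrite mulr0 sin0 add0r => Hx.
by rewrite borel_term0 -/l Hx -[x * g x / l]mulrA exprMn mulrCA.
Qed.

(** The earlier terms are not monomials and contribute [r 0] to the coefficient of [x^n]; the new
    term has to supply only the rest, [a n - r 0]. *)
Local Lemma jet_step n Q : jet n Q ->
  exists c, jet n.+1 (fun x => Q x + borel_term n c 0 x).
Proof.
move=> [r sr Qr]; exists (a n - r 0).
have [u [su u0] Hu] := borel_term_divisible n (a n - r 0).
have [s ss Hs] := hadamard1 (smooth_atD sr su).
exists s => //; apply: filterS3 Qr Hu Hs => x -> -> Hx.
rewrite big_ord_recr /= -!addrA; congr (_ + _).
rewrite -mulrDr Hx u0 subrKC mulrDr exprSr mulrA; congr (_ + _); exact: mulrC.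
Qed.

(** A coefficient depends on the partial sum that precedes it, so the recursion produces the two
    together: the sum of the first [n] terms and the coefficient of the next one. *)
Fixpoint borel_partial n : (R -> R) * R :=
  let Q := if n is n'.+1 then
    (fun x => (borel_partial n').1 x + borel_term n' (borel_partial n').2 0 x)
    else (fun=> 0) in
  (Q, xget 0 [set c | jet n.+1 (fun x => Q x + borel_term n c 0 x)]).

Let c n := (borel_partial n).2.

Local Lemma borel_partialE n x :
  (borel_partial n).1 x = series (fun m => borel_term m (c m) 0 x) n.
Proof.
elim: n => [|n IH]; first by rewrite /series /= big_geq.
by rewrite seriesSr -IH.
Qed.

Local Lemma borel_partial_jet n : jet n (borel_partial n).1.
Proof.
elim: n => [|n IH].
  exists (fun=> 0); first exact: smooth_at_cst.
  by apply: filterE => x; rewrite big_ord0 mulr0 addr0.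
have [d Hd] := jet_step IH.
have E : c n = xget 0 [set c | jet n.+1 (fun x =>
   (borel_partial n).1 x + borel_term n c 0 x)].
  by rewrite /c; case: (n).
have : [set c | jet n.+1 (fun x => (borel_partial n).1 x + borel_term n c 0 x)] (c n).
  by rewrite E; apply: xgetPex; exists d.
by [].
Qed.

(** The first [n] terms have the prescribed jet by construction. The tail is [O(x^n)] by domination,
    hence divisible by [x^n] with a smooth quotient. *)
Theorem borel : exists2 F : R -> R, smooth_at F 0 & forall n,
  exists2 r : R -> R, smooth_at r 0 &
    \forall x \near (0 : R), F x = \sum_(m < n) a m * x ^+ m + x ^+ n * r x.
Proof.
pose phi k m := borel_term m (c m) k.
have dphi k m (x : R) : is_derive x 1 (phi k m) (phi k.+1 m x).
  exact: borel_term_derive.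
have bphi k : exists C, forall x, half_dominated C (fun m => phi k m x).
  exact: borel_term_dominated.
pose F := sum_phi phi 0.
have sF : smooth_at F 0.
  exists setT; split=> [|//|k]; first exact: openT.
  exact: sum_phi_Ck.
exists F => // n.
have [r sr Hr] := borel_partial_jet n.
have sQ : smooth_at (borel_partial n).1 0.
  apply: smooth_at_eq (filterS _ Hr) _; first by move=> x Hx; symmetry; exact: Hx.
  apply: smooth_atD.
    elim: (n) => [|m IH].
      apply: (smooth_at_eq _ (smooth_at_cst (0 : R) 0)).
      by apply: filterE => x; rewrite big_ord0.
    have st : smooth_at (fun x : R => a m * x ^+ m) 0.
      apply: smooth_atM; first exact: smooth_at_cst.
      by apply: smooth_atX; exact: smooth_at_id.
    apply: (smooth_at_eq _ (smooth_atD IH st)).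
    by apply: filterE => x; rewrite big_ord_recr.
  by apply: smooth_atM => //; apply: smooth_atX; exact: smooth_at_id.
have [C HC] := bphi 0%N.
pose K := 1 + `|c n| * 2 ^+ n.
have K0 : 0 <= K by rewrite addr_ge0 // mulr_ge0 // exprn_ge0.
have [|g sg Hg] := @smooth_bigO_divisible R n _ (2 * K) (smooth_atB sF sQ).
  apply: filterE => x; rewrite borel_partialE -mulrA.
  apply: half_dominated_tail; first by rewrite mulr_ge0 // exprn_ge0.
    exact: half_dominated_cvg (HC x).
  move=> m nm; apply: le_trans (borel_term_small _ _ nm) _.
  rewrite ler_wpM2r ?exprn_ge0 // ler_wpM2r ?exprn_ge0 // /K lerD2l.
  have [->|_] := eqVneq m n; first by rewrite mulr1.
  by rewrite mulr0 mulr_ge0 // exprn_ge0.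
exists (fun x => r x + g x); first exact: smooth_atD.
apply: filterS2 Hr Hg => x Hx Hgx.
by rewrite mulrDr addrA -Hx -Hgx addrC subrK.
Qed.

End borel_theorem.

(** * Flat germs and the substitution of a square root *)

Section local_smoothness.
Context {R : realType}.

Lemma smooth_at_bounded (f : R -> R) : smooth_at f 0 ->
  exists2 C, 0 <= C & \forall x \near (0 : R), `|f x| <= C.
Proof.
move=> sf; exists (`|f 0| + 1); first by rewrite addr_ge0.
have : \forall x \near (0 : R), `|f 0 - f x| <= 1.
  by have /cvgrPdist_le/(_ _ ltr01) := smooth_at_continuous sf.
apply: filterS => x Hx; rewrite -(subrK (f 0) (f x)) (le_trans (ler_normD _ _)) //.
by rewrite addrC lerD2l distrC.
Qed.

Lemma smooth_at_derive1 (f : R -> R) x : smooth_at f x -> smooth_at (derive1 f) x.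
Proof.
move=> sf; have -> : derive1 f = 'D_1 f by apply/funext => y; rewrite derive1E.
exact: smooth_at_derive.
Qed.

Lemma smooth_at_derivable1 (f : R -> R) x : smooth_at f x -> derivable f x 1.
Proof. by move=> /smooth_at_differentiable/diff_derivable; apply. Qed.

(** Flatness by bounds instead of vanishing derivatives, a form that passes directly to quotients by
    [x]. *)
Definition flat (f : R -> R) := forall n, exists C, \forall x \near (0 : R),
  `|f x| <= C * `|x| ^+ n.

Lemma flat_divisible n (f : R -> R) : smooth_at f 0 -> flat f ->
  exists2 g : R -> R, smooth_at g 0 & \forall x \near (0 : R), f x = x ^+ n * g x.
Proof. by move=> sf /(_ n) [C]; exact: smooth_bigO_divisible. Qed.

Lemma divisible_bigO n (f g : R -> R) : smooth_at g 0 ->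
  (\forall x \near (0 : R), f x = x ^+ n * g x) ->
  exists C, \forall x \near (0 : R), `|f x| <= C * `|x| ^+ n.
Proof.
move=> /smooth_at_bounded [C C0 HC] H; exists C.
apply: filterS2 HC H => x Cx ->.
by rewrite normrM normrX mulrC ler_wpM2r // exprn_ge0.
Qed.

Lemma flat0 (f : R -> R) : flat f -> f 0 = 0.
Proof.
move=> /(_ 1%N) [C H]; have := nbhs_singleton H.
by rewrite normr0 expr1 mulr0 normr_le0 => /eqP.
Qed.

Lemma flat_quotient (f g : R -> R) : flat f -> g 0 = 0 ->
  (\forall x \near (0 : R), f x = x * g x) -> flat g.
Proof.
move=> ff g0 E n; have [C HC] := ff n.+1; exists `|C|.
apply: filterS2 HC E => x + Ex.
have [->|x0] := eqVneq x 0; first by rewrite g0 normr0 mulr_ge0 // exprn_ge0.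
rewrite Ex normrM exprS mulrCA ler_pM2l ?normr_gt0 // => /le_trans; apply.
by rewrite ler_wpM2r ?exprn_ge0 // ler_norm.
Qed.

Definition sqrt_lift (f : R -> R) (s : R) : R := if 0 < s then f (Num.sqrt s) else 0.

(* The derivative of [sqrt_lift f] is [sqrt_lift (sqrt_lift_deriv f)], and flatness
   is what makes [sqrt_lift_deriv f] smooth at 0 again. *)
Definition sqrt_lift_deriv (f : R -> R) (x : R) : R := derive1 f x * (2 * x)^-1.

(** From [f = x^(n+1) g] follows [f' = x^n ((n+1) g + x g')] for every [n]. Thus [f'] is flat too,
    and division by [2 x] costs neither smoothness nor flatness. *)
Lemma sqrt_lift_deriv_germ (f : R -> R) : smooth_at f 0 -> flat f ->
  smooth_at (sqrt_lift_deriv f) 0 /\ flat (sqrt_lift_deriv f).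
Proof.
move=> sf ff; have sf' := smooth_at_derive1 sf.
have fD n : exists2 h : R -> R, smooth_at h 0 &
    \forall x \near (0 : R), derive1 f x = x ^+ n * h x.
  have [g sg Hg] := flat_divisible n.+1 sf ff.
  exists (fun x => n.+1%:R * g x + x * derive1 g x).
    apply: smooth_atD; first by apply: smooth_atM => //; exact: smooth_at_cst.
    by apply: smooth_atM; [exact: smooth_at_id|exact: smooth_at_derive1].
  have ng := smooth_at_near sg.
  have := near_join Hg; apply: filterS2 ng => x sgx Hx.
  rewrite derive1E (near_eq_derive _ Hx) deriveM; last 2 first.
  - exact: exprn_derivable.
  - exact: smooth_at_derivable1.
  rewrite exp_derive -derive1E; move: (derive1 g x) (g x) => a b /=.
  have -> : (n.+1%:R *: x ^+ n *: 1) = n.+1%:R * x ^+ n * 1 :> R by [].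
  by rewrite -[_ *: a]/(_ * a) -[b *: _]/(b * _) exprSr; ring.
have [g sg Hg] := hadamard1 sf'.
have d0 : derive1 f 0 = 0.
  by have [h sh /nbhs_singleton ->] := fD 1%N; rewrite expr1 mul0r.
have g0 : g 0 = 0.
  have [h sh Hh] := fD 2%N.
  apply: etrans (smooth_at_eq0 sg (smooth_atM (smooth_at_id (0 : R)) sh) _) _; last first.
    by rewrite mul0r.
  apply: filterS2 Hg Hh => x -> + x0; rewrite d0 add0r expr2 -mulrA.
  by move=> /(mulfI x0).
have E : \forall x \near (0 : R), g x * 2^-1 = sqrt_lift_deriv f x.
  apply: filterS Hg => x Hx; rewrite /sqrt_lift_deriv.
  have [->|x0] := eqVneq x 0; first by rewrite g0 d0 !mul0r.
  by rewrite Hx d0 add0r; field.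
split.
  by apply: smooth_at_eq E _; apply: smooth_atM => //; exact: smooth_at_cst.
have sl0 : sqrt_lift_deriv f 0 = 0 by rewrite /sqrt_lift_deriv d0 mul0r.
apply: (@flat_quotient (fun x => derive1 f x * 2^-1)) => //.
  move=> n; have [h sh Hh] := fD n.
  apply: (@divisible_bigO n _ (fun x => h x * 2^-1)).
    by apply: smooth_atM => //; exact: smooth_at_cst.
  by apply: filterS Hh => x ->; rewrite mulrA.
apply: filterE => x; have [->|x0] := eqVneq x 0; first by rewrite d0 !mul0r.
by rewrite /sqrt_lift_deriv; field.
Qed.

Lemma sqrt_lt_ball (rho s : R) : 0 < rho -> 0 < s -> s < rho ^+ 2 -> `|Num.sqrt s| < rho.
Proof.
move=> r0 s0 sr; rewrite ger0_norm ?sqrtr_ge0 //.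
by rewrite -(ltr_pXn2r (n := 2)) ?nnegrE ?sqrtr_ge0 ?ltW // sqr_sqrtr // ltW.
Qed.

Lemma sqrt_lift_derive (rho : R) (f : R -> R) (s : R) : 0 < rho ->
  (forall x, `|x| < rho -> smooth_at f x) -> flat f -> `|s| < rho ^+ 2 ->
  is_derive s 1 (sqrt_lift f) (sqrt_lift (sqrt_lift_deriv f) s).
Proof.
move=> r0 sf ff sr.
have [s0|s0|s0] := ltgtP 0 s; last first.
(* Order 4 in [Num.sqrt s] is order 2 in [s], a quadratic remainder for the derivative 0. *)
- have [C HC] := ff 4%N; rewrite -s0.
  apply: (@is_derive_quadratic _ _ _ _ `|C|) => //.
  rewrite /sqrt_lift ltxx.
  move: HC => /nbhs_ballP [d /= d0 HC].
  have d2 : 0 < d ^+ 2 by rewrite exprn_gt0.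
  have := near_norm_lt d2; apply: filterS => y yd; rewrite mulr0 !subr0.
  case: ifPn => [y0|_]; last by rewrite normr0 mulr_ge0 // exprn_ge0.
  have H : ball 0 d (Num.sqrt y).
    rewrite -ball_normE /= sub0r normrN; apply: sqrt_lt_ball => //.
    by rewrite -(gtr0_norm y0).
  apply: le_trans (HC _ H) _.
  have -> : `|Num.sqrt y| ^+ 4 = `|y| ^+ 2.
    rewrite ger0_norm ?sqrtr_ge0 // (exprM _ 2 2) sqr_sqrtr ?ltW //.
    by rewrite (gtr0_norm y0).
  by rewrite ler_wpM2r ?exprn_ge0 // ler_norm.
- have nE : \forall t \near s, (fun=> 0) t = sqrt_lift f t.
    have := near_open (@open_lt R 0) s0; apply: filterS => t t0.
    by rewrite /sqrt_lift ltNge (ltW t0).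
  rewrite [X in is_derive _ _ _ X]/sqrt_lift ltNge (ltW s0) /=.
  by apply: (near_eq_is_derive nE).
- have nE : \forall t \near s, (f \o Num.sqrt) t = sqrt_lift f t.
    have := near_open (@open_gt R 0) s0; apply: filterS => t t0.
    by rewrite /sqrt_lift /= t0.
  apply: (near_eq_is_derive nE).
  have xr : `|Num.sqrt s| < rho by apply: sqrt_lt_ball => //; rewrite -(gtr0_norm s0).
  have df : is_derive (Num.sqrt s) 1 f (derive1 f (Num.sqrt s)).
    by rewrite derive1E; split=> //; apply: smooth_at_derivable1; exact: sf.
  have := is_derive1_comp df (is_derive1_sqrt s0).
  by rewrite /sqrt_lift s0.
Qed.

(** All orders of smoothness must hold on the same neighborhood. Smoothness on the interval of fixed
    radius [rho] is therefore carried through the induction; [sqrt_lift_deriv] preserves it, off 0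
    by its formula and at 0 by flatness. *)
Lemma sqrt_lift_smooth (rho : R) (f : R -> R) : 0 < rho ->
  (forall x, `|x| < rho -> smooth_at f x) -> flat f -> smooth_at (sqrt_lift f) 0.
Proof.
move=> r0 sf ff.
have r2 : 0 < rho ^+ 2 by rewrite exprn_gt0.
exists (ball 0 (rho ^+ 2)); split; [exact: ball_open|exact: ballxx|move=> k].
have bE s : ball 0 (rho ^+ 2) s -> `|s| < rho ^+ 2.
  by rewrite -ball_normE /= sub0r normrN.
elim: k f sf ff => [|k IH] f sf ff.
  move=> s /bE sr; apply: differentiable_continuous; apply/derivable1_diffP.
  by have [] := sqrt_lift_derive r0 sf ff sr.
apply: (@Ck_on_S1 R k _ (sqrt_lift f) (sqrt_lift (sqrt_lift_deriv f))).
- exact: ball_open.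
- by move=> s /bE sr; exact: (sqrt_lift_derive r0).
have [s0 fl] : smooth_at (sqrt_lift_deriv f) 0 /\ flat (sqrt_lift_deriv f).
  by apply: sqrt_lift_deriv_germ => //; apply: sf; rewrite normr0.
apply: IH => // x xr; have [->//|x0] := eqVneq x 0.
apply: smooth_atM; first by apply: smooth_at_derive1; exact: sf.
apply: smooth_atV; first by rewrite mulf_neq0.
by apply: smooth_atM; [exact: smooth_at_cst|exact: smooth_at_id].
Qed.

End local_smoothness.

Section whitney.
Context {R : realType}.

(** The coefficients are the values at 0 of the iterated Hadamard quotients, which avoids higher
    derivatives and factorials. *)
Lemma taylor_coefficients (k : R -> R) : smooth_at k 0 ->
  exists a : nat -> R, forall n, exists2 r : R -> R, smooth_at r 0 &
    \forall x \near (0 : R), k x = \sum_(m < n) a m * x ^+ m + x ^+ n * r x.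
Proof.
move=> sk.
pose step (f : {f : R -> R | smooth_at f 0}) : {f : R -> R | smooth_at f 0} :=
  let: exist2 g sg _ := cid2 (hadamard1 (svalP f)) in exist _ g sg.
have stepP f : \forall x \near (0 : R), sval f x = sval f 0 + x * sval (step f) x.
  by rewrite /step; case: cid2.
pose ks n := iter n step (exist _ k sk).
exists (fun n => sval (ks n) 0) => n.
exists (sval (ks n)); first exact: (svalP (ks n)).
elim: n => [|n IH]; first by apply: filterE => x; rewrite big_ord0 add0r expr0 mul1r.
apply: filterS2 IH (stepP (ks n)) => x -> Hx.
by rewrite big_ord_recr /= -addrA Hx mulrDr exprSr mulrA; congr (_ + (_ + _)); exact: mulrC.
Qed.

Lemma sum_even_odd (a : nat -> R) n x :
  \sum_(m < n.*2) a m * x ^+ m =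
  \sum_(m < n) a m.*2 * (x ^+ 2) ^+ m + x * \sum_(m < n) a m.*2.+1 * (x ^+ 2) ^+ m.
Proof.
elim: n => [|n IH]; first by rewrite !big_ord0 mulr0 addr0.
rewrite doubleS !big_ord_recr /= IH.
have -> : (x ^+ 2) ^+ n = x ^+ n.*2 by rewrite -exprM mul2n.
rewrite (exprS x n.*2); move: (\sum_(m < n) _) (\sum_(m < n) _) => A B; ring.
Qed.

(** Let [ev] and [od] be the even and odd parts and [od = x * q] with [q] even. Both [ev] and [q]
    are flat, so [sqrt_lift] turns them into smooth functions of [x ^ 2]. *)
Lemma whitney_flat (f : R -> R) : smooth_at f 0 -> flat f ->
  exists e o : R -> R, [/\ smooth_at e 0, smooth_at o 0 &
    \forall x \near (0 : R), f x = e (x ^+ 2) + x * o (x ^+ 2)].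
Proof.
move=> sf ff.
have /nbhs_ballP [rho /= r0 Hr] := smooth_at_near sf.
have sfx x : `|x| < rho -> smooth_at f x.
  by move=> xr; apply: Hr; rewrite -ball_normE /= sub0r normrN.
have sfN x : `|x| < rho -> smooth_at (fun x => f (- x)) x.
  move=> xr; apply: smooth_at_comp1; first by apply: sfx; rewrite normrN.
  by apply: smooth_atN; exact: smooth_at_id.
have ffN : flat (fun x => f (- x)).
  move=> n; have [C HC] := ff n; exists C.
  have sN : smooth_at (fun x : R => - x) 0 by apply: smooth_atN; exact: smooth_at_id.
  have := near_comp0 sN (oppr0 R) HC.
  by apply: filterS => x; rewrite normrN.
pose ev x := 2^-1 * (f x + f (- x)).
pose od x := 2^-1 * (f x - f (- x)).
pose q x := od x * x^-1.
have sev x : `|x| < rho -> smooth_at ev x.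
  move=> xr; apply: smooth_atM; first exact: smooth_at_cst.
  by apply: smooth_atD; [exact: sfx|exact: sfN].
have sod x : `|x| < rho -> smooth_at od x.
  move=> xr; apply: smooth_atM; first exact: smooth_at_cst.
  by apply: smooth_atB; [exact: sfx|exact: sfN].
have flat_comb s : `|s| = 1 -> flat (fun x => 2^-1 * (f x + s * f (- x))).
  move=> s1 n; have [C HC] := ff n; have [C' HC'] := ffN n.
  exists (2^-1 * (C + C')); apply: filterS2 HC HC' => x h1 h2.
  rewrite normrM ger0_norm // -mulrA ler_wpM2l // mulrDl.
  by rewrite (le_trans (ler_normD _ _)) // lerD // normrM s1 mul1r.
have fev : flat ev.
  have := flat_comb 1 (normr1 _); congr flat; apply/funext => x.
  by rewrite mul1r.
have fod : flat od.
  have := flat_comb (-1) (normrN1 _); congr flat; apply/funext => x.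
  by rewrite mulN1r.
have od0 : od 0 = 0 by rewrite /od oppr0 subrr mulr0.
have sq0 : smooth_at q 0 /\ flat q.
  have so : smooth_at od 0 by apply: sod; rewrite normr0.
  have q0 : q 0 = 0 by rewrite /q od0 mul0r.
  have E : \forall x \near (0 : R), od x = x * q x.
    apply: filterE => x; rewrite /q.
    have [->|x0] := eqVneq x 0; first by rewrite od0 mul0r.
    by rewrite mulrCA divff // mulr1.
  split; last exact: (flat_quotient fod q0 E).
  have [g sg Hg] := flat_divisible 2 so fod.
  apply: (smooth_at_eq _ (smooth_atM (smooth_at_id (0 : R)) sg)).
  apply: filterS2 Hg E => x -> Hx.
  have [->|x0] := eqVneq x 0; first by rewrite mul0r q0.
  by apply: (mulfI x0); rewrite -Hx expr2 mulrA.
have sq x : `|x| < rho -> smooth_at q x.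
  move=> xr; have [->|x0] := eqVneq x 0; first exact: sq0.1.
  by apply: smooth_atM; [exact: sod|apply: smooth_atV => //; exact: smooth_at_id].
exists (sqrt_lift ev), (sqrt_lift q); split.
- exact: sqrt_lift_smooth sev fev.
- exact: sqrt_lift_smooth sq sq0.2.
apply: filterE => x; rewrite /sqrt_lift.
have [->|x0] := eqVneq x 0.
  by rewrite expr0n /= ltxx mul0r addr0; exact: flat0.
rewrite exprn_even_gt0 // x0 orbT sqrtr_sqr.
have eE : ev `|x| = ev x.
  by rewrite /ev; case: (ger0P x) => _ //; rewrite opprK addrC.
have qE : q `|x| = q x.
  rewrite /q /od; case: (ger0P x) => _ //.
  by rewrite opprK invrN mulrN -mulNr -mulrN opprB.
rewrite eE qE /q mulrCA divff // mulr1 /ev /od.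
by move: (f x) (f (- x)) => a b; field.
Qed.

Lemma smooth_at_sqr (g : R -> R) : smooth_at g 0 -> smooth_at (fun x : R => g (x ^+ 2)) 0.
Proof.
move=> sg; apply: (smooth_at_comp1 (g := g)); first by rewrite expr0n.
by apply: smooth_atX; exact: smooth_at_id.
Qed.

Lemma near_sqr (P : R -> Prop) : (\forall x \near (0 : R), P x) ->
  \forall x \near (0 : R), P (x ^+ 2).
Proof.
move=> HP; have sX : smooth_at (fun x : R => x ^+ 2) 0.
  by apply: smooth_atX; exact: smooth_at_id.
have X0 : (0 : R) ^+ 2 = 0 by rewrite expr0n.
exact: (near_comp0 sX X0 HP).
Qed.

(** Borel's theorem realizes the even and the odd Taylor coefficients of [k] by two germs; what is
    left of [k] is flat. *)
Theorem whitney_parity (k : R -> R) : smooth_at k 0 ->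
  exists e o : R -> R, [/\ smooth_at e 0, smooth_at o 0 &
    \forall x \near (0 : R), k x = e (x ^+ 2) + x * o (x ^+ 2)].
Proof.
move=> sk; have [a Ha] := taylor_coefficients sk.
have [e se He] := borel (fun m => a m.*2).
have [od so Ho] := borel (fun m => a m.*2.+1).
pose f x := k x - (e (x ^+ 2) + x * od (x ^+ 2)).
have sf0 : smooth_at f 0.
  apply: smooth_atB => //; apply: smooth_atD; first exact: smooth_at_sqr.
  by apply: smooth_atM; [exact: smooth_at_id|exact: smooth_at_sqr].
have ff0 : flat f.
  move=> n.
  have [r sr Hr] := Ha n.*2; have [r1 sr1 Hr1] := He n; have [r2 sr2 Hr2] := Ho n.
  apply: (@divisible_bigO _ n _ (fun x => x ^+ n * (r x - (r1 (x ^+ 2) + x * r2 (x ^+ 2))))).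
    apply: smooth_atM; first by apply: smooth_atX; exact: smooth_at_id.
    apply: smooth_atB => //; apply: smooth_atD; first exact: smooth_at_sqr.
    by apply: smooth_atM; [exact: smooth_at_id|exact: smooth_at_sqr].
  apply: filterS3 Hr (near_sqr Hr1) (near_sqr Hr2) => x h h1 h2.
  rewrite /f h h1 h2 sum_even_odd.
  have -> : x ^+ n.*2 = x ^+ n * x ^+ n by rewrite -exprD addnn.
  have -> : (x ^+ 2) ^+ n = x ^+ n * x ^+ n by rewrite -exprM mul2n -addnn exprD.
  move: (\sum_(m < n) _) (\sum_(m < n) _) (r x) (r1 _) (r2 _) (x ^+ n) => A B C D E F.
  by ring.
have [e' [od' [se' so' H]]] := whitney_flat sf0 ff0.
exists (fun s => e s + e' s), (fun s => od s + od' s); split; try exact: smooth_atD.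
apply: filterS H => x; rewrite /f => /eqP; rewrite subr_eq => /eqP ->.
by ring.
Qed.

End whitney.

(** * Explicit diffeomorphism germs and reparametrizations *)

Ltac smooth := repeat first [ assumption | apply: smooth_at_cst | apply: smooth_at_id
  | apply: smooth_at_coord | apply: smooth_atM | apply: smooth_atD | apply: smooth_atB
  | apply: smooth_atN | apply: smooth_atX | apply: smooth_at_row2 ].

Section partials.
Context {R : realType}.
Implicit Types f g w : 'rV[R]_2 -> R.

Lemma smooth_at_comp1_0 (V : normedModType R) (g : R -> R) (f : V -> R) :
  smooth_at g 0 -> smooth_at f 0 -> f 0 = 0 -> smooth_at (fun x => g (f x)) 0.
Proof. by move=> sg sf f0; apply: smooth_at_comp1 => //; rewrite f0. Qed.

Lemma pdM i f g x : smooth_at f x -> smooth_at g x ->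
  pd i (fun y => f y * g y) x = f x * pd i g x + g x * pd i f x.
Proof.
move=> sf sg; rewrite /pd deriveM //; apply: diff_derivable;
by apply: smooth_at_differentiable.
Qed.

Lemma pdD i f g x : smooth_at f x -> smooth_at g x ->
  pd i (fun y => f y + g y) x = pd i f x + pd i g x.
Proof.
move=> sf sg; rewrite /pd deriveD //; apply: diff_derivable;
by apply: smooth_at_differentiable.
Qed.

Lemma pd_cst i (c : R) x : pd i (fun=> c) x = 0.
Proof. by rewrite /pd derive_cst. Qed.

Lemma pd_coord i j : pd i (fun x : 'rV[R]_2 => x 0 j) 0 = (i == j)%:R.
Proof.
have di := smooth_at_differentiable (smooth_at_id (0 : 'rV[R]_2)).
rewrite /pd -(derive_mx_entry _ _ _ di).
by rewrite derive_id mxE eqxx eq_sym.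
Qed.

Definition second_order w := [/\ smooth_at w 0, w 0 = 0 & forall i, pd i w 0 = 0].

Lemma second_orderM f g : smooth_at f 0 -> smooth_at g 0 -> f 0 = 0 -> g 0 = 0 ->
  second_order (fun x => f x * g x).
Proof.
move=> sf sg f0 g0; split; [by smooth|by rewrite f0 mul0r|].
by move=> i; rewrite pdM // f0 g0 !mul0r addr0.
Qed.

Lemma second_orderMr f g : second_order f -> smooth_at g 0 ->
  second_order (fun x => f x * g x).
Proof.
move=> [sf f0 df] sg; split; [by smooth|by rewrite f0 mul0r|].
by move=> i; rewrite pdM // f0 df mulr0 mul0r addr0.
Qed.

Lemma second_orderD f g : second_order f -> second_order g ->
  second_order (fun x => f x + g x).
Proof.
move=> [sf f0 df] [sg g0 dg]; split; [by smooth|by rewrite f0 g0 addr0|].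
by move=> i; rewrite pdD // df dg addr0.
Qed.

Lemma second_order0 : second_order (fun=> 0).
Proof. by split=> [|//|i]; [smooth|rewrite pd_cst]. Qed.

Lemma diffeo_germ_row2 f g : smooth_at f 0 -> smooth_at g 0 -> f 0 = 0 -> g 0 = 0 ->
  pd 0 f 0 != 0 -> pd 0 f 0 * pd 1 g 0 - pd 1 f 0 * pd 0 g 0 != 0 ->
  diffeo_germ (fun x => row2 (f x) (g x)).
Proof.
move=> sf sg f0 g0 h1 h2.
have e0 : (fun x => row2 (f x) (g x) 0 0) = f by apply/funext => x; rewrite row2E.
have e1 : (fun x => row2 (f x) (g x) 0 1) = g by apply/funext => x; rewrite row2E.
apply: inverse_function_2d; rewrite ?e0 ?e1 //; first by smooth.
by rewrite f0 g0 row2_0.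
Qed.

Lemma diffeo_germ_tangent_id f g : second_order f -> second_order g ->
  diffeo_germ (fun x => row2 (x 0 0 + f x) (x 0 1 + g x)).
Proof.
move=> [sf f0 df] [sg g0 dg].
have sc j : smooth_at (fun x : 'rV[R]_2 => x 0 j) 0 by exact: smooth_at_coord.
apply: diffeo_germ_row2; try by smooth.
- by rewrite mxE add0r.
- by rewrite mxE add0r.
- by rewrite pdD // pd_coord df addr0 oner_neq0.
- rewrite !pdD // !pd_coord !df !dg /= !addr0 mul0r subr0 mulr1.
  exact: oner_neq0.
Qed.

Lemma diffeo_germ_linear (a b c d : R) : a * d - b * c != 0 ->
  diffeo_germ (fun x => row2 (a * x 0 0 + b * x 0 1) (c * x 0 0 + d * x 0 1)).
Proof.
set D := a * d - b * c => D0.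
have s k l k' l' : smooth_at (fun x : 'rV[R]_2 =>
    row2 (k * x 0 0 + l * x 0 1) (k' * x 0 0 + l' * x 0 1)) 0 by smooth.
split; [by rewrite !mxE !mulr0 !addr0 row2_0|exact: s|].
exists (fun x => row2 (d / D * x 0 0 + (- b / D) * x 0 1) (- c / D * x 0 0 + a / D * x 0 1)).
split; [by rewrite !mxE !mulr0 !addr0 row2_0|exact: s| |].
- apply: filterE => x; apply: rV2P; rewrite !row2E; move: (x 0 0) (x 0 1) => u v;
  by rewrite /D; field.
- apply: filterE => x; apply: rV2P; rewrite !row2E; move: (x 0 0) (x 0 1) => u v;
  by rewrite /D; field.
Qed.

Lemma diffeo_germ_diag (s t : R -> R) : smooth_at s 0 -> smooth_at t 0 ->
  s 0 != 0 -> t 0 != 0 ->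
  diffeo_germ (fun x => row2 (x 0 0 * s (x 0 0)) (x 0 1 * t (x 0 1))).
Proof.
move=> ss st s0 t0.
have z j : (0 : 'rV[R]_2) 0 j = 0 by rewrite mxE.
have sc j : smooth_at (fun x : 'rV[R]_2 => x 0 j) 0 by exact: smooth_at_coord.
have P i j u : smooth_at u 0 ->
    pd i (fun x : 'rV[R]_2 => x 0 j * u (x 0 j)) 0 = (i == j)%:R * u 0.
  move=> su; have suc := smooth_at_comp1_0 su (sc j) (z j).
  by rewrite pdM // pd_coord z mul0r add0r mulrC.
have c1 j := smooth_at_comp1_0 ss (sc j) (z j).
have c2 j := smooth_at_comp1_0 st (sc j) (z j).
apply: diffeo_germ_row2; try by smooth.
- by rewrite z mul0r.
- by rewrite z mul0r.
- by rewrite P // mul1r.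
- by rewrite !P //= !mul1r !mul0r subr0 mulf_neq0.
Qed.

(** Inversion of [x * s x] by applying [elementary_inverse] to a function of the first coordinate.
    The inverse is returned as [x * t x], the shape used for all reparametrizations. *)
Lemma inverse1 (s : R -> R) : smooth_at s 0 -> s 0 != 0 ->
  exists2 t : R -> R, smooth_at t 0 /\ t 0 = (s 0)^-1 &
    \forall x \near (0 : R), x * t x * s (x * t x) = x.
Proof.
move=> ss s0.
have z j : (0 : 'rV[R]_2) 0 j = 0 by rewrite mxE.
have sc j : smooth_at (fun x : 'rV[R]_2 => x 0 j) 0 by exact: smooth_at_coord.
have scc := smooth_at_comp1_0 ss (sc 0) (z 0).
pose F (x : 'rV[R]_2) := x 0 0 * s (x 0 0).
have sF : smooth_at F 0 by rewrite /F; smooth.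
have F0 : F 0 = 0 by rewrite /F z mul0r.
have DF : 'D_(delta_mx 0 0) F 0 != 0.
  by rewrite -/(pd 0 F 0) /F pdM // pd_coord z mul0r add0r mulr1.
have u0 : upd 0 0 0 = 0 :> 'rV[R]_2.
  by rewrite -[X in upd 0 0 X](z 0) upd_id.
have [Z []] := elementary_inverse sF DF; rewrite F0 u0 z => sZ Z0 FZ _.
have s2 : smooth_at (fun u : R => row2 u 0) 0 by smooth.
pose r u := Z (row2 u 0).
have sr : smooth_at r 0 by apply: smooth_at_comp => //; rewrite row2_0.
have r0 : r 0 = 0 by rewrite /r row2_0.
have [t st Ht] := hadamard1 sr.
rewrite r0 in Ht.
have E : \forall x \near (0 : R), x * t x * s (x * t x) = x.
  apply: filterS2 Ht (near_comp0 s2 row2_0 FZ) => x.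
  by rewrite /F updE eqxx row2E -/(r x) add0r => ->.
exists t; last exact: E.
split=> //.
have s3 : smooth_at (fun x : R => s (x * t x)) 0.
  by apply: smooth_at_comp1_0 => //; [smooth|rewrite mul0r].
have := smooth_at_eq0 (smooth_atM st s3) (@smooth_at_cst R R R 1 0).
rewrite mul0r => H; have {}H : t 0 * s 0 = 1.
  apply: H; apply: filterS E => x + x0.
  by rewrite -mulrA -[RHS]mulr1 => /(mulfI x0).
by apply: (mulIf s0); rewrite H mulVf.
Qed.

(** The parameter [y * s y] is the inverse of [y * Num.sqrt (U y)], which squares to
    [y ^ 2 * U y]. *)
Lemma reparam_square (U : R -> R) : smooth_at U 0 -> U 0 = 1 ->
  exists2 s : R -> R, smooth_at s 0 /\ s 0 = 1 &
    \forall y \near (0 : R), s y ^+ 2 * U (y * s y) = 1.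
Proof.
move=> sU U0.
pose q y := Num.sqrt (U y).
have sq : smooth_at q 0.
  by apply: smooth_at_comp1 => //; apply: smooth_at_sqrt; rewrite U0.
have q0 : q 0 = 1 by rewrite /q U0 sqrtr1.
have [|t [st t0] Ht] := inverse1 sq; first by rewrite q0 oner_neq0.
rewrite q0 invr1 in t0.
exists t => //.
have Upos : \forall y \near (0 : R), 0 <= U y.
  have : \forall y \near (0 : R), `|U 0 - U y| <= 1.
    by have /cvgrPdist_le/(_ _ ltr01) := smooth_at_continuous sU.
  by apply: filterS => y; rewrite U0 ler_distl => /andP[h1 h2]; lra.
have syt : smooth_at (fun y : R => y * t y) 0 by smooth.
have z : 0 * t 0 = 0 :> R by rewrite mul0r.
apply: filterS2 Ht (near_comp0 syt z Upos) => y Hy Uy.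
have [->|y0] := eqVneq y 0; first by rewrite mul0r t0 U0 expr1n mulr1.
have H : t y * q (y * t y) = 1.
  by move: Hy; rewrite -mulrA -[RHS]mulr1 => /(mulfI y0).
have -> : U (y * t y) = q (y * t y) ^+ 2 by rewrite /q sqr_sqrtr.
by rewrite -exprMn H expr1n.
Qed.

End partials.

(** * Pairs of transverse cusps *)

Section cusp_pairs.
Context {R : realType}.
Implicit Types (g d e : R -> 'rV[R]_2) (P Q S T : R -> R).

(** The target change is common to both curves but the parameters change independently, because
    [diag_map] realizes any such pair of reparametrizations on the source plane. *)
Definition curve_equiv g1 g2 d1 d2 := exists (Phi : 'rV[R]_2 -> 'rV[R]_2) (s t : R -> R),
  [/\ diffeo_germ Phi, smooth_at s 0 /\ s 0 != 0, smooth_at t 0 /\ t 0 != 0,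
      \forall x \near (0 : R), Phi (g1 (x * s x)) = d1 x &
      \forall x \near (0 : R), Phi (g2 (x * t x)) = d2 x].

Lemma smooth_reparam (s : R -> R) : smooth_at s 0 ->
  smooth_at (fun x : R => x * s x) 0.
Proof. by move=> ss; smooth. Qed.

Lemma near_reparam (s : R -> R) (A : R -> Prop) : smooth_at s 0 ->
  (\forall x \near (0 : R), A x) -> \forall x \near (0 : R), A (x * s x).
Proof.
move=> ss HA; apply: (near_comp0 (smooth_reparam ss)) => //.
by rewrite mul0r.
Qed.

Lemma smooth_comp_reparam (s f : R -> R) : smooth_at s 0 -> smooth_at f 0 ->
  smooth_at (fun x : R => f (x * s x)) 0.
Proof.
move=> ss sf; apply: smooth_at_comp1_0 => //; first exact: smooth_reparam.
by rewrite mul0r.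
Qed.

Lemma curve_equiv_trans g1 g2 d1 d2 e1 e2 :
  curve_equiv g1 g2 d1 d2 -> curve_equiv d1 d2 e1 e2 -> curve_equiv g1 g2 e1 e2.
Proof.
move=> [F [s [t [dF [ss s0] [st t0] H1 H2]]]] [G [s' [t' [dG [ss' s0'] [st' t0'] K1 K2]]]].
exists (fun x => G (F x)), (fun x => s' x * s (x * s' x)), (fun x => t' x * t (x * t' x)).
split; [exact: diffeo_germ_comp| | | |].
- split; last by rewrite mul0r mulf_neq0.
  by apply: smooth_atM => //; exact: smooth_comp_reparam.
- split; last by rewrite mul0r mulf_neq0.
  by apply: smooth_atM => //; exact: smooth_comp_reparam.
- by apply: filterS2 (near_reparam ss' H1) K1 => x h <-; rewrite -h mulrA.
- by apply: filterS2 (near_reparam st' H2) K2 => x h <-; rewrite -h mulrA.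
Qed.

Lemma curve_equiv_target F g1 g2 d1 d2 : diffeo_germ F ->
  (\forall x \near (0 : R), F (g1 x) = d1 x) ->
  (\forall x \near (0 : R), F (g2 x) = d2 x) -> curve_equiv g1 g2 d1 d2.
Proof.
move=> dF H1 H2; exists F, (fun=> 1), (fun=> 1).
split=> //; try by split; [exact: smooth_at_cst|exact: oner_neq0].
- by apply: filterS H1 => x; rewrite mulr1.
- by apply: filterS H2 => x; rewrite mulr1.
Qed.

Lemma curve_equiv_source (s t : R -> R) g1 g2 d1 d2 : smooth_at s 0 -> s 0 != 0 ->
  smooth_at t 0 -> t 0 != 0 ->
  (\forall x \near (0 : R), g1 (x * s x) = d1 x) ->
  (\forall x \near (0 : R), g2 (x * t x) = d2 x) -> curve_equiv g1 g2 d1 d2.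
Proof.
by move=> *; exists (fun x => x), s, t; split=> //; exact: diffeo_germ_id.
Qed.

Definition cusp1 P Q (x : R) := row2 (x ^+ 2 * P x) (x ^+ 3 * Q x).
Definition cusp2 S T (y : R) := row2 (y ^+ 3 * S y) (y ^+ 2 * T y).

Lemma cusp1_reparam P Q S T (s : R -> R) : smooth_at s 0 -> s 0 = 1 ->
  (\forall x \near (0 : R), s x ^+ 2 * P (x * s x) = 1) ->
  curve_equiv (cusp1 P Q) (cusp2 S T)
    (cusp1 (fun=> 1) (fun x => s x ^+ 3 * Q (x * s x))) (cusp2 S T).
Proof.
move=> ss s0 H; have n0 : s 0 != 0 by rewrite s0 oner_neq0.
apply: (@curve_equiv_source s (fun=> 1)) => //; try by smooth; rewrite oner_neq0.
  apply: filterS H => x Hx; apply: rV2P; rewrite !row2E exprMn.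
    by rewrite -mulrA Hx.
  by rewrite mulrA.
by apply: filterE => x; rewrite mulr1.
Qed.

Lemma cusp2_reparam P Q S T (t : R -> R) : smooth_at t 0 -> t 0 = 1 ->
  (\forall x \near (0 : R), t x ^+ 2 * T (x * t x) = 1) ->
  curve_equiv (cusp1 P Q) (cusp2 S T)
    (cusp1 P Q) (cusp2 (fun y => t y ^+ 3 * S (y * t y)) (fun=> 1)).
Proof.
move=> st t0 H; have n0 : t 0 != 0 by rewrite t0 oner_neq0.
apply: (@curve_equiv_source (fun=> 1) t) => //; try by smooth; rewrite oner_neq0.
  by apply: filterE => x; rewrite mulr1.
apply: filterS H => x Hx; apply: rV2P; rewrite !row2E exprMn.
  by rewrite mulrA.
by rewrite -mulrA Hx.
Qed.

(* The quintic coefficient of the second cusp is an obstruction to the final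
   interpolation step; it is traded for a term absorbed by a change of parameter
   of the first cusp. *)
Lemma cusp2_kill_quintic P Q S : smooth_at P 0 -> smooth_at Q 0 -> smooth_at S 0 ->
  P 0 = 1 -> S 0 = 1 ->
  exists P' (q : R) S3, [/\ smooth_at P' 0, P' 0 = 1, smooth_at S3 0 &
    curve_equiv (cusp1 P Q) (cusp2 S (fun=> 1)) (cusp1 P' Q)
      (cusp2 (fun y => 1 + q * y + y ^+ 3 * S3 y) (fun=> 1))].
Proof.
move=> sP sQ sS P0 S0.
have [S1 sS1 H1] := hadamard1 sS; have [S2 sS2 H2] := hadamard1 sS1.
have [S3 sS3 H3] := hadamard1 sS2.
set q := S1 0 in H2; set c := S2 0 in H3; rewrite S0 in H1.
exists (fun x => P x * (1 - c * (x ^+ 3 * Q x))), q,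
  (fun y => S3 y - q * c - c ^+ 2 * y - c * y ^+ 2 * S3 y).
split; try by smooth.
  by rewrite P0 expr0n mul0r mulr0 subr0 mulr1.
(* On the second cusp [Y = y^2], so the map [X (1 - c Y)] cancels the coefficient [c] of [y^2] in
   [S]. On the first cusp it multiplies [P] by [1 - c x^3 Q]. *)
have dF := @diffeo_germ_tangent_id R (fun x => (- c * x 0 0) * x 0 1) (fun=> 0).
have {}dF : diffeo_germ (fun x : 'rV[R]_2 =>
    row2 (x 0 0 + (- c * x 0 0) * x 0 1) (x 0 1 + 0)).
  apply: dF; last exact: second_order0.
  by apply: second_orderM; [smooth|smooth|rewrite mxE mulr0|rewrite mxE].
apply: (curve_equiv_target dF).
  by apply: filterE => x; apply: rV2P; rewrite !row2E; ring.
apply: filterS3 H1 H2 H3 => y h1 h2 h3.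
apply: rV2P; rewrite !row2E; last by ring.
by rewrite h1 h2 h3; ring.
Qed.

(* Splitting the remainder by parity makes it a function on the plane, evaluated
   along the cusp. *)
Lemma cusp1_straighten Q S : smooth_at Q 0 -> smooth_at S 0 -> Q 0 = 1 ->
  exists2 t, smooth_at t 0 &
    curve_equiv (cusp1 (fun=> 1) Q) (cusp2 S (fun=> 1))
      (cusp1 (fun=> 1) (fun=> 1)) (cusp2 S (fun y => 1 + y ^+ 3 * t y)).
Proof.
move=> sQ sS Q0.
have [r sr Hr] := hadamard1 sQ; rewrite Q0 in Hr.
have [e [od [se so Heo]]] := whitney_parity sr.
(* With [X = x^2], the second coordinate of the first cusp is [x^3 D X + X^2 e X]. *)
pose D (X : R) := 1 + X * od X.
have sD : smooth_at D 0 by rewrite /D; smooth.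
have D0 : D 0 != 0 by rewrite /D mul0r addr0 oner_neq0.
have sDV : smooth_at (fun X => (D X)^-1) 0 by exact: smooth_atV.
pose w X := - od X * (D X)^-1.
have sw : smooth_at w 0 by rewrite /w; smooth.
have nD : \forall X \near (0 : R), D X != 0 /\ 1 + X * w X = (D X)^-1.
  have : \forall X \near (0 : R), D X != 0.
    exact: cvgr_neq0 (smooth_at_continuous sD) D0.
  apply: filterS => X DX; split=> //; rewrite /w.
  apply: (mulIf DX); rewrite mulVf // mulrDl mul1r -!mulrA mulVf // mulr1.
  by rewrite /D; ring.
(* Chosen so that [Y + f2 = (Y - X^2 e X) / D X], which is [x^3] on the first cusp. On the second
   one [X] has order 3 and the other factor order 2, so [Y] changes only from [y^5] on. *)
pose f2 (x : 'rV[R]_2) := x 0 0 * ((x 0 1 - x 0 0 ^+ 2 * e (x 0 0)) * w (x 0 0) - x 0 0 * e (x 0 0)).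
have sc : smooth_at (fun x : 'rV[R]_2 => x 0 0) 0 by exact: smooth_at_coord.
have z : (0 : 'rV[R]_2) 0 0 = 0 by rewrite mxE.
have sec := smooth_at_comp1_0 se sc z; have swc := smooth_at_comp1_0 sw sc z.
have dF : diffeo_germ (fun x : 'rV[R]_2 => row2 (x 0 0 + 0) (x 0 1 + f2 x)).
  apply: diffeo_germ_tangent_id; first exact: second_order0.
  apply: second_orderM; [by smooth|by smooth|by rewrite z|].
  by rewrite !mxE expr0n /=; ring.
pose X y := y ^+ 3 * S y.
have sX : smooth_at X 0 by rewrite /X; smooth.
have X0 : X 0 = 0 by rewrite /X expr0n mul0r.
have seX := smooth_at_comp1_0 se sX X0; have swX := smooth_at_comp1_0 sw sX X0.
exists (fun y => S y * w (X y) - y * S y ^+ 2 * e (X y) * (1 + X y * w (X y))).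
  by smooth.
apply: (curve_equiv_target dF).
  apply: filterS3 Hr Heo (near_sqr nD) => x h1 h2 h3.
  apply: rV2P; rewrite !row2E ?mulr1 ?addr0 //.
  have -> : x ^+ 3 * Q x + f2 (cusp1 (fun=> 1) Q x) =
    (x ^+ 3 * Q x - x ^+ 4 * e (x ^+ 2)) * (1 + x ^+ 2 * w (x ^+ 2)).
    by rewrite /f2 !row2E !mulr1; ring.
  have [DX ->] := h3; rewrite h1 h2; apply: (mulIf DX); rewrite -mulrA mulVf // /D.
  by move: (e _) (od _) => E O; ring.
apply: filterE => y; apply: rV2P; rewrite !row2E ?addr0 // !mulr1 /f2 !row2E !mulr1 -/(X y).
rewrite /X; by move: (e _) (w _) => E W; ring.
Qed.

(** Since the second coordinate is [y^2 (1 + O(y^3))], the parameter change that restores [y^2] is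
    [y (1 + O(y^3))]. It leaves the vanishing coefficient of [y^2] in [S] untouched. *)
Lemma cusp2_restore P Q q S3 t : smooth_at S3 0 -> smooth_at t 0 ->
  exists2 S3', smooth_at S3' 0 &
    curve_equiv (cusp1 P Q)
      (cusp2 (fun y => 1 + q * y + y ^+ 3 * S3 y) (fun y => 1 + y ^+ 3 * t y))
      (cusp1 P Q) (cusp2 (fun y => 1 + q * y + y ^+ 3 * S3' y) (fun=> 1)).
Proof.
move=> sS3 st.
pose T y := 1 + y ^+ 3 * t y.
have sT : smooth_at T 0 by rewrite /T; smooth.
have T0 : T 0 = 1 by rewrite /T expr0n mul0r addr0.
have [s [ss s0] Hs] := reparam_square sT T0.
have sts := smooth_comp_reparam ss st; have sSs := smooth_comp_reparam ss sS3.
have s1 : smooth_at (fun y => s y + 1) 0 by smooth.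
have n1 : s 0 + 1 != 0 by rewrite s0 gt_eqF // addr_gt0.
have sV := @smooth_atV _ _ (fun y : R => s y + 1) 0 n1 s1.
(* The equation for [s] reads [s^2 - 1 = - y^3 s^5 t (y s)]; division by [s + 1] gives
   [s - 1 = y^3 tau]. *)
pose tau y := - (s y ^+ 5 * t (y * s y)) * (s y + 1)^-1.
have stau : smooth_at tau 0 by rewrite /tau; smooth.
have E : \forall y \near (0 : R), s y = 1 + y ^+ 3 * tau y.
  have n1' : \forall y \near (0 : R), s y + 1 != 0.
    exact: cvgr_neq0 (smooth_at_continuous s1) n1.
  apply: filterS2 n1' Hs => y ny; rewrite /T /tau => H.
  apply: (mulIf ny); rewrite mulrDl mul1r -[y ^+ 3 * _ * _]mulrA -[_ * _ * (s y + 1)]mulrA.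
  rewrite mulVf // mulr1.
  have -> : y ^+ 3 * - (s y ^+ 5 * t (y * s y)) =
    s y ^+ 2 - s y ^+ 2 * (1 + (y * s y) ^+ 3 * t (y * s y)) by ring.
  by rewrite H; ring.
exists (fun y => tau y * (q * y) + s y ^+ 3 * S3 (y * s y) +
  tau y * (3 + 3 * (y ^+ 3 * tau y) + (y ^+ 3 * tau y) ^+ 2) *
    (1 + q * y + q * y * (y ^+ 3 * tau y)) +
  (s y ^+ 3 - 1) * (s y ^+ 3 * S3 (y * s y))).
  by smooth.
apply: curve_equiv_trans (cusp2_reparam P Q (fun y => 1 + q * y + y ^+ 3 * S3 y) ss s0 Hs) _.
apply: (@curve_equiv_target (fun x => x)); first exact: diffeo_germ_id.
  exact: filterE.
apply: filterS E => y Ey; apply: rV2P; rewrite !row2E //; congr (_ * _).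
move: (S3 _) => A; rewrite Ey; move: (tau y) => B; ring.
Qed.

(** The target map [X + (X^3 - Y^2) G] fixes the first cusp pointwise. On the second one
    [X^3 - Y^2 = - y^4 D], so [G] must equal [(q + y^2 S3) / D] there. A smooth function of [X, Y]
    can do so because no term of degree 1 in [y] occurs. *)
Lemma cusp2_straighten q S3 : smooth_at S3 0 ->
  curve_equiv (cusp1 (fun=> 1) (fun=> 1))
    (cusp2 (fun y => 1 + q * y + y ^+ 3 * S3 y) (fun=> 1))
    (cusp1 (fun=> 1) (fun=> 1)) (cusp2 (fun=> 1) (fun=> 1)).
Proof.
move=> sS3.
pose S y := 1 + q * y + y ^+ 3 * S3 y.
have sS : smooth_at S 0 by rewrite /S; smooth.
have S0 : S 0 = 1 by rewrite /S expr0n mul0r mulr0 !addr0.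
pose D y := 1 - y ^+ 5 * S y ^+ 3.
have sD : smooth_at D 0 by rewrite /D; smooth.
have D0 : D 0 != 0 by rewrite /D expr0n mul0r subr0 oner_neq0.
have sDV := smooth_atV D0 sD.
(* Chosen so that [(q + y^2 S3) / D = q + y^2 K]. *)
pose K y := (S3 y + q * y ^+ 3 * S y ^+ 3) * (D y)^-1.
have sK : smooth_at K 0 by rewrite /K; smooth.
have [e [od [se so HK]]] := whitney_parity sK.
have [eS [oS [seS soS HS]]] := whitney_parity sS.
have eS0 : eS 0 != 0.
  have := nbhs_singleton HS; rewrite expr0n /= mul0r addr0 S0 => <-.
  exact: oner_neq0.
have seSV := smooth_atV eS0 seS.
(* In [G = h0 Y + X h1 Y], the product [X h1 Y] yields the odd part [y^3 od (y^2)] of [y^2 K]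
   together with the even term [y^4 oS h1], which [h0] subtracts again. *)
pose h1 Y := od Y * (eS Y)^-1.
have sh1 : smooth_at h1 0 by rewrite /h1; smooth.
pose h0 Y := q + Y * e Y - Y ^+ 2 * oS Y * h1 Y.
have sh0 : smooth_at h0 0 by rewrite /h0; smooth.
have sc : smooth_at (fun x : 'rV[R]_2 => x 0 1) 0 by exact: smooth_at_coord.
have z j : (0 : 'rV[R]_2) 0 j = 0 by rewrite mxE.
have sh0c := smooth_at_comp1_0 sh0 sc (z 1).
have sh1c := smooth_at_comp1_0 sh1 sc (z 1).
pose G (x : 'rV[R]_2) := h0 (x 0 1) + x 0 0 * h1 (x 0 1).
have sG : smooth_at G 0 by rewrite /G; smooth.
pose f1 (x : 'rV[R]_2) := (x 0 0 * x 0 0 ^+ 2 + - x 0 1 * x 0 1) * G x.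
have dF : diffeo_germ (fun x : 'rV[R]_2 => row2 (x 0 0 + f1 x) (x 0 1 + 0)).
  apply: diffeo_germ_tangent_id; last exact: second_order0.
  apply: second_orderMr => //; apply: second_orderD.
    by apply: second_orderM; [smooth|smooth|rewrite z|rewrite z expr0n].
  by apply: second_orderM; [smooth|smooth|rewrite z oppr0|rewrite z].
apply: (curve_equiv_target dF).
  apply: filterE => x; apply: rV2P; rewrite !row2E ?addr0 //.
  by rewrite /f1 !row2E; move: (G _) => g; ring.
have nD : \forall y \near (0 : R), D y != 0.
  exact: cvgr_neq0 (smooth_at_continuous sD) D0.
have nE : \forall y \near (0 : R), eS y != 0.
  exact: cvgr_neq0 (smooth_at_continuous seS) eS0.
have HKS : \forall y \near (0 : R), K y = e (y ^+ 2) + y * od (y ^+ 2) /\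
    S y = eS (y ^+ 2) + y * oS (y ^+ 2) by apply: filterS2 HK HS.
apply: filterS3 HKS nD (near_sqr nE) => y [hK hS] Dy Ey.
apply: rV2P; rewrite !row2E ?addr0 // !mulr1.
rewrite -/(S y).
have GE : G (cusp2 S (fun=> 1) y) = q + y ^+ 2 * K y.
  rewrite /G !row2E !mulr1 hK hS /h0 /h1.
  by move: (e _) (od _) (oS _) Ey => a b c; move: (eS _) => d' d0; field.
rewrite /f1 GE !row2E !mulr1.
have KD : K y * D y = S3 y + q * y ^+ 3 * S y ^+ 3.
  by rewrite /K -mulrA mulVf // mulr1.
have -> : y ^+ 3 * S y * (y ^+ 3 * S y) ^+ 2 + - y ^+ 2 * y ^+ 2 = - y ^+ 4 * D y.
  by rewrite /D; ring.
have -> : - y ^+ 4 * D y * (q + y ^+ 2 * K y) =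
  - y ^+ 4 * (D y * q + y ^+ 2 * (K y * D y)) by ring.
rewrite KD /D {1}/S.
by move: (S y) (S3 y) => u v; ring.
Qed.

(** The order matters: straightening the first cusp disturbs the second coordinate of the other one
    only from [y^5] on, so the coefficient removed before does not come back when that coordinate is
    restored. *)
Theorem cusp_pair_normal P Q S T : smooth_at P 0 -> smooth_at Q 0 ->
  smooth_at S 0 -> smooth_at T 0 -> P 0 = 1 -> Q 0 = 1 -> S 0 = 1 -> T 0 = 1 ->
  curve_equiv (cusp1 P Q) (cusp2 S T)
    (cusp1 (fun=> 1) (fun=> 1)) (cusp2 (fun=> 1) (fun=> 1)).
Proof.
move=> sP sQ sS sT P0 Q0 S0 T0.
have [t [st t0] Ht] := reparam_square sT T0.
apply: curve_equiv_trans (cusp2_reparam P Q S st t0 Ht) _.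
have sS' : smooth_at (fun y => t y ^+ 3 * S (y * t y)) 0.
  by apply: smooth_atM; [smooth|exact: smooth_comp_reparam].
have S0' : t 0 ^+ 3 * S (0 * t 0) = 1 by rewrite mul0r t0 S0 expr1n mulr1.
have [P' [q [S3 [sP' P0' sS3 H]]]] := cusp2_kill_quintic sP sQ sS' P0 S0'.
apply: curve_equiv_trans H _.
have [s [ss s0] Hs] := reparam_square sP' P0'.
apply: curve_equiv_trans (cusp1_reparam Q _ _ ss s0 Hs) _.
have sQ' : smooth_at (fun y => s y ^+ 3 * Q (y * s y)) 0.
  by apply: smooth_atM; [smooth|exact: smooth_comp_reparam].
have Q0' : s 0 ^+ 3 * Q (0 * s 0) = 1 by rewrite mul0r s0 Q0 expr1n mulr1.
have sS4 : smooth_at (fun y => 1 + q * y + y ^+ 3 * S3 y) 0 by smooth.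
have [u su H] := cusp1_straighten sQ' sS4 Q0'.
apply: curve_equiv_trans H _.
have [S5 sS5 H] := cusp2_restore (fun=> 1) (fun=> 1) q sS3 su.
apply: curve_equiv_trans H _.
exact: cusp2_straighten.
Qed.

End cusp_pairs.

(** * Normal form of prenormal germs *)

Section prenormal_germs.
Context {R : realType}.
Implicit Types (F : 'rV[R]_2 -> 'rV[R]_2) (h : 'rV[R]_2 -> R) (i j : 'I_2).

Definition axis j (y : R) : 'rV[R]_2 := y *: delta_mx 0 j.

Lemma axis_entry j y k : axis j y 0 k = if k == j then y else 0.
Proof. by rewrite mxE mxE eqxx /=; case: eqP; rewrite ?mulr1 ?mulr0. Qed.

Lemma axis0 j : axis j 0 = 0.
Proof. exact: scale0r. Qed.

Lemma smooth_at_axis j : smooth_at (axis j) 0.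
Proof.
apply/smooth_at_mxP => i k; rewrite ord1.
case: (eqVneq k j) => [->|kj].
  apply: (smooth_at_eq _ (smooth_at_id (0 : R))).
  by apply: filterE => y; rewrite axis_entry eqxx.
apply: (smooth_at_eq _ (smooth_at_cst (0 : R) (0 : R))).
by apply: filterE => y; rewrite axis_entry (negbTE kj).
Qed.

Lemma near_axis j (A : 'rV[R]_2 -> Prop) : (\forall p \near (0 : 'rV[R]_2), A p) ->
  \forall y \near (0 : R), A (axis j y).
Proof. exact: near_comp0 (smooth_at_axis j) (axis0 j). Qed.

(* The coordinate axes are the singular set and, along each of them, the other
   coordinate direction spans the kernel of the differential. *)
Definition prenormal F := [/\ smooth_at F 0, F 0 = 0 &
  forall i j, i != j -> \forall y \near (0 : R), 'D_(delta_mx 0 i) F (axis j y) = 0].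

Definition diag_map (s : 'I_2 -> R -> R) (p : 'rV[R]_2) : 'rV[R]_2 :=
  \row_k (p 0 k * s k (p 0 k)).

Lemma diag_map_axis s j y : diag_map s (axis j y) = axis j (y * s j y).
Proof.
apply/rowP => k; rewrite mxE !axis_entry; case: eqP => [->//|_]; exact: mul0r.
Qed.

Lemma diag_mapE s p : diag_map s p = row2 (p 0 0 * s 0 (p 0 0)) (p 0 1 * s 1 (p 0 1)).
Proof. by apply: rV2P; rewrite row2E mxE. Qed.

Lemma diffeo_germ_diag_map s : (forall k, smooth_at (s k) 0) ->
  (forall k, s k 0 != 0) -> diffeo_germ (diag_map s).
Proof.
move=> ss s0; apply: diffeo_germ_eq (diffeo_germ_diag (ss 0) (ss 1) (s0 0) (s0 1)) _.
by apply: filterE => p; rewrite diag_mapE.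
Qed.

Lemma derive_const_dir (V W : normedModType R) (f : V -> W) p v :
  (forall h : R, f (h *: v + p) = f p) -> 'D_v f p = 0.
Proof.
move=> H; rewrite /derive.
have -> : (fun h : R => h^-1 *: (f (h *: v + p) - f p)) = (fun=> 0).
  by apply/funext => h; rewrite H subrr scaler0.
exact: lim_cst.
Qed.

Lemma derive_diag_map s i j y : i != j -> (forall k, smooth_at (s k) 0) ->
  smooth_at (diag_map s) (axis j y) ->
  'D_(delta_mx 0 i) (diag_map s) (axis j y) = s i 0 *: delta_mx 0 i.
Proof.
move=> ij ss sd; have dd := smooth_at_differentiable sd.
apply/rowP => k; rewrite (derive_mx_entry _ _ _ dd) [RHS]mxE mxE eqxx /=.
have E : (fun p => diag_map s p 0 k) = (fun p => p 0 k * s k (p 0 k)).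
  by apply/funext => p; rewrite mxE.
rewrite E; case: (eqVneq k i) => [->|ki]; last first.
  rewrite mulr0; apply: derive_const_dir => h.
  have -> : (h *: delta_mx 0 i + axis j y) 0 k = axis j y 0 k.
    by rewrite mxE mxE mxE eqxx (negbTE ki) mulr0 add0r.
  by [].
have z : axis j y 0 i = 0 by rewrite axis_entry (negbTE ij).
have sc : smooth_at (fun p : 'rV[R]_2 => p 0 i) (axis j y) by exact: smooth_at_coord.
have scs : smooth_at (fun p : 'rV[R]_2 => s i (p 0 i)) (axis j y).
  by apply: smooth_at_comp1 => //; rewrite z.
rewrite deriveM; [|exact: diff_derivable (smooth_at_differentiable _)..].
rewrite z scale0r add0r -(derive_mx_entry _ _ _ (smooth_at_differentiable (smooth_at_id _))).
by rewrite derive_id mxE !eqxx.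
Qed.

(** [diag_map] preserves each axis and, along it, only rescales the transverse basis vector, so the
    kernel direction is kept; composition on the left cannot destroy a kernel. *)
Lemma prenormal_transform F Phi s : prenormal F -> smooth_at Phi 0 -> Phi 0 = 0 ->
  (forall k, smooth_at (s k) 0) -> (forall k, s k 0 != 0) ->
  prenormal (fun p => Phi (F (diag_map s p))).
Proof.
move=> [sF F0 DF] sP P0 ss s0.
have dd := diffeo_germ_diag_map ss s0.
have sd := diffeo_germ_smooth dd; have d0 := diffeo_germ0 dd.
have sFd : smooth_at (fun p => F (diag_map s p)) 0.
  by apply: smooth_at_comp_rV => //; rewrite d0.
have F0' : F (diag_map s 0) = 0 by rewrite d0.
split; [|by rewrite F0'|].
  by apply: (@smooth_at_comp_rV _ _ _ _ Phi) => //; rewrite F0'.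
move=> i j ij.
have n1 := near_axis j (smooth_at_near sd).
have n2 := near_axis j (near_comp0 sd d0 (smooth_at_near sF)).
have n3 := near_axis j (near_comp0 sFd F0' (smooth_at_near sP)).
have n4 := near_reparam (ss j) (DF i j ij).
have n12 : \forall y \near (0 : R), smooth_at (diag_map s) (axis j y) /\
  smooth_at F (diag_map s (axis j y)) by apply: filterS2 n1 n2.
apply: filterS3 n12 n3 n4 => y [h1 h2] h3 h4.
have dFd : differentiable (fun p => F (diag_map s p)) (axis j y).
  apply: smooth_at_differentiable.
  exact: (@smooth_at_comp_rV _ _ _ _ F).
rewrite (@derive_chain _ _ _ _ Phi) //; last exact: smooth_at_differentiable.
rewrite (@derive_chain _ _ _ _ F) //; try exact: smooth_at_differentiable.
rewrite derive_diag_map // diag_map_axis.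
rewrite diag_map_axis in h2 h3.
have dF := smooth_at_differentiable h2.
rewrite (deriveE _ dF) linearZ /= -(deriveE _ dF) h4 scaler0.
exact: derive0.
Qed.

Lemma hadamard_square i h : smooth_at h 0 ->
  (\forall p \near (0 : 'rV[R]_2), h (upd i p 0) = 0) ->
  (\forall p \near (0 : 'rV[R]_2), pd i h (upd i p 0) = 0) ->
  exists2 G : 'rV[R]_2 -> R, smooth_at G 0 &
    \forall p \near (0 : 'rV[R]_2), h p = p 0 i ^+ 2 * G p.
Proof.
move=> sh h0 dh.
have [h1 sh1 H1] := hadamard_axis sh h0.
have su : smooth_at (fun p : 'rV[R]_2 => upd i p 0) 0.
  by apply: smooth_at_upd; [exact: smooth_at_id|exact: smooth_at_cst].
have u0 : upd i (0 : 'rV[R]_2) 0 = 0.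
  by rewrite -[X in upd i _ X](_ : (0 : 'rV[R]_2) 0 i = 0) ?upd_id // mxE.
have n1 := near_comp0 su u0 (near_join H1).
have n2 := near_comp0 su u0 (smooth_at_near sh1).
have z1 : \forall p \near (0 : 'rV[R]_2), h1 (upd i p 0) = 0.
  apply: filterS3 n1 n2 dh => p k1 k2.
  rewrite /pd (near_eq_derive _ k1) deriveM; last 2 first.
  - exact: diff_derivable (smooth_at_differentiable (smooth_at_coord _ _ _)).
  - exact: diff_derivable (smooth_at_differentiable _).
  rewrite -(derive_mx_entry _ _ _ (smooth_at_differentiable (smooth_at_id _))).
  rewrite derive_id updE eqxx scale0r add0r mxE !eqxx.
  by rewrite /= -[_ *: _]/(_ * _) mulr1.
have [G sG HG] := hadamard_axis sh1 z1.
by exists G => //; apply: filterS2 H1 HG => p -> ->; rewrite expr2 mulrA.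
Qed.

Lemma upd_axis i j p : i != j -> upd i p 0 = axis j (p 0 j).
Proof.
move=> ij; apply/rowP => k; rewrite updE axis_entry.
case: (eqVneq k i) => [->|ki]; first by rewrite (negbTE ij).
suff -> : k = j by rewrite eqxx.
apply/val_inj; move: i j k ij ki => [[|[|//]] ?] [[|[|//]] ?] [[|[|//]] ?] //=.
Qed.

Lemma near_coord j (A : R -> Prop) : (\forall y \near (0 : R), A y) ->
  \forall p \near (0 : 'rV[R]_2), A ((p : 'rV[R]_2) 0 j).
Proof.
move=> HA; have z : (0 : 'rV[R]_2) 0 j = 0 by rewrite mxE.
exact: near_comp0 (smooth_at_coord 0 j (0 : 'rV[R]_2)) z HA.
Qed.

Lemma near_punctured_zero (f : R -> R) : smooth_at f 0 ->
  (\forall x \near (0 : R), x ^+ 2 * f x = 0) -> \forall x \near (0 : R), f x = 0.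
Proof.
move=> sf H.
have H' : \forall x \near (0 : R), x != 0 -> f x = 0.
  apply: filterS H => x /eqP; rewrite mulf_eq0 expf_eq0 /= => /orP[/eqP ->|/eqP //].
  by rewrite eqxx.
have f0 := smooth_at_eq0 sf (smooth_at_cst (0 : R) 0) H'.
by apply: filterS H' => x Hx; have [->|/Hx] := eqVneq x 0.
Qed.

(** After division by the square of one coordinate, the quotient still vanishes to second order
    along the other axis: its value and transverse derivative there, multiplied by [x^2], are those
    of [h], and [x^2] cancels off the origin. *)
Lemma double_hadamard h : smooth_at h 0 ->
  (forall j, \forall y \near (0 : R), h (axis j y) = 0) ->
  (forall i j, i != j -> \forall y \near (0 : R), pd i h (axis j y) = 0) ->
  exists2 D : 'rV[R]_2 -> R, smooth_at D 0 &
    \forall p \near (0 : 'rV[R]_2), h p = p 0 0 ^+ 2 * p 0 1 ^+ 2 * D p.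
Proof.
move=> sh h0 dh.
have up i j (A : 'rV[R]_2 -> Prop) : i != j -> (\forall y \near (0 : R), A (axis j y)) ->
    \forall p \near (0 : 'rV[R]_2), A (upd i p 0).
  by move=> ij /(near_coord j); apply: filterS => p; rewrite (upd_axis p ij).
have [G sG HG] := @hadamard_square 0 h sh (up 0 1 (fun q => h q = 0) isT (h0 1))
   (up 0 1 (fun q => pd 0 h q = 0) isT (dh 0 1 isT)).
have sa := smooth_at_axis 0.
have onaxis (K : 'rV[R]_2 -> R) : smooth_at K 0 ->
    (\forall x \near (0 : R), x ^+ 2 * K (axis 0 x) = 0) ->
    \forall x \near (0 : R), K (axis 0 x) = 0.
  move=> sK; apply: near_punctured_zero.
  by apply: smooth_at_comp; rewrite ?axis0.
have G0 : \forall x \near (0 : R), G (axis 0 x) = 0.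
  apply: onaxis => //; apply: filterS2 (near_axis 0 HG) (h0 0) => x.
  by rewrite axis_entry eqxx => -> .
have dG0 : \forall x \near (0 : R), pd 1 G (axis 0 x) = 0.
  apply: onaxis; first exact: smooth_at_derive.
  have n1 := near_axis 0 (near_join HG).
  have n2 := near_axis 0 (smooth_at_near sG).
  apply: filterS3 n1 n2 (dh 1 0 isT) => x k1 k2.
  rewrite /pd (near_eq_derive _ k1) deriveM; last 2 first.
  - apply: diff_derivable; apply: smooth_at_differentiable.
    by apply: smooth_atX; exact: smooth_at_coord.
  - exact: diff_derivable (smooth_at_differentiable _).
  rewrite axis_entry eqxx [X in _ + X](_ : _ = 0) ?addr0 //.
  rewrite (derive_const_dir (f := fun p : 'rV[R]_2 => p 0 0 ^+ 2)) ?scaler0 // => t.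
  by congr (_ ^+ 2); rewrite mxE mxE mxE /= mulr0 add0r.
have [D sD HD] := @hadamard_square 1 G sG (up 1 0 (fun q => G q = 0) isT G0)
   (up 1 0 (fun q => pd 1 G q = 0) isT dG0).
exists D => //; apply: filterS2 HG HD => p -> ->; exact: mulrA.
Qed.

End prenormal_germs.

(** * Absorbing multiples of x^2 y^2 into the source *)

Section cusp_model_perturbation.
Context {R : realType}.

Definition cusp_model (p : 'rV[R]_2) : 'rV[R]_2 :=
  row2 (p 0 0 ^+ 2 + p 0 1 ^+ 3) (p 0 1 ^+ 2 + p 0 0 ^+ 3).

Let i0 : 'I_4 := Ordinal (isT : 0 < 4)%N.
Let i1 : 'I_4 := Ordinal (isT : 1 < 4)%N.
Let i2 : 'I_4 := Ordinal (isT : 2 < 4)%N.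
Let i3 : 'I_4 := Ordinal (isT : 3 < 4)%N.

Let v4 (a b c d : R) : 'rV[R]_4 := mx_of_seqs 1 4 [:: [:: a; b; c; d]].

Let v4_0 a b c d : v4 a b c d 0 i0 = a. Proof. by rewrite mxE. Qed.
Let v4_1 a b c d : v4 a b c d 0 i1 = b. Proof. by rewrite mxE. Qed.
Let v4_2 a b c d : v4 a b c d 0 i2 = c. Proof. by rewrite mxE. Qed.
Let v4_3 a b c d : v4 a b c d 0 i3 = d. Proof. by rewrite mxE. Qed.
Let v4E := (v4_0, v4_1, v4_2, v4_3).

Let v4P (x : 'rV[R]_4) a b c d : x 0 i0 = a -> x 0 i1 = b -> x 0 i2 = c ->
  x 0 i3 = d -> x = v4 a b c d.
Proof.
move=> h0 h1 h2 h3; apply/rowP => -[[|[|[|[|//]]]] lj].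
- by rewrite (_ : Ordinal lj = i0) ?v4E //; exact: val_inj.
- by rewrite (_ : Ordinal lj = i1) ?v4E //; exact: val_inj.
- by rewrite (_ : Ordinal lj = i2) ?v4E //; exact: val_inj.
- by rewrite (_ : Ordinal lj = i3) ?v4E //; exact: val_inj.
Qed.

Let smooth_at_v4 (V : normedModType R) (a b c d : V -> R) (x : V) :
  smooth_at a x -> smooth_at b x -> smooth_at c x -> smooth_at d x ->
  smooth_at (fun y => v4 (a y) (b y) (c y) (d y)) x.
Proof.
move=> sa sb sc sd; apply/smooth_at_mxP => i [[|[|[|[|//]]]] lj]; rewrite ord1.
- by rewrite (_ : Ordinal lj = i0); [apply: smooth_at_eq sa; apply: filterE => y; rewrite v4E|exact: val_inj].
- by rewrite (_ : Ordinal lj = i1); [apply: smooth_at_eq sb; apply: filterE => y; rewrite v4E|exact: val_inj].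
- by rewrite (_ : Ordinal lj = i2); [apply: smooth_at_eq sc; apply: filterE => y; rewrite v4E|exact: val_inj].
- by rewrite (_ : Ordinal lj = i3); [apply: smooth_at_eq sd; apply: filterE => y; rewrite v4E|exact: val_inj].
Qed.

Let upd_v4_3 a b c d t : upd i3 (v4 a b c d) t = v4 a b c t.
Proof. by apply: v4P; rewrite updE /= ?v4E. Qed.

Let upd_v4_2 a b c d t : upd i2 (v4 a b c d) t = v4 a b t d.
Proof. by apply: v4P; rewrite updE /= ?v4E. Qed.

(* The two quotients by [x^2 y^2] of the components of
   [cusp_model (x + x y^2 k, y + x^2 y m) - cusp_model (x, y)]. *)
Let G1 (x y k m : R) := 2 * k + y ^+ 2 * k ^+ 2 +
  y * (3 * m + 3 * x ^+ 2 * m ^+ 2 + x ^+ 4 * m ^+ 3).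
Let G2 (x y k m : R) := 2 * m + x ^+ 2 * m ^+ 2 +
  x * (3 * k + 3 * y ^+ 2 * k ^+ 2 + y ^+ 4 * k ^+ 3).

Let affine_slice (F : 'rV[R]_4 -> R) i (x : 'rV[R]_4) (a : R) : smooth_at F x ->
  (forall t, F (upd i x t) = 2 * t + a) -> 'D_(delta_mx 0 i) F x != 0.
Proof.
move=> sF H.
have dF : differentiable F (upd i x (x 0 i)).
  by rewrite upd_id; exact: smooth_at_differentiable.
have := is_derive_upd dF; rewrite upd_id => -[_ <-].
have -> : (fun t => F (upd i x t)) = (2 *: (id : R -> R)) + cst a.
  by apply/funext => t; rewrite H.
have d2 : is_derive (x 0 i) 1 ((2 *: (id : R -> R)) + cst a) 2.
  by apply: is_derive_eq; rewrite addr0; exact: mulr1.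
by have [_ ->] := d2; rewrite (eqr_nat R 2 0).
Qed.

(** The coordinates of R^4 are [x, y, m, k]. The first equation is solved for [k], the result [Z] is
    substituted into the second, and that one is solved for [m]. At [x = y = 0] the left-hand side
    [G2] is [2 m], and [G1] is [2 k], which gives the starting values [m0], [k0] and the nonzero
    slopes. *)
Lemma solve_perturbation (D1 D2 : 'rV[R]_2 -> R) : smooth_at D1 0 -> smooth_at D2 0 ->
  exists k m : 'rV[R]_2 -> R, [/\ smooth_at k 0, smooth_at m 0 &
    \forall p \near (0 : 'rV[R]_2),
      G1 ((p : 'rV[R]_2) 0 0) (p 0 1) (k p) (m p) = D1 p /\ G2 (p 0 0) (p 0 1) (k p) (m p) = D2 p].
Proof.
move=> sD1 sD2.
pose k0 := D1 0 / 2; pose m0 := D2 0 / 2.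
have sc j (x : 'rV[R]_4) : smooth_at (fun q : 'rV[R]_4 => q 0 j) x by exact: smooth_at_coord.
have sDc D (x : 'rV[R]_4) : smooth_at D 0 -> x 0 i0 = 0 -> x 0 i1 = 0 ->
    smooth_at (fun q : 'rV[R]_4 => D (row2 (q 0 i0) (q 0 i1)) : R) x.
  by move=> sD h0 h1; apply: smooth_at_comp; [rewrite h0 h1 row2_0|smooth].
pose F1 (q : 'rV[R]_4) := G1 (q 0 i0) (q 0 i1) (q 0 i3) (q 0 i2) -
  D1 (row2 (q 0 i0) (q 0 i1)).
pose x1 := v4 0 0 m0 k0.
have sF1 : smooth_at F1 x1.
  have := sDc D1 x1 sD1; rewrite !v4E => /(_ erefl erefl) ?.
  by rewrite /F1 /G1; smooth.
have F1x : F1 x1 = 0 by rewrite /F1 !v4E row2_0 /G1 /k0; field.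
have DF1 : 'D_(delta_mx 0 i3) F1 x1 != 0.
  apply: (affine_slice (a := - D1 0) sF1) => t.
  by rewrite upd_v4_3 /F1 !v4E row2_0 /G1; ring.
have [Z []] := elementary_inverse sF1 DF1.
rewrite F1x upd_v4_3 v4E => sZ Zx HZ _.
pose F2 (q : 'rV[R]_4) :=
  G2 (q 0 i0) (q 0 i1) (Z (v4 (q 0 i0) (q 0 i1) (q 0 i2) 0)) (q 0 i2) -
  D2 (row2 (q 0 i0) (q 0 i1)).
pose x2 := v4 0 0 m0 0.
have sv2 : smooth_at (fun q : 'rV[R]_4 => v4 (q 0 i0) (q 0 i1) (q 0 i2) 0) x2.
  by apply: smooth_at_v4; smooth.
have sZ2 : smooth_at (fun q : 'rV[R]_4 => Z (v4 (q 0 i0) (q 0 i1) (q 0 i2) 0)) x2.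
  by apply: smooth_at_comp => //; rewrite !v4E.
have sF2 : smooth_at F2 x2.
  have := sDc D2 x2 sD2; rewrite !v4E => /(_ erefl erefl) ?.
  by rewrite /F2 /G2; smooth.
have F2x : F2 x2 = 0.
  by rewrite /F2 !v4E row2_0 /G2 /m0; move: (Z _) => ?; field.
have DF2 : 'D_(delta_mx 0 i2) F2 x2 != 0.
  apply: (affine_slice (a := - D2 0) sF2) => t.
  by rewrite upd_v4_2 /F2 !v4E row2_0 /G2; move: (Z _) => ?; ring.
have [Y []] := elementary_inverse sF2 DF2.
rewrite F2x upd_v4_2 v4E => sY Yx HY _.
have sw : smooth_at (fun p : 'rV[R]_2 => v4 (p 0 0) (p 0 1) 0 0) 0.
  by apply: smooth_at_v4; smooth.
have w0 : v4 ((0 : 'rV[R]_2) 0 0) ((0 : 'rV[R]_2) 0 1) 0 0 = v4 0 0 0 0 by rewrite !mxE.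
pose m (p : 'rV[R]_2) := Y (v4 (p 0 0) (p 0 1) 0 0).
have sm : smooth_at m 0.
  by apply: (@smooth_at_comp _ _ _ Y (fun p : 'rV[R]_2 => v4 (p 0 0) (p 0 1) 0 0)) => //; rewrite w0.
have m00 : m 0 = m0 by rewrite /m w0.
have sw2 : smooth_at (fun p : 'rV[R]_2 => v4 (p 0 0) (p 0 1) (m p) 0) 0.
  by apply: smooth_at_v4; smooth.
have w20 : v4 ((0 : 'rV[R]_2) 0 0) ((0 : 'rV[R]_2) 0 1) (m 0) 0 = v4 0 0 m0 0.
  by rewrite m00 !mxE.
exists (fun p : 'rV[R]_2 => Z (v4 (p 0 0) (p 0 1) (m p) 0)), m; split=> //.
  by apply: (@smooth_at_comp _ _ _ Z (fun p : 'rV[R]_2 => v4 (p 0 0) (p 0 1) (m p) 0)) => //; rewrite w20.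
have n1 : \forall p \near (0 : 'rV[R]_2),
    F1 (upd i3 (v4 ((p : 'rV[R]_2) 0 0) (p 0 1) (m p) 0) (Z (v4 (p 0 0) (p 0 1) (m p) 0))) =
    v4 (p 0 0) (p 0 1) (m p) 0 0 i3.
  apply: (near_comp (f := fun p : 'rV[R]_2 => v4 (p 0 0) (p 0 1) (m p) 0)
    (P := fun q => F1 (upd i3 q (Z q)) = q 0 i3)).
    exact: smooth_at_continuous.
  by rewrite w20.
have n2 : \forall p \near (0 : 'rV[R]_2),
    F2 (upd i2 (v4 ((p : 'rV[R]_2) 0 0) (p 0 1) 0 0) (Y (v4 (p 0 0) (p 0 1) 0 0))) =
    v4 (p 0 0) (p 0 1) 0 0 0 i2.
  apply: (near_comp (f := fun p : 'rV[R]_2 => v4 (p 0 0) (p 0 1) 0 0)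
    (P := fun q => F2 (upd i2 q (Y q)) = q 0 i2)).
    exact: smooth_at_continuous.
  by rewrite w0.
apply: filterS2 n1 n2 => p; rewrite upd_v4_3 upd_v4_2 -/(m p) /F1 /F2 !v4E row2_eta.
by move=> /subr0_eq -> /subr0_eq ->.
Qed.

Lemma cusp_model_perturbation (f : 'rV[R]_2 -> 'rV[R]_2) (D1 D2 : 'rV[R]_2 -> R) :
  smooth_at D1 0 -> smooth_at D2 0 ->
  (\forall p \near (0 : 'rV[R]_2), f p = cusp_model p +
     ((p : 'rV[R]_2) 0 0 ^+ 2 * p 0 1 ^+ 2) *: row2 (D1 p) (D2 p)) ->
  A_equivalent f cusp_model.
Proof.
move=> sD1 sD2 Hf; have [k [m [sk sm H]]] := solve_perturbation sD1 sD2.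
have z j : (0 : 'rV[R]_2) 0 j = 0 by rewrite mxE.
exists (fun p : 'rV[R]_2 => row2 (p 0 0 + (p 0 0 * p 0 1 ^+ 2) * k p)
                      (p 0 1 + (p 0 0 ^+ 2 * p 0 1) * m p)), (fun x => x).
split; [|exact: diffeo_germ_id|].
  apply: diffeo_germ_tangent_id; apply: second_orderMr => //;
  by apply: second_orderM; [smooth|smooth|rewrite z ?expr0n|rewrite z ?expr0n].
apply: filterS2 Hf H => p -> [H1 H2]; rewrite -H1 -H2.
apply: rV2P; rewrite rV_entryD rV_entryZ !row2E /G1 /G2; ring.
Qed.

End cusp_model_perturbation.

(** * Classification of prenormal germs *)

Section prenormal_classification.
Context {R : realType}.

Lemma fifth_root (a : R) : a != 0 -> exists2 u : R, u != 0 & u ^+ 5 = a.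
Proof.
have pos (b : R) : 0 < b -> exists2 u : R, u != 0 & u ^+ 5 = b.
  move=> b0; exists (b `^ 5^-1); first by rewrite gt_eqF // powR_gt0.
  by rewrite -powR_mulrn ?powR_ge0 // -powRrM mulVf // powRr1 // ltW.
move=> a0; have [/pos//|] := ltP 0 a.
rewrite le_eqVlt (negbTE a0) /= -oppr_gt0 => /pos [u u0 ua].
exists (- u); first by rewrite oppr_eq0.
by rewrite -[RHS]opprK -ua; ring.
Qed.

Lemma cusp_pair_scale (P Q S T : R -> R) : smooth_at P 0 -> smooth_at Q 0 ->
  smooth_at S 0 -> smooth_at T 0 -> P 0 = 1 -> Q 0 != 0 -> S 0 != 0 -> T 0 = 1 ->
  curve_equiv (cusp1 P Q) (cusp2 S T)
    (cusp1 (fun=> 1) (fun=> 1)) (cusp2 (fun=> 1) (fun=> 1)).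
Proof.
move=> sP sQ sS sT P0 Q0 S0 T0.
have [u u0 uE] := fifth_root Q0; have [v v0 vE] := fifth_root S0.
(* Scaling the parameters by [l], [m] and the target by [l^-2], [m^-2] keeps the quadratic
   coefficients and requires [l^3 Q 0 = m^2] and [m^3 S 0 = l^2]. Elimination leads to fifth powers,
   such as [l^5 Q(0)^3 S(0)^2 = 1]. *)
pose l := (v ^+ 2 * u ^+ 3)^-1; pose m := (u ^+ 2 * v ^+ 3)^-1.
have l0 : l != 0 by rewrite invr_neq0 // mulf_neq0 // expf_neq0.
have m0 : m != 0 by rewrite invr_neq0 // mulf_neq0 // expf_neq0.
have sl (c : R) : smooth_at (fun=> c : R) (0 : R) by exact: smooth_at_cst.
have sc (c : R) (f : R -> R) : smooth_at f 0 -> smooth_at (fun x : R => f (x * c)) 0.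
  by move=> sf; exact: (smooth_comp_reparam (sl c) sf).
have step : curve_equiv (cusp1 P Q) (cusp2 S T)
    (cusp1 (fun x => P (x * l)) (fun x => l ^+ 3 * (m ^+ 2)^-1 * Q (x * l)))
    (cusp2 (fun x => m ^+ 3 * (l ^+ 2)^-1 * S (x * m)) (fun x => T (x * m))).
  have dL := @diffeo_germ_linear R (l ^+ 2)^-1 0 0 (m ^+ 2)^-1.
  exists (fun x => row2 ((l ^+ 2)^-1 * x 0 0 + 0 * x 0 1) (0 * x 0 0 + (m ^+ 2)^-1 * x 0 1)).
  exists (fun=> l), (fun=> m); split => //.
  - by apply: dL; rewrite mulr0 subr0 mulf_neq0 // invr_neq0 // expf_neq0.
  - apply: filterE => x; apply: rV2P; rewrite !row2E; move: (P _) (Q _) => A B; by field.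
  - apply: filterE => x; apply: rV2P; rewrite !row2E; move: (S _) (T _) => A B; by field.
apply: curve_equiv_trans step _; apply: cusp_pair_normal.
- exact: sc.
- by apply: smooth_atM; [exact: sl|exact: sc].
- by apply: smooth_atM; [exact: sl|exact: sc].
- exact: sc.
- by rewrite mul0r.
- by rewrite mul0r -uE /l /m; field; rewrite u0 v0.
- by rewrite mul0r -vE /l /m; field; rewrite u0 v0.
- by rewrite mul0r.
Qed.

Lemma cusp_pair_linear (A1 A2 B1 B2 : R -> R) :
  smooth_at A1 0 -> smooth_at A2 0 -> smooth_at B1 0 -> smooth_at B2 0 ->
  A1 0 * B2 0 - A2 0 * B1 0 != 0 ->
  A1 0 * derive1 A2 0 - A2 0 * derive1 A1 0 != 0 ->
  B1 0 * derive1 B2 0 - B2 0 * derive1 B1 0 != 0 ->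
  curve_equiv (fun x => row2 (x ^+ 2 * A1 x) (x ^+ 2 * A2 x))
    (fun y => row2 (y ^+ 2 * B1 y) (y ^+ 2 * B2 y))
    (cusp1 (fun=> 1) (fun=> 1)) (cusp2 (fun=> 1) (fun=> 1)).
Proof.
move=> sA1 sA2 sB1 sB2 D0 DA DB.
have [a1 sa1 Ha1] := hadamard1 sA1; have [a2 sa2 Ha2] := hadamard1 sA2.
have [b1 sb1 Hb1] := hadamard1 sB1; have [b2 sb2 Hb2] := hadamard1 sB2.
rewrite (hadamard1_derive sa1 Ha1) (hadamard1_derive sa2 Ha2) in DA.
rewrite (hadamard1_derive sb1 Hb1) (hadamard1_derive sb2 Hb2) in DB.
set p := A1 0 in D0 DA Ha1; set q := A2 0 in D0 DA Ha2.
set r := B1 0 in D0 DB Hb1; set s := B2 0 in D0 DB Hb2.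
pose D := p * s - q * r; rewrite -/D in D0.
(* The inverse of the matrix with columns [(p, q)] and [(r, s)]: the cuspidal tangents become the
   coordinate axes, and the other two determinants, divided by [D] and up to sign, become the cubic
   coefficients. *)
have dL : diffeo_germ (fun x => row2 (s / D * x 0 0 + (- r / D) * x 0 1)
                                     (- q / D * x 0 0 + p / D * x 0 1)).
  apply: diffeo_germ_linear.
  have -> : s / D * (p / D) - - r / D * (- q / D) = D / D * D^-1 by rewrite /D; ring.
  by rewrite divff // mul1r invr_neq0.
apply: (@curve_equiv_trans _ _ _
  (cusp1 (fun x => s / D * A1 x + - r / D * A2 x) (fun x => - q / D * a1 x + p / D * a2 x))
  (cusp2 (fun x => s / D * b1 x + - r / D * b2 x) (fun x => - q / D * B1 x + p / D * B2 x))).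
  apply: (curve_equiv_target dL).
    apply: filterS2 Ha1 Ha2 => x h1 h2; apply: rV2P; rewrite !row2E; first by ring.
    rewrite h1 h2; by ring.
  apply: filterS2 Hb1 Hb2 => x h1 h2; apply: rV2P; rewrite !row2E; last by ring.
  rewrite h1 h2; by ring.
apply: cusp_pair_scale; try by smooth.
- rewrite -/p -/q.
  have -> : s / D * p + - r / D * q = D / D by rewrite /D; ring.
  exact: divff.
- have -> : - q / D * a1 0 + p / D * a2 0 = (p * a2 0 - q * a1 0) / D by ring.
  by rewrite mulf_neq0 // invr_neq0.
- have -> : s / D * b1 0 + - r / D * b2 0 = - (r * b2 0 - s * b1 0) / D by ring.
  by rewrite mulf_neq0 ?oppr_eq0 // invr_neq0.
- rewrite -/r -/s.
  have -> : - q / D * r + p / D * s = D / D by rewrite /D; ring.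
  exact: divff.
Qed.

Lemma cusp_model_smooth : smooth_at (@cusp_model R) 0.
Proof. by rewrite /cusp_model; smooth. Qed.

Lemma cusp_model_entry0 : (fun p => cusp_model p 0 0) =
  (fun p : 'rV[R]_2 => p 0 0 ^+ 2 + p 0 1 ^+ 3).
Proof. by apply/funext => p; rewrite row2E. Qed.

Lemma cusp_model_entry1 : (fun p => cusp_model p 0 1) =
  (fun p : 'rV[R]_2 => p 0 1 ^+ 2 + p 0 0 ^+ 3).
Proof. by apply/funext => p; rewrite row2E. Qed.

Lemma pd_coordX i k n j (y : R) : i != j ->
  pd i (fun p : 'rV[R]_2 => p 0 k ^+ n.+2) (axis j y) = 0.
Proof.
move=> ij; rewrite /pd.
case: (eqVneq k i) => [->|ki].
  have z : axis j y 0 i = 0 by rewrite axis_entry (negbTE ij).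
  have -> : (fun p : 'rV[R]_2 => p 0 i ^+ n.+2) =
    (fun p => p 0 i * p 0 i ^+ n.+1) by apply/funext => p; rewrite exprS.
  have dc m : derivable (fun p : 'rV[R]_2 => p 0 i ^+ m) (axis j y) (delta_mx 0 i).
    apply: diff_derivable; apply: smooth_at_differentiable.
    by apply: smooth_atX; exact: smooth_at_coord.
  rewrite deriveM; [|exact: (dc 1%N)|exact: dc].
  by rewrite z scale0r expr0n scale0r addr0.
apply: derive_const_dir => h; congr (_ ^+ _).
by rewrite mxE mxE mxE eqxx (negbTE ki) mulr0 add0r.
Qed.

Lemma I2_neq0 (k : 'I_2) : k != 0 -> k = 1.
Proof. by move=> k0; apply/val_inj; move: k0; case: k => [[|[|//]] ?]. Qed.

Theorem prenormal_cusp_model (F : 'rV[R]_2 -> 'rV[R]_2) (A1 A2 B1 B2 : R -> R) :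
  prenormal F ->
  smooth_at A1 0 -> smooth_at A2 0 -> smooth_at B1 0 -> smooth_at B2 0 ->
  (\forall x \near (0 : R), F (axis 0 x) = row2 (x ^+ 2 * A1 x) (x ^+ 2 * A2 x)) ->
  (\forall y \near (0 : R), F (axis 1 y) = row2 (y ^+ 2 * B1 y) (y ^+ 2 * B2 y)) ->
  A1 0 * B2 0 - A2 0 * B1 0 != 0 ->
  A1 0 * derive1 A2 0 - A2 0 * derive1 A1 0 != 0 ->
  B1 0 * derive1 B2 0 - B2 0 * derive1 B1 0 != 0 ->
  A_equivalent F cusp_model.
Proof.
move=> pF sA1 sA2 sB1 sB2 FA FB D0 DA DB.
have [Phi [s [t [dP [ss s0] [st t0] H1 H2]]]] :=
  cusp_pair_linear sA1 sA2 sB1 sB2 D0 DA DB.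
pose st' (k : 'I_2) := if k == 0 then s else t.
have sst k : smooth_at (st' k) 0 by rewrite /st'; case: ifP.
have st0 k : st' k 0 != 0 by rewrite /st'; case: ifP.
have dd := diffeo_germ_diag_map sst st0.
pose F' p := Phi (F (diag_map st' p)).
have pF' : prenormal F'.
  exact: (prenormal_transform pF (diffeo_germ_smooth dP) (diffeo_germ0 dP) sst st0).
apply: A_equivalent_trans (A_equivalent_diffeo F dd dP) _.
rewrite -/F'.
have [sF' F'0 DF'] := pF'.
have onaxis j : \forall y \near (0 : R), F' (axis j y) = cusp_model (axis j y).
  case: (eqVneq j 0) => [->|j0].
    apply: filterS2 (near_reparam ss FA) H1 => x h1 h2.
    rewrite /F' diag_map_axis /st' eqxx h1 h2.
    by rewrite /cusp_model !axis_entry /cusp1 /= !mulr1 !expr0n /= addr0 add0r.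
  rewrite (I2_neq0 j0).
  apply: filterS2 (near_reparam st FB) H2 => x h1 h2.
  rewrite /F' diag_map_axis /st' /= h1 h2.
  by rewrite /cusp_model !axis_entry /cusp2 /= !mulr1 !expr0n /= addr0 add0r.
have scm k : smooth_at (fun p : 'rV[R]_2 => cusp_model p 0 k) 0.
  by have /smooth_at_mxP := cusp_model_smooth; exact.
have sF'k k : smooth_at (fun p => F' p 0 k) 0 by have /smooth_at_mxP := sF'; exact.
(* Transverse derivatives along the axes vanish for [F'] and for the model alike, hence for their
   difference. *)
have div k : exists2 D : 'rV[R]_2 -> R, smooth_at D 0 &
    \forall p \near (0 : 'rV[R]_2), F' p 0 k - cusp_model p 0 k =
      p 0 0 ^+ 2 * p 0 1 ^+ 2 * D p.
  apply: double_hadamard; first exact: smooth_atB.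
    by move=> j; apply: filterS (onaxis j) => y ->; rewrite subrr.
  move=> i j ij.
  have n1 := near_axis j (smooth_at_near sF').
  have n2 := near_axis j (smooth_at_near (scm k)).
  apply: filterS3 n1 n2 (DF' i j ij) => y h1 h2 h3.
  have d1 : derivable (fun p => F' p 0 k) (axis j y) (delta_mx 0 i).
    apply: diff_derivable; apply: smooth_at_differentiable.
    by have /smooth_at_mxP := h1; exact.
  rewrite /pd deriveB //; last exact: diff_derivable (smooth_at_differentiable h2).
  rewrite -(derive_mx_entry _ _ _ (smooth_at_differentiable h1)) h3 mxE add0r.
  apply/eqP; rewrite oppr_eq0; apply/eqP; rewrite -/(pd i _ _).
  have dX k' n : derivable (fun p : 'rV[R]_2 => p 0 k' ^+ n) (axis j y) (delta_mx 0 i).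
    apply: diff_derivable; apply: smooth_at_differentiable.
    by apply: smooth_atX; exact: smooth_at_coord.
  case: (eqVneq k 0) => [->|k0].
    by rewrite cusp_model_entry0 /pd deriveD // -!/(pd i _ _) !pd_coordX // addr0.
  rewrite (I2_neq0 k0).
  by rewrite cusp_model_entry1 /pd deriveD // -!/(pd i _ _) !pd_coordX // addr0.
have [D1 sD1 HD1] := div 0; have [D2 sD2 HD2] := div 1.
apply: (cusp_model_perturbation sD1 sD2).
apply: filterS2 HD1 HD2 => p h1 h2.
apply: rV2P; rewrite rV_entryD rV_entryZ.
  by rewrite (row2_00 (D1 p)) -h1 addrC subrK.
by rewrite (row2_01 (D1 p)) -h2 addrC subrK.
Qed.

End prenormal_classification.

Section prenormal_form.
Context {R : realType}.

(** On the axis [x_i = 0] the first summand has a double zero in [x_i], and the second does not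
    depend on [x_i]. *)
Lemma pd_form i j (K : 'rV[R]_2 -> R) (g : R -> R) y : i != j ->
  smooth_at K (axis j y) -> smooth_at g y ->
  pd i (fun p : 'rV[R]_2 => p 0 i ^+ 2 * K p + g (p 0 j)) (axis j y) = 0.
Proof.
move=> ij sK sg.
have sX : smooth_at (fun p : 'rV[R]_2 => p 0 i ^+ 2) (axis j y).
  by apply: smooth_atX; exact: smooth_at_coord.
have sgc : smooth_at (fun p : 'rV[R]_2 => g (p 0 j)) (axis j y).
  by apply: smooth_at_comp1; [rewrite axis_entry eqxx|exact: smooth_at_coord].
have dX := diff_derivable (v := delta_mx 0 i) (smooth_at_differentiable sX).
have dK := diff_derivable (v := delta_mx 0 i) (smooth_at_differentiable sK).
have dg := diff_derivable (v := delta_mx 0 i) (smooth_at_differentiable sgc).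
have dXK := diff_derivable (v := delta_mx 0 i) (smooth_at_differentiable (smooth_atM sX sK)).
rewrite /pd deriveD // deriveM //.
have := pd_coordX i (0%N) y ij; rewrite /pd => ->.
rewrite axis_entry (negbTE ij) expr0n scale0r scaler0 !add0r.
apply: derive_const_dir => h; congr g.
by rewrite mxE mxE mxE eqxx [j == i]eq_sym (negbTE ij) mulr0 add0r.
Qed.

Variables (F : 'rV[R]_2 -> 'rV[R]_2) (A B : 'I_2 -> R -> R) (C : 'I_2 -> 'rV[R]_2 -> R).
Hypotheses (sA : forall k, smooth_at (A k) 0) (sB : forall k, smooth_at (B k) 0).
Hypothesis sC : forall k, smooth_at (C k) 0.
Hypothesis FE : \forall p \near (0 : 'rV[R]_2), forall k,
  F p 0 k = p 0 0 ^+ 2 * A k (p 0 0) + p 0 1 ^+ 2 * B k (p 0 1) +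
            p 0 0 ^+ 2 * p 0 1 ^+ 2 * C k p.

Let z j : (0 : 'rV[R]_2) 0 j = 0. Proof. by rewrite mxE. Qed.
Let sc j : smooth_at (fun p : 'rV[R]_2 => p 0 j) 0. Proof. exact: smooth_at_coord. Qed.
Let sAc k := smooth_at_comp1_0 (sA k) (sc 0) (z 0).
Let sBc k := smooth_at_comp1_0 (sB k) (sc 1) (z 1).

Lemma prenormal_form_axis0 : \forall x \near (0 : R),
  F (axis 0 x) = row2 (x ^+ 2 * A 0 x) (x ^+ 2 * A 1 x).
Proof.
apply: filterS (near_axis 0 FE) => x H.
by apply: rV2P; rewrite H row2E !axis_entry /= expr0n /= mul0r mulr0 mul0r !addr0.
Qed.

Lemma prenormal_form_axis1 : \forall y \near (0 : R),
  F (axis 1 y) = row2 (y ^+ 2 * B 0 y) (y ^+ 2 * B 1 y).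
Proof.
apply: filterS (near_axis 1 FE) => y H.
by apply: rV2P; rewrite H row2E !axis_entry /= expr0n /= !mul0r addr0 add0r.
Qed.

Lemma prenormal_form : prenormal F.
Proof.
have sF : smooth_at F 0.
  apply/smooth_at_mxP => i k; rewrite ord1.
  apply: (@smooth_at_eq _ _ _ (fun p : 'rV[R]_2 => p 0 0 ^+ 2 * A k (p 0 0) +
    p 0 1 ^+ 2 * B k (p 0 1) + p 0 0 ^+ 2 * p 0 1 ^+ 2 * C k p)).
    by apply: filterS FE => p ->.
  have := sAc k; have := sBc k; have := sC k => ? ? ?; smooth.
split=> // [|i j ij].
  have := nbhs_singleton prenormal_form_axis0; rewrite axis0 => ->.
  by rewrite expr0n /= !mul0r row2_0.
suff main k : \forall y \near (0 : R), pd i (fun p => F p 0 k) (axis j y) = 0.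
  apply: filterS3 (main 0) (main 1) (near_axis j (smooth_at_near sF)) => y h0 h1 sy.
  have dF := smooth_at_differentiable sy.
  by apply: rV2P; rewrite derive_mx_entry // mxE.
have nFE := near_axis j (near_join FE).
case: (eqVneq i 0) => [i0|/I2_neq0 i1].
  have j1 : j = 1 by apply: I2_neq0; rewrite eq_sym -i0.
  subst i j.
  pose K (p : 'rV[R]_2) := A k (p 0 0) + p 0 1 ^+ 2 * C k p.
  have sK : smooth_at K 0 by rewrite /K; have := sAc k; have := sC k => ? ?; smooth.
  have sg : smooth_at (fun y : R => y ^+ 2 * B k y) 0 by have := sB k => ?; smooth.
  apply: filterS3 nFE (near_axis 1 (smooth_at_near sK)) (smooth_at_near sg) => y h1 h2 h3.
  rewrite -(@pd_form 0 1 K _ y isT h2 h3); apply: near_eq_derive.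
  by apply: filterS h1 => p ->; rewrite /K; ring.
have j0 : j = 0.
  by apply: contraNeq ij => /I2_neq0 ->; rewrite i1.
subst i j.
pose K (p : 'rV[R]_2) := B k (p 0 1) + p 0 0 ^+ 2 * C k p.
have sK : smooth_at K 0 by rewrite /K; have := sBc k; have := sC k => ? ?; smooth.
have sg : smooth_at (fun y : R => y ^+ 2 * A k y) 0 by have := sA k => ?; smooth.
apply: filterS3 nFE (near_axis 0 (smooth_at_near sK)) (smooth_at_near sg) => y h1 h2 h3.
rewrite -(@pd_form 1 0 K _ y isT h2 h3); apply: near_eq_derive.
by apply: filterS h1 => p ->; rewrite /K; ring.
Qed.

Theorem prenormal_form_equiv :
  A 0 0 * B 1 0 - A 1 0 * B 0 0 != 0 ->
  A 0 0 * derive1 (A 1) 0 - A 1 0 * derive1 (A 0) 0 != 0 ->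
  B 0 0 * derive1 (B 1) 0 - B 1 0 * derive1 (B 0) 0 != 0 ->
  A_equivalent F cusp_model.
Proof.
exact: (prenormal_cusp_model prenormal_form (sA 0) (sA 1) (sB 0) (sB 1)
  prenormal_form_axis0 prenormal_form_axis1).
Qed.

End prenormal_form.

(** * The sharksfin *)

Section sharksfin.
Context {R : realType}.

Lemma sharksfin_model_smooth : smooth_at (@sharksfin_model R) 0.
Proof. by rewrite /sharksfin_model; smooth. Qed.

Lemma sharksfin_model0 : @sharksfin_model R 0 = 0.
Proof. by rewrite /sharksfin_model !mxE mul0r !expr0n /= !addr0 row2_0. Qed.

(* The singular set [2 v^2 = 2 u^2 + 3 u^3] of the model is a nodal cubic; the
   two branches at the node, parametrized by the slope [v / u] shifted by 1 and
   -1, are the images of the axes under [sharksfin_chart], which moreover sends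
   the transverse coordinate direction to the kernel of the differential. *)
Definition sharksfin_chart (p : 'rV[R]_2) : 'rV[R]_2 :=
  let x := p 0 0 in let y := p 0 1 in
  row2 (4 / 3 * (x - y) + 2 / 3 * (x + y) ^+ 2)
    (2 / 3 * (2 * x + 3 * x ^+ 2 + x ^+ 3 + y ^+ 3 - 3 * y ^+ 2 + 2 * y
              - 2 * x ^+ 2 * y - 2 * x * y ^+ 2)).

Lemma diffeo_germ_sharksfin_chart : diffeo_germ sharksfin_chart.
Proof.
have z j : (0 : 'rV[R]_2) 0 j = 0 by rewrite mxE.
(* The inverse of the linear part, applied to the chart, leaves the identity plus [(w1, w2)]. Both
   are arranged as sums of products of functions that vanish at 0. *)
pose w1 (p : 'rV[R]_2) := let x := p 0 0 in let y := p 0 1 in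
  x * ((4 * x + 2 * y + x ^+ 2 - 2 * x * y - 2 * y ^+ 2) / 4) + y * ((y ^+ 2 - 2 * y) / 4).
pose w2 (p : 'rV[R]_2) := let x := p 0 0 in let y := p 0 1 in
  x * ((2 * x - 2 * y + x ^+ 2 - 2 * x * y - 2 * y ^+ 2) / 4) + y * ((y ^+ 2 - 4 * y) / 4).
have s1 : second_order w1.
  by apply: second_orderD; apply: second_orderM; try by smooth; rewrite /= !z; ring.
have s2 : second_order w2.
  by apply: second_orderD; apply: second_orderM; try by smooth; rewrite /= !z; ring.
have dL : diffeo_germ (fun x : 'rV[R]_2 =>
    row2 (4 / 3 * x 0 0 + - (4 / 3) * x 0 1) (4 / 3 * x 0 0 + 4 / 3 * x 0 1)).
  apply: diffeo_germ_linear.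
  have -> : 4 / 3 * (4 / 3) - - (4 / 3) * (4 / 3) = 32 / 9 :> R by field.
  by rewrite mulf_neq0 ?invr_neq0 // pnatr_eq0.
apply: diffeo_germ_eq (diffeo_germ_comp dL (diffeo_germ_tangent_id s1 s2)) _.
apply: filterE => p; rewrite /sharksfin_chart /w1 /w2 /=.
by move: (p 0 0) (p 0 1) => x y; apply: rV2P; rewrite !row2E; field.
Qed.

Lemma sharksfin_cusp_model : A_equivalent (@sharksfin_model R) cusp_model.
Proof.
have E := A_equivalent_diffeo (@sharksfin_model R) diffeo_germ_sharksfin_chart diffeo_germ_id.
apply: A_equivalent_trans E _.
(* [A], [B] and [C] are read off from the model expanded in [sharksfin_chart]: the parts depending
   on [x] alone, on [y] alone, and the mixed part divided by [x^2 y^2]. *)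
pose A (k : 'I_2) (x : R) : R := if k == 0
  then 16 / 9 + x * (32 / 9 + 20 / 9 * x + 4 / 9 * x ^+ 2)
  else 32 / 9 + x * (256 / 27 + 88 / 9 * x + 40 / 9 * x ^+ 2 + 20 / 27 * x ^+ 3).
pose B (k : 'I_2) (y : R) : R := if k == 0
  then - (16 / 9) + y * (32 / 9 - 20 / 9 * y + 4 / 9 * y ^+ 2)
  else 32 / 9 + y * (- (256 / 27) + 88 / 9 * y - 40 / 9 * y ^+ 2 + 20 / 27 * y ^+ 3).
pose C (k : 'I_2) (p : 'rV[R]_2) : R := let x := p 0 0 in let y := p 0 1 in
  if k == 0 then - (20 / 9) * (x + y)
  else - (176 / 9) + 40 / 9 * (y - x + x ^+ 2 + y ^+ 2) + 280 / 27 * x * y.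
have dA0 : derive1 (A 0) 0 = 32 / 9.
  rewrite (@hadamard1_derive _ _ (fun x => 32 / 9 + 20 / 9 * x + 4 / 9 * x ^+ 2)).
  - by rewrite expr0n /=; ring.
  - by smooth.
  - by apply: filterE => x; rewrite /A /=; ring.
have dA1 : derive1 (A 1) 0 = 256 / 27.
  rewrite (@hadamard1_derive _ _ (fun x => 256 / 27 + 88 / 9 * x + 40 / 9 * x ^+ 2 + 20 / 27 * x ^+ 3)).
  - by rewrite !expr0n /=; ring.
  - by smooth.
  - by apply: filterE => x; rewrite /A /=; ring.
have dB0 : derive1 (B 0) 0 = 32 / 9.
  rewrite (@hadamard1_derive _ _ (fun x => 32 / 9 - 20 / 9 * x + 4 / 9 * x ^+ 2)).
  - by rewrite expr0n /=; ring.
  - by smooth.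
  - by apply: filterE => x; rewrite /B /=; ring.
have dB1 : derive1 (B 1) 0 = - (256 / 27).
  rewrite (@hadamard1_derive _ _ (fun x => - (256 / 27) + 88 / 9 * x - 40 / 9 * x ^+ 2 + 20 / 27 * x ^+ 3)).
  - by rewrite !expr0n /=; ring.
  - by smooth.
  - by apply: filterE => x; rewrite /B /=; ring.
have nz (m n : nat) : (m%:R / n.+1%:R == 0 :> R) = (m == 0)%N.
  by rewrite mulf_eq0 invr_eq0 !pnatr_eq0 orbF.
apply: (@prenormal_form_equiv _ _ A B C).
- by move=> k; rewrite /A; case: (k == 0); smooth.
- by move=> k; rewrite /B; case: (k == 0); smooth.
- by move=> k; rewrite /C; case: (k == 0); smooth.
- apply: filterE => p k; case: (eqVneq k 0) => [->|/I2_neq0 ->].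
    rewrite /A /B /C /= /sharksfin_model /sharksfin_chart !row2E.
    by move: (p 0 0) (p 0 1) => x y; field.
  rewrite /A /B /C /= /sharksfin_model /sharksfin_chart !row2E.
  by move: (p 0 0) (p 0 1) => x y; field.
- rewrite /A /B /=.
  have -> : (16 / 9 + 0 * (32 / 9 + 20 / 9 * 0 + 4 / 9 * 0 ^+ 2)) *
    (32 / 9 + 0 * (- (256 / 27) + 88 / 9 * 0 - 40 / 9 * 0 ^+ 2 + 20 / 27 * 0 ^+ 3)) -
    (32 / 9 + 0 * (256 / 27 + 88 / 9 * 0 + 40 / 9 * 0 ^+ 2 + 20 / 27 * 0 ^+ 3)) *
    (- (16 / 9) + 0 * (32 / 9 - 20 / 9 * 0 + 4 / 9 * 0 ^+ 2)) = 1024%:R / 81%:R :> R by field.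
  by rewrite nz.
- rewrite dA0 dA1 /A /=.
  have -> : (16 / 9 + 0 * (32 / 9 + 20 / 9 * 0 + 4 / 9 * 0 ^+ 2)) * (256 / 27) -
    (32 / 9 + 0 * (256 / 27 + 88 / 9 * 0 + 40 / 9 * 0 ^+ 2 + 20 / 27 * 0 ^+ 3)) * (32 / 9)
    = 1024%:R / 243%:R :> R by field.
  by rewrite nz.
- rewrite dB0 dB1 /B /=.
  have -> : (- (16 / 9) + 0 * (32 / 9 - 20 / 9 * 0 + 4 / 9 * 0 ^+ 2)) * (- (256 / 27)) -
    (32 / 9 + 0 * (- (256 / 27) + 88 / 9 * 0 - 40 / 9 * 0 ^+ 2 + 20 / 27 * 0 ^+ 3)) * (32 / 9)
    = 1024%:R / 243%:R :> R by field.
  by rewrite nz.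
Qed.

Lemma cusp_model_sharksfin : A_equivalent cusp_model (@sharksfin_model R).
Proof.
exact: A_equivalent_sym sharksfin_model_smooth sharksfin_model0 sharksfin_cusp_model.
Qed.

End sharksfin.

(** * Necessity of the determinant conditions *)

Section germ_quotients.
Context {R : realType}.

Lemma hadamard2 (h : 'rV[R]_2 -> R) : smooth_at h 0 ->
  exists2 k : 'I_2 -> 'rV[R]_2 -> R, (forall i, smooth_at (k i) 0) &
    \forall p \near (0 : 'rV[R]_2),
      h p = h 0 + (p : 'rV[R]_2) 0 0 * k 0 p + p 0 1 * k 1 p.
Proof.
move=> sh; have [G sG HG] := hadamard_coord 0 sh.
have sa : smooth_at (fun y : R => h (axis 1 y)) 0.
  by apply: smooth_at_comp; [rewrite axis0|exact: smooth_at_axis].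
have [g sg Hg] := hadamard1 sa.
exists (fun i => if i == 0 then G else fun p => g (p 0 1)).
  move=> i; case: (i == 0) => //; apply: smooth_at_comp1_0 => //; first by smooth.
  by rewrite mxE.
apply: filterS2 HG (near_coord 1 Hg) => p /eqP + h2.
by rewrite subr_eq (@upd_axis _ 0 1) // h2 axis0 /= => /eqP ->; ring.
Qed.

Lemma curve_quotient (c : R -> 'rV[R]_2) : smooth_at c 0 -> c 0 = 0 ->
  exists2 m : 'I_2 -> R -> R, (forall k, smooth_at (m k) 0) &
    \forall x \near (0 : R), c x = row2 (x * m 0 x) (x * m 1 x).
Proof.
move=> /smooth_at_mxP sc c0.
have [m0 s0 H0] := hadamard1 (sc 0 0); have [m1 s1 H1] := hadamard1 (sc 0 1).
exists (fun k => if k == 0 then m0 else m1); first by move=> k; case: (k == 0).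
apply: filterS2 H0 H1 => x h0 h1; apply: rV2P; rewrite row2E.
  by rewrite h0 c0 mxE add0r.
by rewrite h1 c0 mxE add0r.
Qed.

Lemma annihilator (a0 a1 b0 b1 : R) : a0 * b1 - a1 * b0 = 0 ->
  exists l0 l1, [/\ ~ (l0 = 0 /\ l1 = 0), l0 * a0 + l1 * a1 = 0 & l0 * b0 + l1 * b1 = 0].
Proof.
move=> H; have [/andP[/eqP -> /eqP ->]|a] := boolP ((a0 == 0) && (a1 == 0)).
  have [/andP[/eqP -> /eqP ->]|b] := boolP ((b0 == 0) && (b1 == 0)).
    exists 1, 0; split; [|ring|ring].
    by case=> /eqP; rewrite oner_eq0.
  exists b1, (- b0); split; [|ring|ring].
  by case=> h /eqP; rewrite oppr_eq0 => /eqP h'; rewrite h h' eqxx in b.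
exists a1, (- a0); split; [|ring|].
  by case=> h /eqP; rewrite oppr_eq0 => /eqP h'; rewrite h h' eqxx in a.
by rewrite -[RHS]oppr0 -H; ring.
Qed.

End germ_quotients.

Section sharksfin_necessary.
Context {R : realType}.
Variables (F phi Phi : 'rV[R]_2 -> 'rV[R]_2).
Hypotheses (pF : prenormal F) (dphi : diffeo_germ phi) (dPhi : diffeo_germ Phi).
Hypothesis E : \forall p \near (0 : 'rV[R]_2), Phi (F p) = sharksfin_model (phi p).

Let M := @sharksfin_model R.
Let sF : smooth_at F 0. Proof. by case: pF. Qed.
Let F0 : F 0 = 0. Proof. by case: pF. Qed.
Let sphi := diffeo_germ_smooth dphi.
Let phi0 := diffeo_germ0 dphi.

(** Composed with the inverse of [Phi], the functional [(l0, l1)] becomes a function on the target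
    of the model. The [k i] are its Hadamard quotients and their values at 0 its linear part, which
    a diffeomorphism cannot make vanish. *)
Lemma sharksfin_functional (l0 l1 : R) :
  exists k : 'I_2 -> 'rV[R]_2 -> R, [/\ forall i, smooth_at (k i) 0,
    k 0 0 = 0 -> k 1 0 = 0 -> l0 = 0 /\ l1 = 0 &
    \forall p \near (0 : 'rV[R]_2), l0 * F p 0 0 + l1 * F p 0 1 =
      M (phi p) 0 0 * k 0 (M (phi p)) + M (phi p) 0 1 * k 1 (M (phi p))].
Proof.
have [Psi dPsi [PsiK PhiK]] := diffeo_germ_inv dPhi.
have sPsi := diffeo_germ_smooth dPsi; have Psi0 := diffeo_germ0 dPsi.
pose h (p : 'rV[R]_2) := l0 * Psi p 0 0 + l1 * Psi p 0 1.
have sPk k : smooth_at (fun p => Psi p 0 k) 0 by move/smooth_at_mxP: sPsi; exact.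
have sh : smooth_at h 0 by have := sPk 0; have := sPk 1 => ? ?; rewrite /h; smooth.
have h0 : h 0 = 0 by rewrite /h Psi0 !mxE !mulr0 addr0.
have [k sk Hk] := hadamard2 sh.
exists k; split=> //; last first.
  have sM : smooth_at (fun p => M (phi p)) 0.
    by apply: smooth_at_comp_rV => //; rewrite phi0; exact: sharksfin_model_smooth.
  have M0 : M (phi 0) = 0 by rewrite phi0; exact: sharksfin_model0.
  apply: filterS3 E (near_comp0 sF F0 PsiK) (near_comp0 sM M0 Hk) => p e1 e2.
  by rewrite h0 add0r => <-; rewrite /h /M -e1 e2.
(* On the [j]-th axis the composite of [h] with [Phi] is linear of slope [l_j], while the expansion
   of [h] with zero linear part makes this slope 0. *)
move=> k0 k1; suff l (j : 'I_2) : (if j == 0 then l0 else l1) = 0 by have := l 0; have := l 1.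
have sc : smooth_at (fun t : R => Phi (axis j t)) 0.
  by apply: smooth_at_comp_rV; [rewrite axis0; exact: diffeo_germ_smooth|exact: smooth_at_axis].
have c0 : Phi (axis j 0) = 0 by rewrite axis0 (diffeo_germ0 dPhi).
have [m sm Hm] := curve_quotient sc c0.
have skc i : smooth_at (fun t : R => k i (Phi (axis j t))) 0.
  by apply: smooth_at_comp => //; rewrite c0.
have := @smooth_at_eq0 _ (fun=> if j == 0 then l0 else l1)
  (fun t => m 0 t * k 0 (Phi (axis j t)) + m 1 t * k 1 (Phi (axis j t))).
rewrite c0 k0 k1 !mulr0 addr0; apply.
- exact: smooth_at_cst.
- have := sm 0; have := sm 1; have := skc 0; have := skc 1 => ? ? ? ?; smooth.
apply: filterS3 Hm (near_axis j PsiK) (near_comp0 sc c0 Hk) => t e1 e2 e3 t0.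
have P0 : Phi (axis j t) 0 0 = t * m 0 t by rewrite e1 row2E.
have P1 : Phi (axis j t) 0 1 = t * m 1 t by rewrite e1 row2E.
apply: (mulfI t0); move: e3; rewrite h0 add0r {1}/h e2 !axis_entry P0 P1 => e3.
rewrite mulrDr !mulrA -e3; case: (eqVneq j 0) => [->|/I2_neq0 ->] /=; ring.
Qed.

Variables (A B : 'I_2 -> R -> R) (C : 'I_2 -> 'rV[R]_2 -> R).
Hypotheses (sA : forall k, smooth_at (A k) 0) (sB : forall k, smooth_at (B k) 0).
Hypothesis sC : forall k, smooth_at (C k) 0.
Hypothesis FE : \forall p \near (0 : 'rV[R]_2), forall k,
  F p 0 k = p 0 0 ^+ 2 * A k (p 0 0) + p 0 1 ^+ 2 * B k (p 0 1) +
            p 0 0 ^+ 2 * p 0 1 ^+ 2 * C k p.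

(* Otherwise a combination of the components of [F] vanishes to order three,
   whereas no combination of the components of the model does. *)
Lemma sharksfin_independent : A 0 0 * B 1 0 - A 1 0 * B 0 0 != 0.
Proof.
apply/eqP => /annihilator [l0 [l1 [l lA lB]]]; apply: l.
have [k [sk kl Hk]] := sharksfin_functional l0 l1.
have [psi dpsi [psiK phiK]] := diffeo_germ_inv dphi.
have sl (D : 'I_2 -> R -> R) : (forall k, smooth_at (D k) 0) ->
    smooth_at (fun x => l0 * D 0 x + l1 * D 1 x) 0.
  by move=> sD; have := sD 0; have := sD 1 => ? ?; smooth.
have [a sa Ha] := hadamard1 (sl A sA).
have [b sb Hb] := hadamard1 (sl B sB).
(* Along the line [t (w0, w1)] the model is [t^2 (w0 w1, w0^2 + w1^2)] to leading order, whereas the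
   combination of the components of [F], carried over by [psi], is [O(t^3)]. Division by [t^2]
   leaves the quadratic form at [t = 0]. *)
have quad (w0 w1 : R) : w0 * w1 * k 0 0 + (w0 ^+ 2 + w1 ^+ 2) * k 1 0 = 0.
  pose w (t : R) := row2 (t * w0) (t * w1).
  have sw : smooth_at w 0 by rewrite /w; smooth.
  have w00 : w 0 = 0 by rewrite /w !mul0r row2_0.
  have spw : smooth_at (fun t : R => psi (w t)) 0.
    by apply: smooth_at_comp_rV => //; rewrite w00; exact: diffeo_germ_smooth.
  have pw0 : psi (w 0) = 0 by rewrite w00 (diffeo_germ0 dpsi).
  have [n sn Hn] := curve_quotient spw pw0.
  have spwk i : smooth_at (fun t => psi (w t) 0 i) 0 by move/smooth_at_mxP: spw; exact.
  have p0 i : psi (w 0) 0 i = 0 by rewrite pw0 mxE.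
  have sMw : smooth_at (fun t => M (w t)) 0.
    by apply: smooth_at_comp_rV => //; rewrite w00; exact: sharksfin_model_smooth.
  have Mw0 : M (w 0) = 0 by rewrite w00; exact: sharksfin_model0.
  have skM i : smooth_at (fun t => k i (M (w t))) 0.
    by apply: smooth_at_comp => //; rewrite Mw0.
  have sap := smooth_at_comp1_0 sa (spwk 0) (p0 0).
  have sbp := smooth_at_comp1_0 sb (spwk 1) (p0 1).
  have sCp i : smooth_at (fun t => C i (psi (w t))) 0.
    by apply: smooth_at_comp => //; rewrite pw0.
  pose S (t : R) := n 0 t ^+ 3 * a (psi (w t) 0 0) + n 1 t ^+ 3 * b (psi (w t) 0 1) +
    t * n 0 t ^+ 2 * n 1 t ^+ 2 * (l0 * C 0 (psi (w t)) + l1 * C 1 (psi (w t))).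
  have sS : smooth_at S 0.
    have := sn 0; have := sn 1; have := sCp 0; have := sCp 1 => ? ? ? ?.
    by rewrite /S; smooth.
  have := @smooth_at_eq0 _ (fun t => w0 * w1 * k 0 (M (w t)) +
    (w0 ^+ 2 + w1 ^+ 2 + t * w0 ^+ 3) * k 1 (M (w t))) (fun t => t * S t).
  rewrite Mw0 !mul0r addr0; apply.
  - by have := skM 0; have := skM 1 => ? ?; smooth.
  - by smooth.
  have n1 := near_comp0 spw pw0 (near_coord 0 Ha).
  have n2 := near_comp0 spw pw0 (near_coord 1 Hb).
  have n12 : \forall t \near (0 : R), (l0 * A 0 (psi (w t) 0 0) + l1 * A 1 (psi (w t) 0 0) =
      psi (w t) 0 0 * a (psi (w t) 0 0)) /\
    (l0 * B 0 (psi (w t) 0 1) + l1 * B 1 (psi (w t) 0 1) =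
      psi (w t) 0 1 * b (psi (w t) 0 1)).
    by apply: filterS2 n1 n2 => t -> ->; rewrite lA lB !add0r.
  have n3 := near_comp0 spw pw0 FE.
  have n4 := near_comp0 spw pw0 Hk.
  have n5 := near_comp0 sw w00 phiK.
  have n34 : \forall t \near (0 : R),
     l0 * (psi (w t) 0 0 ^+ 2 * A 0 (psi (w t) 0 0) + psi (w t) 0 1 ^+ 2 * B 0 (psi (w t) 0 1) +
       psi (w t) 0 0 ^+ 2 * psi (w t) 0 1 ^+ 2 * C 0 (psi (w t))) +
     l1 * (psi (w t) 0 0 ^+ 2 * A 1 (psi (w t) 0 0) + psi (w t) 0 1 ^+ 2 * B 1 (psi (w t) 0 1) +
       psi (w t) 0 0 ^+ 2 * psi (w t) 0 1 ^+ 2 * C 1 (psi (w t))) =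
     M (w t) 0 0 * k 0 (M (w t)) + M (w t) 0 1 * k 1 (M (w t)).
    by apply: filterS3 n3 n4 n5 => t e1 + e3; rewrite !e1 e3.
  apply: filterS3 n12 n34 Hn => t [e1 e2] e3 e4 t0.
  have P0 : psi (w t) 0 0 = t * n 0 t by rewrite e4 row2E.
  have P1 : psi (w t) 0 1 = t * n 1 t by rewrite e4 row2E.
  have M0 : M (w t) 0 0 = t ^+ 2 * (w0 * w1).
    by rewrite /M /sharksfin_model /w !row2E; ring.
  have M1 : M (w t) 0 1 = t ^+ 2 * (w0 ^+ 2 + w1 ^+ 2 + t * w0 ^+ 3).
    by rewrite /M /sharksfin_model /w !row2E; ring.
  apply: (mulfI (expf_neq0 2 t0)).
  transitivity (M (w t) 0 0 * k 0 (M (w t)) + M (w t) 0 1 * k 1 (M (w t))).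
    by rewrite {1}M0 {1}M1; move: (k 0 _) (k 1 _) => ? ?; ring.
  rewrite -e3.
  transitivity (psi (w t) 0 0 ^+ 2 * (psi (w t) 0 0 * a (psi (w t) 0 0)) +
    psi (w t) 0 1 ^+ 2 * (psi (w t) 0 1 * b (psi (w t) 0 1)) +
    psi (w t) 0 0 ^+ 2 * psi (w t) 0 1 ^+ 2 * (l0 * C 0 (psi (w t)) + l1 * C 1 (psi (w t)))).
    by rewrite -e1 -e2; ring.
  rewrite /S; move: (a _) (b _) (C 0 _) (C 1 _) => *; rewrite P0 P1.
  by move: (n 0 t) (n 1 t) => *; ring.
(* The direction [(1, 0)] isolates [k 1 0], and [(1, 1)] then gives [k 0 0]. *)
have k1 : k 1 0 = 0 by rewrite -(quad 1 0); ring.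
by apply: kl => //; rewrite -(quad 1 1) k1; ring.
Qed.

(* On an axis [c = phi o axis] runs in the singular set of the model, so that its
   two coordinates [x m0, x m1] satisfy [2 m1^2 = 2 m0^2 + 3 x m0^3]. *)
Lemma sharksfin_axis i j : i != j -> exists2 m : 'I_2 -> R -> R,
  (forall k, smooth_at (m k) 0) & m 0 0 != 0 /\
  \forall x \near (0 : R), phi (axis j x) = row2 (x * m 0 x) (x * m 1 x) /\
    (x != 0 -> 2 * m 1 x ^+ 2 = 2 * m 0 x ^+ 2 + 3 * x * m 0 x ^+ 3).
Proof.
move=> ij; have [psi dpsi [psiK _]] := diffeo_germ_inv dphi.
have spsi := diffeo_germ_smooth dpsi; have psi0 := diffeo_germ0 dpsi.
have sc : smooth_at (fun x : R => phi (axis j x)) 0.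
  by apply: smooth_at_comp_rV; [rewrite axis0|exact: smooth_at_axis].
have c0 : phi (axis j 0) = 0 by rewrite axis0.
have [m sm Hm] := curve_quotient sc c0.
have nK := near_axis j (near_join psiK).
have nsphi := near_axis j (smooth_at_near sphi).
have nspsi := near_comp0 sc c0 (smooth_at_near spsi).
have nE := near_axis j (near_join E).
have nsF := near_axis j (smooth_at_near sF).
have nsP := near_axis j (near_comp0 sF F0 (smooth_at_near (diffeo_germ_smooth dPhi))).
have dF : \forall x \near (0 : R), 'D_(delta_mx 0 i) F (axis j x) = 0.
  by case: pF => _ _; exact.
have ker : \forall x \near (0 : R), 'D_(delta_mx 0 i) (fun p => M (phi p)) (axis j x) = 0.
  apply: filterS2 nE (filterI dF (filterI nsF nsP)) => x e1 [e2 [e3 e4]].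
  rewrite -(near_eq_derive _ e1) derive_chain; last 2 first.
  - exact: smooth_at_differentiable.
  - exact: smooth_at_differentiable.
  by rewrite e2; exact: derive0.
have w_neq0 : \forall x \near (0 : R), 'D_(delta_mx 0 i) phi (axis j x) != 0.
  apply: filterS3 nK nsphi nspsi => x e1 e2 e3; apply/eqP => e4.
  have := near_eq_derive (delta_mx 0 i) e1.
  rewrite derive_chain; last 2 first.
  - exact: smooth_at_differentiable.
  - exact: smooth_at_differentiable.
  rewrite e4 derive0 derive_id => /rowP/(_ i); rewrite !mxE !eqxx => /eqP.
  by rewrite eq_sym oner_eq0.
have Hsing : \forall x \near (0 : R),
    2 * phi (axis j x) 0 1 ^+ 2 = 2 * phi (axis j x) 0 0 ^+ 2 + 3 * phi (axis j x) 0 0 ^+ 3.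
  apply: filterS3 ker w_neq0 nsphi => x e1 e2 e3.
  have dphix := smooth_at_differentiable e3.
  have sk k : smooth_at (fun p => phi p 0 k) (axis j x) by move/smooth_at_mxP: e3; exact.
  have s0 := sk 0; have s1 := sk 1.
  have sMphi : smooth_at (fun p => M (phi p)) (axis j x).
    by rewrite /M /sharksfin_model; smooth.
  have dM := smooth_at_differentiable sMphi.
  have := derive_mx_entry (delta_mx 0 i) 0 0 dM; rewrite e1 mxE.
  have := derive_mx_entry (delta_mx 0 i) 0 1 dM; rewrite e1 mxE.
  rewrite -!/(pd _ _ _).
  have -> : (fun p => M (phi p) 0 0) = (fun p => phi p 0 0 * phi p 0 1).
    by apply/funext => p; rewrite /M /sharksfin_model row2E.
  have -> : (fun p => M (phi p) 0 1) = (fun p => phi p 0 0 * phi p 0 0 + phi p 0 1 * phi p 0 1 +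
      phi p 0 0 * (phi p 0 0 * phi p 0 0)).
    by apply/funext => p; rewrite /M /sharksfin_model row2E; ring.
  have s00 : smooth_at (fun p => phi p 0 0 * phi p 0 0) (axis j x) by smooth.
  have s11 : smooth_at (fun p => phi p 0 1 * phi p 0 1) (axis j x) by smooth.
  have s01 : smooth_at (fun p => phi p 0 0 * phi p 0 0 + phi p 0 1 * phi p 0 1) (axis j x).
    by smooth.
  have s000 : smooth_at (fun p => phi p 0 0 * (phi p 0 0 * phi p 0 0)) (axis j x) by smooth.
  rewrite (pdD i s01 s000) (pdD i s00 s11) (pdM i s0 s0) (pdM i s1 s1) (pdM i s0 s00).
  rewrite (pdM i s0 s0) (pdM i s0 s1) /pd -!(derive_mx_entry _ _ _ dphix).
  move: e2; set w := 'D_ _ _ _; set q := phi _ => w0 e4 e5.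
  (* The Jacobian matrix of the model at [q] kills [w], so by Cramer's rule its determinant
     annihilates each entry of [w]. *)
  have H k : w 0 k * (2 * q 0 1 ^+ 2 - (2 * q 0 0 ^+ 2 + 3 * q 0 0 ^+ 3)) = 0.
    move: e4 e5; case: (eqVneq k 0) => [->|/I2_neq0 ->];
    move: (q 0 0) (q 0 1) (w 0 0) (w 0 1) => a b c d h1 h2.
      transitivity (- a * (0 : R) + 2 * b * 0); last by ring.
      by rewrite {1}h1 h2; ring.
    transitivity (b * (0 : R) - (2 * a + 3 * a ^+ 2) * 0); last by ring.
    by rewrite {1}h1 h2; ring.
  apply/eqP; rewrite -subr_eq0; apply: contraNT w0 => ne.
  apply/eqP/rV2P; rewrite mxE; apply/eqP.
    by have /eqP := H 0; rewrite mulf_eq0 (negbTE ne) orbF.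
  by have /eqP := H 1; rewrite mulf_eq0 (negbTE ne) orbF.
have Hrel : \forall x \near (0 : R), x != 0 ->
    2 * m 1 x ^+ 2 = 2 * m 0 x ^+ 2 + 3 * x * m 0 x ^+ 3.
  apply: filterS2 Hm Hsing => x -> + x0; rewrite !row2E => e.
  by apply: (mulfI (expf_neq0 2 x0)); move: e; move: (m 0 x) (m 1 x) => a b e;
    transitivity (2 * (x * b) ^+ 2); [ring|rewrite e; ring].
exists m => //; split; last by apply: filterS2 Hm Hrel.
(* If [m 0 0 = 0], the relation gives [m 1 0 = 0], so the image of the axis under [phi] has zero
   velocity at 0; this is impossible because [psi] maps it back to the axis. *)
apply/eqP => m00.
have rel0 := smooth_at_eq0 (f := fun x => 2 * m 1 x ^+ 2)
  (g := fun x => 2 * m 0 x ^+ 2 + 3 * x * m 0 x ^+ 3).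
have m10 : m 1 0 = 0.
  have s0 := sm 0; have s1 := sm 1.
  have /eqP : 2 * m 1 0 ^+ 2 = 2 * m 0 0 ^+ 2 + 3 * 0 * m 0 0 ^+ 3.
    by apply: rel0 Hrel; smooth.
  rewrite m00 mulr0 mul0r expr0n mulr0 addr0 mulf_eq0 pnatr_eq0 expf_eq0 /=.
  by move/eqP.
have spj : smooth_at (fun p => psi p 0 j) 0 by move/smooth_at_mxP: spsi; exact.
have [g sg Hg] := hadamard2 spj.
have sgc k : smooth_at (fun x : R => g k (phi (axis j x))) 0.
  by apply: smooth_at_comp => //; rewrite c0.
have := @smooth_at_eq0 _ (fun=> 1)
  (fun x => m 0 x * g 0 (phi (axis j x)) + m 1 x * g 1 (phi (axis j x))).
rewrite m00 m10 !mul0r addr0 => one0.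
have /eqP : (1 : R) = 0; last by rewrite oner_eq0.
apply: one0; [exact: smooth_at_cst| |].
  by have := sm 0; have := sm 1; have := sgc 0; have := sgc 1 => ? ? ? ?; smooth.
apply: filterS3 Hm (near_axis j psiK) (near_comp0 sc c0 Hg) => x e1 e2 e3 x0.
have P0 : phi (axis j x) 0 0 = x * m 0 x by rewrite e1 row2E.
have P1 : phi (axis j x) 0 1 = x * m 1 x by rewrite e1 row2E.
apply: (mulfI x0); move: e3; rewrite e2 psi0 axis_entry eqxx P0 P1 mxE add0r => e3.
by rewrite mulr1 mulrDr !mulrA.
Qed.

(* With [l] annihilating [G 0] and [G' 0], the composite of a function with
   linear part [k0, k1] with the model is [O(x^4)] along the axis, i.e.
   [k0 m0 m1 + k1 (2 m0^2 + 5/2 x m0^3) = O(x^2)]. Squaring to eliminate [m1],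
   the terms of order 0 and 1 give [k0^2 = 4 k1^2] and [k1 = 0]. *)
Lemma sharksfin_cusp i j (G : 'I_2 -> R -> R) : i != j ->
  (forall k, smooth_at (G k) 0) ->
  (\forall x \near (0 : R), F (axis j x) = row2 (x ^+ 2 * G 0 x) (x ^+ 2 * G 1 x)) ->
  G 0 0 * derive1 (G 1) 0 - G 1 0 * derive1 (G 0) 0 != 0.
Proof.
move=> ij sG HG.
have [g0 sg0 Hg0] := hadamard1 (sG 0); have [g1 sg1 Hg1] := hadamard1 (sG 1).
rewrite (hadamard1_derive sg0 Hg0) (hadamard1_derive sg1 Hg1).
apply/eqP => /annihilator [l0 [l1 [l lG lg]]]; apply: l.
have [k [sk kl Hk]] := sharksfin_functional l0 l1.
have [m sm [m00 Hm]] := sharksfin_axis ij.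
have sm0 := sm 0; have sm1 := sm 1.
have slg : smooth_at (fun x => l0 * g0 x + l1 * g1 x) 0 by smooth.
have [S sS HS] := hadamard1 slg.
have [r0 sr0 Hr0] := hadamard2 (sk 0); have [r1 sr1 Hr1] := hadamard2 (sk 1).
have sc : smooth_at (fun x : R => phi (axis j x)) 0.
  by apply: smooth_at_comp_rV; [rewrite axis0|exact: smooth_at_axis].
have c0 : phi (axis j 0) = 0 by rewrite axis0.
have sMc : smooth_at (fun x : R => M (phi (axis j x))) 0.
  by apply: smooth_at_comp_rV => //; rewrite c0; exact: sharksfin_model_smooth.
have Mc0 : M (phi (axis j 0)) = 0 by rewrite c0; exact: sharksfin_model0.
pose N (x : R) := m 0 x ^+ 2 + m 1 x ^+ 2 + x * m 0 x ^+ 3.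
have sN : smooth_at N 0 by rewrite /N; smooth.
(* Along the curve the model equals [x^2 (m0 m1, N)], so the nonconstant parts of [k 0] and [k 1]
   contribute with an additional factor [x^2]. They are collected in [q] and moved into the
   remainder [T]. *)
pose q (r : 'I_2 -> 'rV[R]_2 -> R) (x : R) :=
  m 0 x * m 1 x * r 0 (M (phi (axis j x))) + N x * r 1 (M (phi (axis j x))).
have sq r : (forall i, smooth_at (r i) 0) -> smooth_at (q r) 0.
  move=> sr; have s k' : smooth_at (fun x : R => r k' (M (phi (axis j x)))) 0.
    by apply: smooth_at_comp => //; rewrite Mc0.
  by have := s 0; have := s 1 => ? ?; rewrite /q; smooth.
have sq0 := sq _ sr0; have sq1 := sq _ sr1.
pose T (x : R) := S x - m 0 x * m 1 x * q r0 x - N x * q r1 x.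
have sT : smooth_at T 0 by rewrite /T; smooth.
set a := k 0 0 in kl Hr0; set b := k 1 0 in kl Hr1.
have key : \forall x \near (0 : R), x != 0 ->
    a * (m 0 x * m 1 x) + b * N x = x ^+ 2 * T x.
  have n1 : \forall x \near (0 : R),
      k 0 (M (phi (axis j x))) = a + M (phi (axis j x)) 0 0 * r0 0 (M (phi (axis j x))) +
        M (phi (axis j x)) 0 1 * r0 1 (M (phi (axis j x))) /\
      k 1 (M (phi (axis j x))) = b + M (phi (axis j x)) 0 0 * r1 0 (M (phi (axis j x))) +
        M (phi (axis j x)) 0 1 * r1 1 (M (phi (axis j x))).
    by apply: filterS2 (near_comp0 sMc Mc0 Hr0) (near_comp0 sMc Mc0 Hr1).
  have n2 : \forall x \near (0 : R),
      l0 * (x ^+ 2 * G 0 x) + l1 * (x ^+ 2 * G 1 x) = x ^+ 4 * S x.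
    apply: filterS3 Hg0 Hg1 HS => x e4 e5 e6.
    transitivity (x ^+ 2 * ((l0 * G 0 0 + l1 * G 1 0) + x * (l0 * g0 x + l1 * g1 x))).
      by rewrite e4 e5; ring.
    by rewrite lG e6 lg; ring.
  have n3 : \forall x \near (0 : R), l0 * (x ^+ 2 * G 0 x) + l1 * (x ^+ 2 * G 1 x) =
      M (phi (axis j x)) 0 0 * k 0 (M (phi (axis j x))) +
      M (phi (axis j x)) 0 1 * k 1 (M (phi (axis j x))).
    by apply: filterS2 (near_axis j Hk) HG => x <- ->; rewrite !row2E.
  have n23 : \forall x \near (0 : R), x ^+ 4 * S x =
      M (phi (axis j x)) 0 0 * k 0 (M (phi (axis j x))) +
      M (phi (axis j x)) 0 1 * k 1 (M (phi (axis j x))).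
    by apply: filterS2 n2 n3 => x ->.
  apply: filterS3 n1 n23 Hm => x [e1 e2] e7 [e3 _] x0.
  have M0 : M (phi (axis j x)) 0 0 = x ^+ 2 * (m 0 x * m 1 x).
    by rewrite e3 /M /sharksfin_model !row2E; ring.
  have M1 : M (phi (axis j x)) 0 1 = x ^+ 2 * N x.
    by rewrite e3 /M /sharksfin_model !row2E /N; ring.
  move: e7; rewrite e1 e2 !M0 !M1 => e7.
  apply: (mulfI (expf_neq0 2 x0)).
  transitivity (x ^+ 4 * S x - x ^+ 4 * (m 0 x * m 1 x * q r0 x + N x * q r1 x)).
    rewrite e7 /q; move: (r0 0 _) (r0 1 _) (r1 0 _) (r1 1 _) (N x) (m 0 x) (m 1 x) => *; ring.
  by rewrite /T; move: (S x) (q r0 x) (q r1 x) => *; ring.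
have key2 : \forall x \near (0 : R), x != 0 ->
    a ^+ 2 * (m 0 x ^+ 4 * (1 + 3 / 2 * x * m 0 x)) =
    (x ^+ 2 * T x - b * (m 0 x ^+ 2 * (2 + 5 / 2 * x * m 0 x))) ^+ 2.
  apply: filterS2 key Hm => x e1 [_ e2] x0.
  rewrite -(e1 x0) /N.
  have e3 : m 1 x ^+ 2 = m 0 x ^+ 2 + 3 / 2 * x * m 0 x ^+ 3.
    by have := e2 x0; move: (m 0 x) (m 1 x) => u v h; lra.
  transitivity (a ^+ 2 * m 0 x ^+ 2 * m 1 x ^+ 2); first by rewrite e3; field.
  rewrite e3; move: (m 0 x) (m 1 x) e3 => u v e3.
  have -> : a * (u * v) + b * (u ^+ 2 + (u ^+ 2 + 3 / 2 * x * u ^+ 3) + x * u ^+ 3) -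
    b * (u ^+ 2 * (2 + 5 / 2 * x * u)) = a * (u * v) by field.
  by rewrite !exprMn e3; ring.
have ab : a ^+ 2 = 4 * b ^+ 2.
  have := smooth_at_eq0 (f := fun x => a ^+ 2 * (m 0 x ^+ 4 * (1 + 3 / 2 * x * m 0 x)))
    (g := fun x => (x ^+ 2 * T x - b * (m 0 x ^+ 2 * (2 + 5 / 2 * x * m 0 x))) ^+ 2).
  have s1 : smooth_at (fun x : R => a ^+ 2 * (m 0 x ^+ 4 * (1 + 3 / 2 * x * m 0 x))) 0 by smooth.
  have s2 : smooth_at (fun x : R => (x ^+ 2 * T x -
    b * (m 0 x ^+ 2 * (2 + 5 / 2 * x * m 0 x))) ^+ 2) 0 by smooth.
  move=> /(_ s1 s2 key2) e; apply: (mulIf (expf_neq0 4 m00)).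
  transitivity (a ^+ 2 * (m 0 0 ^+ 4 * (1 + 3 / 2 * 0 * m 0 0))); first by ring.
  by rewrite e; ring.
(* After [ab] the constant terms of [key2] cancel. The terms of first order, [6 b^2 m0^5] and
   [10 b^2 m0^5], combine to [- 4 b^2 m0^5], and [U] is the rest divided by [x]. *)
pose U (x : R) := x * T x ^+ 2 * x ^+ 2 - 2 * x * T x * b * (m 0 x ^+ 2 * (2 + 5 / 2 * x * m 0 x)) +
  x * b ^+ 2 * (25 / 4) * m 0 x ^+ 6.
have sU : smooth_at U 0 by rewrite /U; smooth.
have b0 : b = 0.
  have s1 : smooth_at (fun x : R => - 4 * b ^+ 2 * m 0 x ^+ 5) 0 by smooth.
  have : - 4 * b ^+ 2 * m 0 0 ^+ 5 = U 0.
    apply: (smooth_at_eq0 s1 sU).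
    apply: filterS key2 => x + x0 => /(_ x0); rewrite ab /U.
    move: (m 0 x) (T x) => u t e; apply: (mulfI x0).
    by move: e; move: (b) => c e; lra.
  rewrite /U !mul0r !mulr0 !mul0r subr0 addr0 => /eqP.
  rewrite mulf_eq0 (negbTE (expf_neq0 5 m00)) orbF mulf_eq0 oppr_eq0 pnatr_eq0 /= sqrf_eq0.
  by move/eqP.
apply: kl => //; move: ab; rewrite b0 expr0n mulr0 => /eqP.
by rewrite sqrf_eq0 => /eqP.
Qed.

End sharksfin_necessary.

(** * Composite motions *)

Section composite_motion_germ.
Context {R : realType}.

Lemma det3 (a b c d e f g h i : R) :
  \det (mx_of_seqs 3 3 [:: [:: a; b; c]; [:: d; e; f]; [:: g; h; i]]) =
  a * (e * i - f * h) - b * (d * i - f * g) + c * (d * h - e * g).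
Proof.
have det2 (A : 'M[R]_2) : \det A = A 0 0 * A 1 1 - A 0 1 * A 1 0.
  rewrite (expand_det_row _ 0) sum_I2 /cofactor !det_mx11 !mxE /=.
  have -> : lift 0 0 = 1 :> 'I_2 by exact: val_inj.
  have -> : lift 1 0 = 0 :> 'I_2 by exact: val_inj.
  by rewrite expr0 expr1; ring.
rewrite (expand_det_row _ 0) !big_ord_recl big_ord0 /cofactor !det2 !mxE /=.
by rewrite /bump /=; ring.
Qed.

Lemma trig_quotients : exists c s : R -> R, [/\ smooth_at c 0, smooth_at s 0 &
  \forall t \near (0 : R), cos t = 1 + t ^+ 2 * c t /\ sin t = t + t ^+ 2 * s t].
Proof.
have [k sk Hk] := hadamard1 (smooth_at_cos (0 : R)).
have [l sl Hl] := hadamard1 (smooth_at_sin (0 : R)).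
have k0 : k 0 = 0.
  rewrite -(hadamard1_derive sk Hk) derive1E.
  by have [_ ->] := is_derive_cos (0 : R); rewrite sin0 oppr0.
have l0 : l 0 = 1.
  rewrite -(hadamard1_derive sl Hl) derive1E.
  by have [_ ->] := is_derive_sin (0 : R); rewrite cos0.
have [c sc Hc] := hadamard1 sk; have [s ss Hs] := hadamard1 sl.
exists c, s; split=> //.
apply: filterS2 (filterI Hk Hl) (filterI Hc Hs) => t [-> ->] [-> ->].
by rewrite cos0 sin0 k0 l0; split; ring.
Qed.

Lemma rotmx_row (x y t : R) :
  row2 x y *m (rotmx t)^T = row2 (cos t * x - sin t * y) (sin t * x + cos t * y).
Proof. by apply: rV2P; rewrite !mxE sum_I2 !mxE /=; ring. Qed.

Variables (w1 w2 : R) (c s : R -> R).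
Hypotheses (sc : smooth_at c 0) (ss : smooth_at s 0).
Hypothesis Hcs : \forall t \near (0 : R),
  cos t = 1 + t ^+ 2 * c t /\ sin t = t + t ^+ 2 * s t.

(** The displacement of the point [(w1, w2)] divided by [u^2]: the velocity [a + p (-w2, w1)] plus
    the contribution of the second-order remainders of cosine and sine. The latter has a factor
    [u^2], so it affects neither the value nor the first derivative at 0. *)
Definition point_coef (a1 a2 p : R -> R) (k : 'I_2) (u : R) : R :=
  let t := u ^+ 2 * p u in
  if k == 0 then a1 u - p u * w2 + u * (u * p u ^+ 2 * (c t * w1 - s t * w2))
  else a2 u + p u * w1 + u * (u * p u ^+ 2 * (s t * w1 + c t * w2)).

Section coef.
Variables (a1 a2 p : R -> R).
Hypotheses (sa1 : smooth_at a1 0) (sa2 : smooth_at a2 0) (sp : smooth_at p 0).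

Let st : smooth_at (fun u : R => u ^+ 2 * p u) 0. Proof. by smooth. Qed.
Let t0 : (0 : R) ^+ 2 * p 0 = 0. Proof. by rewrite expr0n mul0r. Qed.
Let sct := smooth_at_comp1_0 sc st t0.
Let sst := smooth_at_comp1_0 ss st t0.

Lemma smooth_at_point_coef k : smooth_at (point_coef a1 a2 p k) 0.
Proof.
have := sct; have := sst => ? ?.
by rewrite /point_coef; case: (k == 0); smooth.
Qed.

Lemma point_coef0 :
  point_coef a1 a2 p 0 0 = a1 0 - p 0 * w2 /\ point_coef a1 a2 p 1 0 = a2 0 + p 0 * w1.
Proof. by rewrite /point_coef /= !mul0r !addr0. Qed.

Lemma derive1_point_coef :
  derive1 (point_coef a1 a2 p 0) 0 = derive1 a1 0 - derive1 p 0 * w2 /\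
  derive1 (point_coef a1 a2 p 1) 0 = derive1 a2 0 + derive1 p 0 * w1.
Proof.
have [g1 sg1 H1] := hadamard1 sa1; have [g2 sg2 H2] := hadamard1 sa2.
have [h sh H] := hadamard1 sp; have := sct; have := sst => ? ?.
rewrite (hadamard1_derive sg1 H1) (hadamard1_derive sg2 H2) (hadamard1_derive sh H).
have [e0 e1] := point_coef0; split.
  rewrite (@hadamard1_derive _ _ (fun u => g1 u - h u * w2 +
    u * p u ^+ 2 * (c (u ^+ 2 * p u) * w1 - s (u ^+ 2 * p u) * w2))).
  - by rewrite !mul0r addr0.
  - by smooth.
  apply: filterS2 H1 H => u h1 h2; rewrite e0 /point_coef /= {1}h1 {1}h2.
  by move: (c _) (s _) => *; ring.
rewrite (@hadamard1_derive _ _ (fun u => g2 u + h u * w1 +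
  u * p u ^+ 2 * (s (u ^+ 2 * p u) * w1 + c (u ^+ 2 * p u) * w2))).
- by rewrite !mul0r addr0.
- by smooth.
apply: filterS2 H2 H => u h1 h2; rewrite e1 /point_coef /= {1}h1 {1}h2.
by move: (c _) (s _) => *; ring.
Qed.

Lemma se2_act_expansion : \forall u \near (0 : R),
  se2_act (se2_of_angle (row2 (u ^+ 2 * a1 u) (u ^+ 2 * a2 u)) (u ^+ 2 * p u)) (row2 w1 w2) =
  row2 (w1 + u ^+ 2 * point_coef a1 a2 p 0 u) (w2 + u ^+ 2 * point_coef a1 a2 p 1 u).
Proof.
apply: filterS (near_comp0 st t0 Hcs) => u [h1 h2].
rewrite /se2_act /= rotmx_row h1 h2 /point_coef /=.
by apply: rV2P; rewrite rV_entryD !row2E; move: (c _) (s _) => *; ring.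
Qed.

End coef.

(** The displacement [u^2 A u] caused by [alpha] is rotated by [beta]. This is the rotation by [t]
    minus the identity, divided by [v^2] and applied to [A u]. *)
Definition mixed_coef (q : R -> R) (A : 'I_2 -> R -> R) (k : 'I_2) (x : 'rV[R]_2) : R :=
  let t := x 0 1 ^+ 2 * q (x 0 1) in
  if k == 0
  then q (x 0 1) * (t * c t * A 0 (x 0 0) - (1 + t * s t) * A 1 (x 0 0))
  else q (x 0 1) * ((1 + t * s t) * A 0 (x 0 0) + t * c t * A 1 (x 0 0)).

Lemma smooth_at_mixed_coef q A k : smooth_at q 0 -> (forall k, smooth_at (A k) 0) ->
  smooth_at (mixed_coef q A k) 0.
Proof.
move=> sq sA; have z j : (0 : 'rV[R]_2) 0 j = 0 by rewrite mxE.
have sx j : smooth_at (fun x : 'rV[R]_2 => x 0 j) 0 by exact: smooth_at_coord.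
have sqx := smooth_at_comp1_0 sq (sx 1) (z 1).
have sA0 := smooth_at_comp1_0 (sA 0) (sx 0) (z 0).
have sA1 := smooth_at_comp1_0 (sA 1) (sx 0) (z 0).
have st : smooth_at (fun x : 'rV[R]_2 => x 0 1 ^+ 2 * q (x 0 1)) 0 by smooth.
have t0 : (0 : 'rV[R]_2) 0 1 ^+ 2 * q ((0 : 'rV[R]_2) 0 1) = 0 by rewrite z expr0n mul0r.
have sct := smooth_at_comp1_0 sc st t0; have sst := smooth_at_comp1_0 ss st t0.
by rewrite /mixed_coef; case: (k == 0); smooth.
Qed.

Variables (alpha beta : R -> se2 R) (a1 a2 p b1 b2 q : R -> R).
Hypotheses (sp : smooth_at p 0) (sq : smooth_at q 0).
Hypothesis alphaE : \forall u \near (0 : R), alpha u =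
  se2_of_angle (row2 (u ^+ 2 * a1 u) (u ^+ 2 * a2 u)) (u ^+ 2 * p u).
Hypothesis betaE : \forall v \near (0 : R), beta v =
  se2_of_angle (row2 (v ^+ 2 * b1 v) (v ^+ 2 * b2 v)) (v ^+ 2 * q v).

Let f := ev (row2 w1 w2) \o composite_motion alpha beta.
Let A := point_coef a1 a2 p.
Let B := point_coef b1 b2 q.
Let C := mixed_coef q A.

Lemma se2_act_mul (g h : se2 R) x : se2_act (se2_mul g h) x = se2_act g (se2_act h x).
Proof. by rewrite /se2_act /= trmx_mul mulmxDl mulmxA -addrA [se2_trans g + _]addrC. Qed.

Lemma composite_motion_expansion : \forall x \near (0 : 'rV[R]_2),
  f x = row2 w1 w2 + row2
    (x 0 0 ^+ 2 * A 0 (x 0 0) + x 0 1 ^+ 2 * B 0 (x 0 1) + x 0 0 ^+ 2 * x 0 1 ^+ 2 * C 0 x)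
    (x 0 0 ^+ 2 * A 1 (x 0 0) + x 0 1 ^+ 2 * B 1 (x 0 1) + x 0 0 ^+ 2 * x 0 1 ^+ 2 * C 1 x).
Proof.
have nA : \forall u \near (0 : R), se2_act (alpha u) (row2 w1 w2) =
    row2 (w1 + u ^+ 2 * A 0 u) (w2 + u ^+ 2 * A 1 u).
  by apply: filterS2 alphaE (se2_act_expansion a1 a2 sp) => u ->.
have st : smooth_at (fun u : R => u ^+ 2 * q u) 0 by smooth.
have t0 : (0 : R) ^+ 2 * q 0 = 0 by rewrite expr0n mul0r.
(* The neighborhood of [v = 0] does not depend on the displacement [(y, z)], for which [u^2 A u] is
   substituted afterwards. *)
have nB : \forall v \near (0 : R), forall y z, se2_act (beta v) (row2 (w1 + y) (w2 + z)) =
    row2 (w1 + v ^+ 2 * B 0 v + (y + v ^+ 2 * q v *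
        (v ^+ 2 * q v * c (v ^+ 2 * q v) * y - (1 + v ^+ 2 * q v * s (v ^+ 2 * q v)) * z)))
      (w2 + v ^+ 2 * B 1 v + (z + v ^+ 2 * q v *
        ((1 + v ^+ 2 * q v * s (v ^+ 2 * q v)) * y + v ^+ 2 * q v * c (v ^+ 2 * q v) * z))).
  apply: filterS2 betaE (near_comp0 st t0 Hcs) => v -> [h1 h2] y z.
  rewrite /se2_act /= rotmx_row h1 h2 /B /point_coef /=.
  by apply: rV2P; rewrite rV_entryD !row2E; move: (c _) (s _) => *; ring.
apply: filterS2 (near_coord 0 nA) (near_coord 1 nB) => x e1 e2.
rewrite /f /= /ev /composite_motion se2_act_mul e1 e2 /C /mixed_coef /=.
by apply: rV2P; rewrite rV_entryD !row2E; move: (c _) (s _) (A 0 _) (A 1 _) (B _ _) => *; ring.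
Qed.

Let F := fun x => f x - f 0.

Lemma composite_motion_form : \forall x \near (0 : 'rV[R]_2), forall k,
  F x 0 k = x 0 0 ^+ 2 * A k (x 0 0) + x 0 1 ^+ 2 * B k (x 0 1) +
            x 0 0 ^+ 2 * x 0 1 ^+ 2 * C k x.
Proof.
have f0 : f 0 = row2 w1 w2.
  by rewrite (nbhs_singleton composite_motion_expansion) !mxE !expr0n /= !mul0r !addr0 row2_0 addr0.
apply: filterS composite_motion_expansion => x e k.
rewrite /F f0 e addrC addKr.
by case: (eqVneq k 0) => [->|/I2_neq0 ->]; rewrite row2E.
Qed.

End composite_motion_germ.

(** The origin lies on both axes, so each basis vector is there the kernel direction of one of
    them. *)
Lemma prenormal_corank2 (R : realType) (f : 'rV[R]_2 -> 'rV[R]_2) :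
  prenormal (fun x => f x - f 0) -> corank2_singular_at0 f.
Proof.
move=> [sF _ dF]; have sf : smooth_at f 0.
  apply: smooth_at_eq (smooth_atD sF (smooth_at_cst (f 0) (0 : 'rV[R]_2))).
  by apply: filterE => x; rewrite subrK.
split=> //; suff -> : jacobian f 0 = 0 by exact: mxrank0.
apply/matrixP => i k; rewrite !mxE -deriveE; last exact: smooth_at_differentiable.
have [j ij] : exists j, i != j.
  by case: (eqVneq i 0) => [->|i0]; [exists 1|exists 0].
have := nbhs_singleton (dF i j ij); rewrite axis0 => d0.
have df : derivable f 0 (delta_mx 0 i) := diff_derivable (smooth_at_differentiable sf).
have := deriveB df (derivable_cst (f 0) 0 (delta_mx 0 i)).
by rewrite derive_cst subr0 => <-; rewrite d0 mxE.
Qed.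

Theorem theorem3p6 (R : realType) (w1 w2 : R) (alpha beta : R -> se2 R)
    (a1 a2 p b1 b2 q : R -> R)
    (ha : se2_curve_germ alpha) (hb : se2_curve_germ beta)
    (sa : se2_singular_at0 alpha) (sb : se2_singular_at0 beta)
    (sm_a1 : smooth_at a1 0) (sm_a2 : smooth_at a2 0) (sm_p : smooth_at p 0)
    (sm_b1 : smooth_at b1 0) (sm_b2 : smooth_at b2 0) (sm_q : smooth_at q 0)
    (alphaE : \forall u \near (0 : R), alpha u =
      se2_of_angle (row2 (u ^+ 2 * a1 u) (u ^+ 2 * a2 u)) (u ^+ 2 * p u))
    (betaE : \forall v \near (0 : R), beta v =
      se2_of_angle (row2 (v ^+ 2 * b1 v) (v ^+ 2 * b2 v)) (v ^+ 2 * q v)) :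
  let f := ev (row2 w1 w2) \o composite_motion alpha beta in
  corank2_singular_at0 f /\
  (sharksfin_at0 f <->
    [/\ \det (mx_of_seqs 3 3 [:: [:: 1;   w2;   - w1];
                                 [:: p 0; a1 0; a2 0];
                                 [:: q 0; b1 0; b2 0]]) != 0,
        \det (mx_of_seqs 3 3 [:: [:: 1;           w2;           - w1];
                                 [:: p 0;         a1 0;         a2 0];
                                 [:: derive1 p 0; derive1 a1 0; derive1 a2 0]]) != 0 &
        \det (mx_of_seqs 3 3 [:: [:: 1;           w2;           - w1];
                                 [:: q 0;         b1 0;         b2 0];
                                 [:: derive1 q 0; derive1 b1 0; derive1 b2 0]]) != 0]).
Proof.
move=> f; have [c [s [sc ss Hcs]]] := @trig_quotients R.
have [A00 A10] := point_coef0 w1 w2 c s a1 a2 p.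
have [B00 B10] := point_coef0 w1 w2 c s b1 b2 q.
have [dA0 dA1] := derive1_point_coef w1 w2 sc ss sm_a1 sm_a2 sm_p.
have [dB0 dB1] := derive1_point_coef w1 w2 sc ss sm_b1 sm_b2 sm_q.
have sA := smooth_at_point_coef w1 w2 sc ss sm_a1 sm_a2 sm_p.
have sB := smooth_at_point_coef w1 w2 sc ss sm_b1 sm_b2 sm_q.
have sC k := smooth_at_mixed_coef sc ss k sm_q sA.
have FE := composite_motion_form w1 w2 Hcs sm_p sm_q alphaE betaE.
set A := point_coef w1 w2 c s a1 a2 p in A00 A10 dA0 dA1 sA sC FE.
set B := point_coef w1 w2 c s b1 b2 q in B00 B10 dB0 dB1 sB FE.
have pF := prenormal_form sA sB sC FE.
(* Clearing the first column with the row [(1, w2, -w1)] turns the other rows into the vectors [A]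
   and [B] at 0, or their derivatives in [d2] and [d3], and leaves a 2x2 determinant. *)
have d1 : \det (mx_of_seqs 3 3 [:: [:: 1; w2; - w1]; [:: p 0; a1 0; a2 0];
    [:: q 0; b1 0; b2 0]]) = A 0 0 * B 1 0 - A 1 0 * B 0 0.
  by rewrite det3 A00 A10 B00 B10; ring.
have d2 : \det (mx_of_seqs 3 3 [:: [:: 1; w2; - w1]; [:: p 0; a1 0; a2 0];
    [:: derive1 p 0; derive1 a1 0; derive1 a2 0]]) =
    A 0 0 * derive1 (A 1) 0 - A 1 0 * derive1 (A 0) 0.
  rewrite det3 A00 A10 dA0 dA1.
  by move: (derive1 p 0) (derive1 a1 0) (derive1 a2 0) => *; ring.
have d3 : \det (mx_of_seqs 3 3 [:: [:: 1; w2; - w1]; [:: q 0; b1 0; b2 0];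
    [:: derive1 q 0; derive1 b1 0; derive1 b2 0]]) =
    B 0 0 * derive1 (B 1) 0 - B 1 0 * derive1 (B 0) 0.
  rewrite det3 B00 B10 dB0 dB1.
  by move: (derive1 q 0) (derive1 b1 0) (derive1 b2 0) => *; ring.
have [sf rf] := prenormal_corank2 pF.
rewrite d1 d2 d3; split=> //; split=> [[_ [phi [Phi [dphi dPhi E]]]]|[n1 n2 n3]].
  split.
  - exact: (sharksfin_independent pF dphi dPhi E sA sB sC FE).
  - exact: (sharksfin_cusp pF dphi dPhi E (i := 1) (j := 0) isT sA
      (prenormal_form_axis0 FE)).
  - exact: (sharksfin_cusp pF dphi dPhi E (i := 0) (j := 1) isT sB
      (prenormal_form_axis1 FE)).
split=> //; apply: A_equivalent_trans cusp_model_sharksfin.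
exact: (prenormal_form_equiv sA sB sC FE).
Qed.
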